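(* Let $\mathsf{K}$ be any one of the following classes of logics: algebraizable, equivalential, weakly algebraizable, protoalgebraic, truth-equational. Then the decision problem ''given a finite reduced matrix $\langle \mathbf{A}, F\rangle$ of finite type, does the logic determined by $\langle \mathbf{A}, F\rangle$ belong to $\mathsf{K}$?'' is hard for $\mathbf{EXPTIME}$ (under polynomial-time many-one reductions).
   Context: A (logical) matrix is a pair $\langle \mathbf{A}, F\rangle$ with $\mathbf{A}$ an algebra and $F \subseteq A$. A congruence $\theta$ of $\mathbf{A}$ is compatible with $F$ if $F$ is a union of $\theta$-blocks; the Leibniz congruence $\Omega^{\mathbf{A}}F$ is the largest congruence of $\mathbf{A}$ compatible with $F$. The matrix is reduced if $\Omega^{\mathbf{A}}F$ is the identity relation. A logic $\vdash$ is a substitution-invariant closure relation on the set of formulas (terms over a countable set of variables) of a fixed algebraic language. A class $\mathsf{M}$ of matrices determines the logic $\vdash_{\mathsf{M}}$: $\Gamma \vdash_{\mathsf{M}} \varphi$ iff for every $\langle \mathbf{A},F\rangle\in\mathsf{M}$ and every evaluation $f$ of formulas into $\mathbf{A}$, $f[\Gamma]\subseteq F$ implies $f(\varphi)\in F$. A matrix $\langle \mathbf{A},F\rangle$ is a model of $\vdash$ if $\vdash \subseteq \vdash_{\langle \mathbf{A},F\rangle}$; $\mathrm{Mod}^{*}(\vdash)$ denotes the class of reduced models. $\vdash$ is protoalgebraic if there is a set of formulas $\Delta(x,y,\vec z)$ such that for every model $\langle \mathbf{A},F\rangle$ of $\vdash$ and $a,b\in A$: $\langle a,b\rangle\in\Omega^{\mathbf{A}}F$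 iff $\Delta(a,b,\vec c)\subseteq F$ for all $\vec c\in A$. $\vdash$ is equivalential if such a $\Delta$ exists without parameters $\vec z$. $\vdash$ is truth-equational if there is a set of equations $\tau(x)$ such that for every $\langle \mathbf{A},F\rangle\in\mathrm{Mod}^{*}(\vdash)$, $F=\{a\in A:\mathbf{A}\vDash\tau(a)\}$. $\vdash$ is algebraizable (resp. weakly algebraizable) if it is equivalential (resp. protoalgebraic) and truth-equational. A finite matrix of finite type (finitely many basic operations) is encoded as follows: $A=\{1,\dots,n\}$ is given by $n$; each $k$-ary operation is given as the list of its $n^{k}$ values; $F$ is given by a number $m\le n$ meaning $F=\{1,\dots,m\}$. Input length is the length of this encoding. *)

(* Defs.v *)
From mathcomp Require Import all_boot.
Set Implicit Arguments. Unset Strict Implicit. Unset Printing Implicit Defensive.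

Inductive move := MLeft | MRight | MStay.

Record TM (Sin Sout : finType) := {
  tm_Q : finType;
  tm_G : finType;
  tm_blank : tm_G;
  tm_in : Sin -> tm_G;
  tm_out : tm_G -> option Sout;
  tm_start : tm_Q;
  tm_halt : tm_Q -> bool;
  tm_accept : tm_Q -> bool;
  tm_delta : tm_Q -> tm_G -> tm_Q * tm_G * move }.

Arguments tm_Q {Sin Sout} t.
Arguments tm_G {Sin Sout} t.
Arguments tm_blank {Sin Sout} t.
Arguments tm_in {Sin Sout} t _.
Arguments tm_out {Sin Sout} t _.
Arguments tm_start {Sin Sout} t.
Arguments tm_halt {Sin Sout} t _.
Arguments tm_accept {Sin Sout} t _.
Arguments tm_delta {Sin Sout} t _ _.

(* configuration: state, cells left of the head (nearest first),
   cells from the head rightwards (head cell first); missing cells are blank *)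
Definition config Sin Sout (M : TM Sin Sout) : Type :=
  (tm_Q M * seq (tm_G M) * seq (tm_G M))%type.

Definition tm_step Sin Sout (M : TM Sin Sout) (c : config M) : config M :=
  let: (q, l, r) := c in
  if tm_halt M q then c else
  let: (q', g', mv) := tm_delta M q (head (tm_blank M) r) in
  match mv with
  | MStay => (q', l, g' :: behead r)
  | MRight => (q', g' :: l, behead r)
  | MLeft => (q', behead l, head (tm_blank M) l :: g' :: behead r)
  end.

Definition tm_init Sin Sout (M : TM Sin Sout) (w : seq Sin) : config M :=
  (tm_start M, [::], map (tm_in M) w).

Definition tm_run Sin Sout (M : TM Sin Sout) (t : nat) (w : seq Sin) : config M :=
  iter t (@tm_step Sin Sout M) (tm_init M w).

Fixpoint tm_readout Sin Sout (M : TM Sin Sout) (s : seq (tm_G M)) : seq Sout :=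
  match s with
  | [::] => [::]
  | g :: s' => match tm_out M g with
               | Some o => o :: @tm_readout Sin Sout M s'
               | None => [::]
               end
  end.

Definition decides_in_time Sin Sout (M : TM Sin Sout) (L : seq Sin -> Prop)
    (T : nat -> nat) : Prop :=
  forall w, let: (q, _, _) := tm_run M (T (size w)) w in
            tm_halt M q /\ (tm_accept M q <-> L w).

Definition computes_in_time Sin Sout (M : TM Sin Sout) (f : seq Sin -> seq Sout)
    (T : nat -> nat) : Prop :=
  forall w, let: (q, _, r) := tm_run M (T (size w)) w in
            tm_halt M q /\ @tm_readout Sin Sout M r = f w.

Definition in_EXPTIME (L : seq bool -> Prop) : Prop :=
  exists (M : TM bool bool) (c : nat),
    decides_in_time M L (fun n => 2 ^ (n ^ c + c)).

Definition polytime_computable (Sin Sout : finType) (f : seq Sin -> seq Sout) : Prop :=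
  exists (M : TM Sin Sout) (c : nat), computes_in_time M f (fun n => n ^ c + c).

Definition EXPTIME_hard (Sigma : finType) (L : seq Sigma -> Prop) : Prop :=
  forall L' : seq bool -> Prop, in_EXPTIME L' ->
    exists f : seq bool -> seq Sigma,
      polytime_computable f /\ forall w, L' w <-> L (f w).

Definition arity (sig : seq nat) (i : 'I_(size sig)) : nat := nth 0 sig i.

Inductive term (sig : seq nat) : Type :=
| Var : nat -> term sig
| App (i : 'I_(size sig)) : {ffun 'I_(arity i) -> term sig} -> term sig.

Record algebra (sig : seq nat) := {
  carrier :> Type;
  ops : forall i : 'I_(size sig), ('I_(arity i) -> carrier) -> carrier }.
Arguments ops {sig} a i _.

Fixpoint eval (sig : seq nat) (A : algebra sig) (v : nat -> A) (t : term sig) : A :=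
  match t with
  | Var x => v x
  | App i args => ops A i (fun j => eval v (args j))
  end.

Fixpoint vars_in (sig : seq nat) (P : nat -> Prop) (t : term sig) : Prop :=
  match t with
  | Var x => P x
  | App i args => forall j, vars_in P (args j)
  end.

Record lmatrix (sig : seq nat) := { malg : algebra sig; mfilt : malg -> Prop }.
Arguments malg {sig} l.
Arguments mfilt {sig} l _.

Definition logic (sig : seq nat) := (term sig -> Prop) -> term sig -> Prop.

Definition logic_of (sig : seq nat) (M : lmatrix sig) : logic sig :=
  fun Gamma phi => forall v : nat -> malg M,
    (forall g, Gamma g -> mfilt M (eval v g)) -> mfilt M (eval v phi).

Definition is_model (sig : seq nat) (L : logic sig) (M : lmatrix sig) : Prop :=
  forall Gamma phi, L Gamma phi -> logic_of M Gamma phi.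

Definition is_congruence (sig : seq nat) (A : algebra sig) (th : A -> A -> Prop) : Prop :=
  (forall a, th a a) /\ (forall a b, th a b -> th b a) /\
  (forall a b c, th a b -> th b c -> th a c) /\
  (forall i (a b : 'I_(arity i) -> A), (forall j, th (a j) (b j)) ->
     th (ops A i a) (ops A i b)).

Definition compatible (A : Type) (th : A -> A -> Prop) (F : A -> Prop) : Prop :=
  forall a b, th a b -> F a -> F b.

Definition is_Leibniz (sig : seq nat) (A : algebra sig) (F : A -> Prop)
    (th : A -> A -> Prop) : Prop :=
  is_congruence th /\ compatible th F /\
  forall th', is_congruence th' -> compatible th' F -> forall a b, th' a b -> th a b.

Definition Omega (sig : seq nat) (A : algebra sig) (F : A -> Prop) (a b : A) : Prop :=
  exists th, is_Leibniz F th /\ th a b.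

Definition reduced (sig : seq nat) (M : lmatrix sig) : Prop :=
  forall a b : malg M, Omega (mfilt M) a b <-> a = b.

(* x = Var 0, y = Var 1, the parameters z are the remaining variables *)
Definition protoalgebraic (sig : seq nat) (L : logic sig) : Prop :=
  exists Delta : term sig -> Prop,
    forall M : lmatrix sig, is_model L M ->
      forall a b : malg M, Omega (mfilt M) a b <->
        (forall v : nat -> malg M, v 0 = a -> v 1 = b ->
           forall d, Delta d -> mfilt M (eval v d)).

Definition equivalential (sig : seq nat) (L : logic sig) : Prop :=
  exists Delta : term sig -> Prop,
    (forall d, Delta d -> vars_in (fun x => x <= 1) d) /\
    forall M : lmatrix sig, is_model L M ->
      forall a b : malg M, Omega (mfilt M) a b <->
        (forall v : nat -> malg M, v 0 = a -> v 1 = b ->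
           forall d, Delta d -> mfilt M (eval v d)).

Definition truth_equational (sig : seq nat) (L : logic sig) : Prop :=
  exists tau : term sig * term sig -> Prop,
    (forall e, tau e -> vars_in (fun x => x = 0) e.1 /\ vars_in (fun x => x = 0) e.2) /\
    forall M : lmatrix sig, is_model L M -> reduced M ->
      forall a : malg M, mfilt M a <->
        (forall e, tau e -> eval (fun _ => a) e.1 = eval (fun _ => a) e.2).

Definition algebraizable (sig : seq nat) (L : logic sig) : Prop :=
  equivalential L /\ truth_equational L.

Definition weakly_algebraizable (sig : seq nat) (L : logic sig) : Prop :=
  protoalgebraic L /\ truth_equational L.

Inductive logic_class :=
  | KAlgebraizable | KEquivalential | KWeaklyAlgebraizable
  | KProtoalgebraic | KTruthEquational.

Definition in_class (K : logic_class) (sig : seq nat) (L : logic sig) : Prop :=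
  match K with
  | KAlgebraizable => algebraizable L
  | KEquivalential => equivalential L
  | KWeaklyAlgebraizable => weakly_algebraizable L
  | KProtoalgebraic => protoalgebraic L
  | KTruthEquational => truth_equational L
  end.

(* Carrier {1..n} is represented by 'I_n (element k+1 <-> ordinal k);       *)
(* we store n = fm_size.+1 (algebras are nonempty).                         *)
(* Each operation: (arity k, list of its n^k values in {1..n}), the         *)
(* argument tuple (a_0,...,a_{k-1}) being listed lexicographically          *)
(* (a_0 most significant).  F = {1..m}.                                     *)

Record fmat := { fm_size : nat; fm_m : nat; fm_ops : seq (nat * seq nat) }.

Definition fm_n (D : fmat) : nat := (fm_size D).+1.
Definition fm_sig (D : fmat) : seq nat := map fst (fm_ops D).

Definition fm_wf (D : fmat) : Prop :=
  fm_m D <= fm_n D /\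
  all (fun p => (size p.2 == fm_n D ^ p.1) &&
                all (fun v => (1 <= v) && (v <= fm_n D)) p.2) (fm_ops D).

Definition fm_table (D : fmat) (i : nat) : seq nat := nth [::] (map snd (fm_ops D)) i.

Definition tuple_index (n k : nat) (a : 'I_k -> nat) : nat :=
  \sum_(j < k) a j * n ^ (k.-1 - j).

Definition fm_alg (D : fmat) : algebra (fm_sig D) :=
  {| carrier := 'I_(fm_size D).+1;
     ops := fun i a =>
       inord (nth 1 (fm_table D i) (tuple_index (fm_n D) (fun j => a j))).-1 |}.

Definition fm_matrix (D : fmat) : lmatrix (fm_sig D) :=
  {| malg := fm_alg D; mfilt := fun x : 'I_(fm_size D).+1 => x < fm_m D |}.

(* binary encoding of numbers over the alphabet 'I_3:
   0, 1 = binary digits (most significant first, no leading zeros),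
   2 = separator terminating each number *)
Fixpoint bits_lsb (fuel n : nat) : seq bool :=
  match fuel with
  | 0 => [::]
  | f.+1 => if n == 0 then [::] else odd n :: bits_lsb f n./2
  end.

Definition bits (n : nat) : seq bool :=
  if n == 0 then [:: false] else rev (bits_lsb n n).

Definition sym0 : 'I_3 := @Ordinal 3 0 isT.
Definition sym1 : 'I_3 := @Ordinal 3 1 isT.
Definition symsep : 'I_3 := @Ordinal 3 2 isT.

Definition enc_num (n : nat) : seq 'I_3 :=
  map (fun b : bool => if b then sym1 else sym0) (bits n) ++ [:: symsep].

Definition fm_numbers (D : fmat) : seq nat :=
  [:: fm_n D; fm_m D; size (fm_ops D)] ++
  flatten (map (fun p => p.1 :: p.2) (fm_ops D)).

Definition encode (D : fmat) : seq 'I_3 := flatten (map enc_num (fm_numbers D)).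

Definition problem (K : logic_class) (w : seq 'I_3) : Prop :=
  exists D : fmat, w = encode D /\ fm_wf D /\ reduced (fm_matrix D) /\
    in_class K (logic_of (fm_matrix D)).

(* Main.v *)
(** Simulate the exponential-time machine by facts, each of which gives the content
    of the cell of address [z] of the space-time diagram, where [z] is a binary
    number of polynomially many bits. The algebra has one sort for every bit of the
    address and one for the symbol; an element is a sort with a value, and the
    operations act sortwise. A unary term thus yields a tuple of values, one for
    every sort: a tuple without error value is exactly a true fact, and a fact about
    an accepting cell can be turned into the tuple that is designated everywhere.
    Carries cannot be propagated sortwise, so there is one step operation for every
    choice of carry positions. If the machine accepts, some unary term is therefore
    a theorem, and a further operation uses it to define equality by a term, whence
    algebraizability. If it rejects, the logic has no theorems; then the empty
    filter is a model on every algebra, which refutes protoalgebraicity as well as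
    truth-equationality. So a single reduction serves all five classes.

    The reduction is computed by a program with polynomially bounded counters; a
    machine with one tape represents the value of a counter by the position of a
    marker on a track of its own. *)

Require Import Defs.
From mathcomp Require Import all_boot.
From mathcomp Require Import zify.
From Stdlib Require Import FunctionalExtensionality.
Set Implicit Arguments. Unset Strict Implicit. Unset Printing Implicit Defensive.

(** The matrix has to be reduced whether or not the machine accepts, so equality must be expressible
    in both cases. The equality operation therefore has a third argument as a guard: its result can
    be designated only if the guard is. A designated parameter opens the guard in every case, which
    yields reducedness; a term without parameters can only put a theorem there. Acceptance thus
    decides whether the parameter can be replaced by a term. Soundness evaluates a term in all sorts
    at once, every variable being the error element of the sort. Since no operation can compare
    sorts, a wrong guess of a carry is not rejected as a whole; it leaves an error in one sort, and
    the invariant asks for no more than that: some error, or a true fact. Row 0 has exponentially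
    many blank cells, too many for one constant operation each. They are generated from one another
    and carry a mark of their own, because only there does a blank force its right neighbour to be
    blank. The head starts in the middle of a wide row. So it never meets an end of the tape, and
    reading across the border of two rows meets blanks only. *)

Definition tape (G : Type) (blank : G) (h : nat) (l r : seq G) (p : nat) : G :=
  if p < h then nth blank l (h.-1 - p) else nth blank r (p - h).

Definition move_head (mv : move) (h : nat) : nat :=
  match mv with MLeft => h.-1 | MRight => h.+1 | MStay => h end.

Definition upd (G : Type) (f : nat -> G) (h : nat) (g : G) (p : nat) : G :=
  if p == h then g else f p.

Lemma tape_head (G : Type) (blank : G) h l r : tape blank h l r h = head blank r.
Proof. by rewrite /tape ltnn subnn nth0. Qed.

Definition tape_move (G : Type) (blank : G) (mv : move) (g : G) (l r : seq G) :=
  match mv with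
  | MStay => (l, g :: behead r)
  | MRight => (g :: l, behead r)
  | MLeft => (behead l, head blank l :: g :: behead r)
  end.

(** The two lists describe a tape without origin. A left move at [h = 0] would bring in a new cell
    and shift all positions by one; the hypothesis excludes it and returns as the side condition of
    [rstepsS]. *)
Lemma tape_moveE (G : Type) (blank : G) mv g h l r :
    (mv = MLeft -> 0 < h) ->
  let: (l', r') := tape_move blank mv g l r in
  tape blank (move_head mv h) l' r' = upd (tape blank h l r) h g.
Proof.
case: mv => [/(_ erefl)||_] /=.
- case: h => // h _; apply: functional_extensionality => p.
  rewrite /tape /upd /=.
  case: (ltngtP p h.+1) => [p_h|p_h|->].
  + case: (ltngtP p h) => [p_h'|p_h'|->]; [|lia|].
      by rewrite nth_behead; congr nth; lia.
    by rewrite !subnn /= nth0.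
  + rewrite ltnNge (ltnW (ltnW p_h)) /=.
    have ->: p - h = (p - h.+1).-1.+2 by lia.
    by rewrite /= nth_behead; congr nth; lia.
  + by rewrite ltnNge leqnSn subSnn.
- move=> _; apply: functional_extensionality => p; rewrite /tape /upd.
  case: (ltngtP p h) => [p_h|p_h|->].
  + rewrite ltnS (ltnW p_h) /=; have ->: h - p = (h.-1 - p).+1 by lia.
    by [].
  + by rewrite ltnS leqNgt p_h /= nth_behead; congr nth; lia.
  + by rewrite ltnSn subnn.
- apply: functional_extensionality => p; rewrite /tape /upd.
  case: (ltngtP p h) => [p_h|p_h|->] //; last by rewrite subnn.
  have ->: p - h = (p - h).-1.+1 by lia.
  by rewrite /= nth_behead.
Qed.

Lemma tm_stepE Sin Sout (M : TM Sin Sout) q l r : ~~ tm_halt M q ->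
  tm_step ((q, l, r) : config M) =
  let: (q', g', mv) := tm_delta M q (head (tm_blank M) r) in
  let: (l', r') := tape_move (tm_blank M) mv g' l r in (q', l', r').
Proof.
by move=> /negPf q_halt; rewrite /tm_step q_halt; case: tm_delta => -[q' g' []].
Qed.

Lemma tm_step_halt Sin Sout (M : TM Sin Sout) (c : config M) t :
  tm_halt M c.1.1 -> iter t (@tm_step _ _ M) c = c.
Proof.
case: c => -[q l] r /= q_halt; elim: t => //= t ->.
by rewrite /tm_step q_halt.
Qed.

(** * Routines: machine fragments with two exits *)

Record routine (G : Type) := Routine {
  rQ : finType;
  rstart : rQ;
  rdelta : rQ -> G -> (rQ + bool) * G * move }.
Arguments rstart {G} r.
Arguments rdelta {G} r _ _.

Section Routine.
Variable G : Type.
Implicit Type R : routine G.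

Inductive rsteps R : nat -> (rQ R + bool) * nat * (nat -> G) ->
    (rQ R + bool) * nat * (nat -> G) -> Prop :=
| rsteps0 c : rsteps 0 c c
| rstepsS n q h f q' g' mv c : rdelta R q (f h) = (q', g', mv) ->
    (mv = MLeft -> 0 < h) ->
    rsteps n (q', move_head mv h, upd f h g') c ->
    rsteps n.+1 (inl q, h, f) c.

Lemma rsteps_trans R n1 n2 c1 c2 c3 :
  @rsteps R n1 c1 c2 -> rsteps n2 c2 c3 -> rsteps (n1 + n2) c1 c3.
Proof.
by elim=> // n q h f q' g' mv c E h0 _ IH /IH; apply: rstepsS E h0.
Qed.

Definition rcall (R' : finType) Q (e : Q -> R') (ex : bool -> R' + bool)
    (x : (Q + bool) * G * move) : (R' + bool) * G * move :=
  (match x.1.1 with inl q => inl (e q) | inr b => ex b end, x.1.2, x.2).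

(** The embedded routine runs as before until the step that reaches its exit; [rcall] redirects that
    very step to [ex b], at no extra cost. Exits have no outgoing steps, so the inner run ends
    there. *)
Lemma rsteps_call R R' (e : rQ R -> rQ R') ex :
    (forall q g, rdelta R' (e q) g = rcall e ex (rdelta R q g)) ->
  forall n q h f b h' f' m c,
  @rsteps R n (inl q, h, f) (inr b, h', f') ->
  rsteps m (ex b, h', f') c -> rsteps (n + m) (inl (e q), h, f) c.
Proof.
move=> eE n q h f b h' f' m c.
move Ec1: (inl q, h, f) => c1; move Ec2: (inr b, h', f') => c2 R_run.
elim: R_run q h f Ec1 Ec2 => {n c1 c2} [c0|n q0 h0 f0 q' g' mv c0 E h_gt0 R_run IH].
  by move=> q h f <-.
move=> q h f [-> -> ->] Ec0 rest; rewrite addSn.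
case: q' => [q'|b'] in E R_run IH *.
  by apply: (@rstepsS _ _ _ _ _ (inl (e q')) g' mv);
    rewrite ?eE ?E //; apply: IH.
move: R_run rest; rewrite -Ec0 => R_run rest.
inversion R_run; subst; apply: (@rstepsS _ _ _ _ _ (ex b) g' mv) => //.
by rewrite eE E.
Qed.

Definition seqR R1 R2 : routine G := {|
  rQ := (rQ R1 + rQ R2)%type; rstart := inl (rstart R1);
  rdelta := fun q g => match q with
    | inl q1 => rcall inl (fun=> inl (inr (rstart R2))) (rdelta R1 q1 g)
    | inr q2 => rcall inr inr (rdelta R2 q2 g)
    end |}.

Definition iteR R0 R1 R2 : routine G := {|
  rQ := (rQ R0 + (rQ R1 + rQ R2))%type; rstart := inl (rstart R0);
  rdelta := fun q g => match q with
    | inl q0 => rcall inl (fun b => inl (inr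
        (if b then inl (rstart R1) else inr (rstart R2)))) (rdelta R0 q0 g)
    | inr (inl q1) => rcall (fun q => inr (inl q)) inr (rdelta R1 q1 g)
    | inr (inr q2) => rcall (fun q => inr (inr q)) inr (rdelta R2 q2 g)
    end |}.

Definition untilR R0 R1 : routine G := {|
  rQ := (rQ R0 + rQ R1)%type; rstart := inl (rstart R0);
  rdelta := fun q g => match q with
    | inl q0 => rcall inl (fun b =>
        if b then inr true else inl (inr (rstart R1))) (rdelta R0 q0 g)
    | inr q1 => rcall inr (fun=> inl (inl (rstart R0))) (rdelta R1 q1 g)
    end |}.

(** The head at 0 on entry and on exit is the calling convention that makes the combinators
    composable. *)
Definition rruns R n f b f' :=
  @rsteps R n (inl (rstart R), 0, f) (inr b, 0, f').

Lemma rsteps_exit R (R' : routine G) (e : rQ R -> rQ R') n q h f b h' f' :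
    (forall q g, rdelta R' (e q) g = rcall e inr (rdelta R q g)) ->
  @rsteps R n (inl q, h, f) (inr b, h', f') ->
  rsteps n (inl (e q), h, f) (inr b, h', f').
Proof.
by move=> eE R_run; rewrite -[n]addn0; apply: (rsteps_call eE R_run); constructor.
Qed.

Lemma rruns_seq R1 R2 n1 n2 f b1 f1 b2 f2 :
  rruns R1 n1 f b1 f1 -> rruns R2 n2 f1 b2 f2 ->
  rruns (seqR R1 R2) (n1 + n2) f b2 f2.
Proof.
move=> run1 run2; apply: (@rsteps_call R1 (seqR R1 R2) inl _ _ _ _ _ _ _ _ _ _ _ run1).
  by [].
exact: (@rsteps_exit R2 (seqR R1 R2)).
Qed.

Lemma rruns_ite R0 R1 R2 n0 n f (b : bool) f0 b' f' :
  rruns R0 n0 f b f0 -> rruns (if b then R1 else R2) n f0 b' f' ->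
  rruns (iteR R0 R1 R2) (n0 + n) f b' f'.
Proof.
move=> run0 run; apply: (@rsteps_call R0 (iteR R0 R1 R2) inl _ _ _ _ _ _ _ _ _ _ _ run0).
  by [].
case: b run {run0} => run.
  exact: (@rsteps_exit R1 (iteR R0 R1 R2) (fun q => inr (inl q))).
exact: (@rsteps_exit R2 (iteR R0 R1 R2) (fun q => inr (inr q))).
Qed.

Lemma rruns_until_stop R0 R1 n f f' :
  rruns R0 n f true f' -> rruns (untilR R0 R1) n f true f'.
Proof.
move=> run; rewrite -[n]addn0.
by apply: (@rsteps_call R0 (untilR R0 R1) inl _ _ _ _ _ _ _ _ _ _ _ run) => //; constructor.
Qed.

Lemma rruns_until_loop R0 R1 n0 n1 n f f0 b1 f1 b f' :
  rruns R0 n0 f false f0 -> rruns R1 n1 f0 b1 f1 ->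
  rruns (untilR R0 R1) n f1 b f' ->
  rruns (untilR R0 R1) (n0 + (n1 + n)) f b f'.
Proof.
move=> run0 run1 run.
apply: (@rsteps_call R0 (untilR R0 R1) inl _ _ _ _ _ _ _ _ _ _ _ run0) => //.
exact: (@rsteps_call R1 (untilR R0 R1) inr _ _ _ _ _ _ _ _ _ _ _ run1).
Qed.

(* Seek the first cell satisfying [P], rewrite it by [m1] and its right
   neighbour by [m2], return to the start cell and rewrite that by [m0]; the
   exit is the value of [tau] on the cell that was found. *)
Definition sweepR (start P tau : G -> bool) (m1 m2 m0 : G -> G) : routine G := {|
  rQ := option (bool * bool); rstart := None;
  rdelta := fun q g => match q with
    | None => if P g then (inl (Some (false, tau g)), m1 g, MRight)
              else (inl None, g, MRight)
    | Some (false, b) => (inl (Some (true, b)), m2 g, MLeft)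
    | Some (true, b) => if start g then (inr b, m0 g, MStay)
                        else (inl (Some (true, b)), g, MLeft)
    end |}.

Lemma upd_same (f : nat -> G) h : upd f h (f h) = f.
Proof. by apply: functional_extensionality => p; rewrite /upd; case: eqP => // ->. Qed.

Definition sweep_result (f : nat -> G) k (m1 m2 m0 : G -> G) (p : nat) : G :=
  let g := f p in
  let g := if p == k then m1 g else g in
  let g := if p == k.+1 then m2 g else g in
  if p == 0 then m0 g else g.

(** The time is [k] for the search, two for the cells [k] and [k.+1], and [k.+1] for the way back.
    [m1] and [m2] must respect the start flag, since it stops the return; [m0] acts only once the
    flag has been found. *)
Lemma rruns_sweep (start P tau : G -> bool) (m1 m2 m0 : G -> G) (f : nat -> G) k :
    (forall p, start (f p) = (p == 0)) ->
    (forall g, start (m1 g) = start g) -> (forall g, start (m2 g) = start g) ->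
    P (f k) -> (forall j, j < k -> ~~ P (f j)) ->
  rruns (sweepR start P tau m1 m2 m0) (2 * k + 3) f (tau (f k))
    (sweep_result f k m1 m2 m0).
Proof.
move=> startE start1 start2 Pk Pj; set R := sweepR _ _ _ _ _ _.
have seek j : j <= k -> @rsteps R j (inl None, 0, f) (inl None, j, f).
  elim: j => [|j IH] j_k; first by constructor.
  rewrite -{1}addn1; apply: rsteps_trans (IH (ltnW j_k)) _.
  apply: (@rstepsS R 0 None j f (inl None) (f j) MRight) => //=.
    by rewrite (negPf (Pj _ j_k)).
  by rewrite upd_same; constructor.
have ret b f1 j : (forall p, start (f1 p) = (p == 0)) ->
    @rsteps R j.+1 (inl (Some (true, b)), j, f1) (inr b, 0, upd f1 0 (m0 (f1 0))).
  move=> start_f1; elim: j => [|j IH].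
    apply: (@rstepsS R 0 _ _ _ (inr b) (m0 (f1 0)) MStay) => //=; last by constructor.
    by rewrite start_f1.
  apply: (@rstepsS R j.+1 _ _ _ (inl (Some (true, b))) (f1 j.+1) MLeft) => //=.
    by rewrite start_f1.
  by rewrite upd_same.
have -> : 2 * k + 3 = k + (k.+1).+2 by lia.
apply: rsteps_trans (seek k (leqnn k)) _.
apply: (@rstepsS R _ _ _ _ (inl (Some (false, tau (f k)))) (m1 (f k)) MRight) => //=.
  by rewrite Pk.
apply: (@rstepsS R _ _ _ _ (inl (Some (true, tau (f k))))
          (m2 (f k.+1)) MLeft) => //=.
  by rewrite /upd gtn_eqF.
set f1 := upd (upd f k _) _ _.
have <- : upd f1 0 (m0 (f1 0)) = sweep_result f k m1 m2 m0.
  apply: functional_extensionality => p; rewrite /upd /f1 /sweep_result /upd.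
  case: (eqVneq p k.+1) => [->|p_k1] /=; first by rewrite (gtn_eqF (ltnSn k)).
  case: (eqVneq p 0) => [->|_] /=; first by case: eqP => [<-|].
  by case: eqP => [->|].
apply: ret => p; rewrite /f1 /upd.
case: eqP => [->|_]; first by rewrite start2 startE.
by case: eqP => [->|_] //; rewrite start1 startE.
Qed.

End Routine.

(** * Counter programs *)

Record store := Store { cnt : nat -> nat; out : seq 'I_3 }.

(** The primitives are those that a single sweep over the tape can perform; all other arithmetic is
    programmed. *)
Inductive action := Inc of nat | Clr of nat | Out of 'I_3.
Inductive test := TEq of nat & nat | TLe of nat & nat | TInp of nat & option bool.
Inductive prog :=
  | Act of action
  | Seq of prog & prog
  | If of test & prog & prog
  | Until of test & prog.

Definition run_action (a : action) (s : store) : store :=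
  match a with
  | Inc h => Store (upd (cnt s) h (cnt s h).+1) (out s)
  | Clr h => Store (upd (cnt s) h 0) (out s)
  | Out o => Store (cnt s) (rcons (out s) o)
  end.

Definition run_test (w : seq bool) (t : test) (s : store) : bool :=
  match t with
  | TEq a b => cnt s a == cnt s b
  | TLe a b => cnt s a <= cnt s b
  | TInp h x => onth w (cnt s h) == x
  end.

Inductive exec (w : seq bool) : prog -> store -> store -> nat -> Prop :=
| ExAct a s : exec w (Act a) s (run_action a s) 1
| ExSeq p q s s1 s2 n1 n2 : exec w p s s1 n1 -> exec w q s1 s2 n2 ->
    exec w (Seq p q) s s2 (n1 + n2)
| ExIf t p q s s' n : exec w (if run_test w t s then p else q) s s' n ->
    exec w (If t p q) s s' n.+1
| ExStop t p s : run_test w t s -> exec w (Until t p) s s 1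
| ExLoop t p s s1 s2 n1 n2 : ~~ run_test w t s -> exec w p s s1 n1 ->
    exec w (Until t p) s1 s2 n2 -> exec w (Until t p) s s2 (n1 + n2).+1.

Section Compile.
Variable K : nat.

(* start flag, counter markers, input track, output track *)
Definition cell := (bool * {ffun 'I_K -> bool} * option bool * option 'I_3)%type.

Definition has (h : nat) (c : cell) : bool := [exists i : 'I_K, (i == h :> nat) && c.1.1.2 i].
Definition put (h : nat) (b : bool) (c : cell) : cell :=
  (c.1.1.1, [ffun i : 'I_K => if i == h :> nat then b else c.1.1.2 i], c.1.2, c.2).
Definition write (o : 'I_3) (c : cell) : cell := (c.1, Some o).
Definition is_start (c : cell) : bool := c.1.1.1.

Definition tape_of (w : seq bool) (s : store) (p : nat) : cell :=
  (p == 0, [ffun i : 'I_K => cnt s i == p], onth w p, onth (out s) p).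

Lemma has_tape_of w s p h : h < K -> has h (tape_of w s p) = (cnt s h == p).
Proof.
move=> h_K; apply/existsP/idP => [[i /andP[/eqP <-]]|s_h]; first by rewrite ffunE.
by exists (Ordinal h_K); rewrite eqxx ffunE.
Qed.

(** A marker moves from [k] to [k.+1] through [m1] and [m2]; clearing removes it and lets [m0] put
    it on cell 0. The end of the output is the first cell whose output track is empty. *)
Definition compile_action (a : action) : routine cell :=
  match a with
  | Inc h => sweepR is_start (has h) (fun=> true) (put h false) (put h true) id
  | Clr h => sweepR is_start (has h) (fun=> true) (put h false) id (put h true)
  | Out o => sweepR is_start (fun c => c.2 == None) (fun=> true) (write o) id id
  end.

(** Of two markers the sweep meets the one at the smaller value first, and that cell alone tells
    equality and order. *)
Definition compile_test (t : test) : routine cell :=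
  match t with
  | TEq a b => sweepR is_start (fun c => has a c || has b c)
                 (fun c => has a c && has b c) id id id
  | TLe a b => sweepR is_start (fun c => has a c || has b c) (has a) id id id
  | TInp h x => sweepR is_start (has h) (fun c => c.1.2 == x) id id id
  end.

Fixpoint compile (p : prog) : routine cell :=
  match p with
  | Act a => compile_action a
  | Seq p q => seqR (compile p) (compile q)
  | If t p q => iteR (compile_test t) (compile p) (compile q)
  | Until t p => untilR (compile_test t) (compile p)
  end.

Definition action_ok (a : action) :=
  match a with Inc h | Clr h => h < K | Out _ => true end.
Definition test_ok (t : test) :=
  match t with TEq a b | TLe a b => (a < K) && (b < K) | TInp h _ => h < K end.
Fixpoint prog_ok (p : prog) :=
  match p with
  | Act a => action_ok a
  | Seq p q => prog_ok p && prog_ok q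
  | If t p q => [&& test_ok t, prog_ok p & prog_ok q]
  | Until t p => test_ok t && prog_ok p
  end.

Definition store_le (m : nat) (s : store) :=
  (forall h, cnt s h <= m) /\ size (out s) <= m.

Lemma run_action_le m a s : store_le m s -> store_le m.+1 (run_action a s).
Proof.
move=> [cnt_le out_le]; case: a => [h|h|o] /=; split=> //=.
- by move=> h'; rewrite /upd; case: eqP => _; rewrite ?ltnS ?leqW.
- exact: leqW.
- by move=> h'; rewrite /upd; case: eqP => _ //; rewrite leqW.
- exact: leqW.
- by move=> h; rewrite leqW.
- by rewrite size_rcons.
Qed.

Lemma sweep_result_id (G : Type) (f : nat -> G) k : sweep_result f k id id id = f.
Proof.
by apply: functional_extensionality => p; rewrite /sweep_result; do 3?case: ifP.
Qed.

Lemma onth_rcons (T : Type) (s : seq T) x p :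
  onth (rcons s x) p = if p == size s then Some x else onth s p.
Proof. by elim: s p => [|y s IH] [|p] //=; case: p. Qed.

Lemma onth_lt (T : eqType) (s : seq T) p : p < size s -> onth s p != None.
Proof. by rewrite -onthTE; case: onth. Qed.

Lemma compile_actionP w a s m : action_ok a -> store_le m s ->
  exists2 n, n <= 2 * m + 3 &
  exists b, rruns (compile_action a) n (tape_of w s) b (tape_of w (run_action a s)).
Proof.
case: a => [h|h|o] /=.
- move=> h_K [s_le _]; exists (2 * cnt s h + 3); first by move: (s_le h); lia.
  exists true; set f' := tape_of w (Store _ _); rewrite (_ : f' =
    sweep_result (tape_of w s) (cnt s h) (put h false) (put h true) id).
    apply: (@rruns_sweep _ _ _ (fun=> true)) => //; first by rewrite has_tape_of.
    by move=> j j_h; rewrite has_tape_of // gtn_eqF.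
  apply: functional_extensionality => p; rewrite /f' /sweep_result /tape_of /=.
  rewrite if_same; case: (eqVneq p (cnt s h)) => [->|p_h].
    rewrite (ltn_eqF (ltnSn _)) /put /=; congr (_, _, _, _).
    apply/ffunP=> i; rewrite !ffunE /upd; case: (eqVneq (i : nat) h) => // _.
    by rewrite gtn_eqF.
  case: (eqVneq p (cnt s h).+1) => [->|p_h1].
    rewrite /put /=; congr (_, _, _, _); apply/ffunP=> i; rewrite !ffunE /upd.
    by case: (eqVneq (i : nat) h); rewrite ?eqxx.
  congr (_, _, _, _); apply/ffunP=> i; rewrite !ffunE /upd.
  case: (eqVneq (i : nat) h) => // ->.
  by rewrite eq_sym (negPf p_h1) eq_sym (negPf p_h).
- move=> h_K [s_le _]; exists (2 * cnt s h + 3); first by move: (s_le h); lia.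
  exists true; set f' := tape_of w (Store _ _); rewrite (_ : f' =
    sweep_result (tape_of w s) (cnt s h) (put h false) id (put h true)).
    apply: (@rruns_sweep _ _ _ (fun=> true)) => //; first by rewrite has_tape_of.
    by move=> j j_h; rewrite has_tape_of // gtn_eqF.
  apply: functional_extensionality => p; rewrite /f' /sweep_result /tape_of /=.
  rewrite if_same; case: (eqVneq p 0) => [->|p_0]; case: eqVneq => p_h /=;
    rewrite /put /=; congr (_, _, _, _); apply/ffunP=> i; rewrite !ffunE /upd //;
    case: (eqVneq (i : nat) h) => // iE; rewrite ?iE.
  + by rewrite eq_sym (negPf p_0).
  + by rewrite eq_sym (negPf p_0) eq_sym (negPf p_h).
- move=> _ [_ s_le]; exists (2 * size (out s) + 3); first by lia.
  exists true; set f' := tape_of w (Store _ _); rewrite (_ : f' =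
    sweep_result (tape_of w s) (size (out s)) (write o) id id).
    apply: (@rruns_sweep _ _ _ (fun=> true)) => //=; first by rewrite onth_default.
    by move=> j j_h; rewrite onth_lt.
  apply: functional_extensionality => p; rewrite /f' /sweep_result /tape_of /=.
  by rewrite !if_same onth_rcons; case: (eqVneq p (size (out s))) => [->|].
Qed.

Lemma compile_testP w t s m : test_ok t -> store_le m s ->
  exists2 n, n <= 2 * m + 3 &
    rruns (compile_test t) n (tape_of w s) (run_test w t s) (tape_of w s).
Proof.
case: t => [a b|a b|h x] /=.
- move=> /andP[a_K b_K] [s_le _]; exists (2 * minn (cnt s a) (cnt s b) + 3).
    by move: (s_le a); lia.
  set P := fun c => _ || _; set tau := fun c => _ && _.
  set k := minn _ _; have -> : (cnt s a == cnt s b) = tau (tape_of w s k).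
    by rewrite /tau !has_tape_of // /k; lia.
  rewrite -{3}(sweep_result_id (tape_of w s) k); apply: rruns_sweep => //.
    by rewrite /P !has_tape_of // /k; lia.
  by move=> j j_k; rewrite /P !has_tape_of // /k; lia.
- move=> /andP[a_K b_K] [s_le _]; exists (2 * minn (cnt s a) (cnt s b) + 3).
    by move: (s_le a); lia.
  set P := fun c => _ || _; set tau := has a.
  set k := minn _ _; have -> : (cnt s a <= cnt s b) = tau (tape_of w s k).
    by rewrite /tau !has_tape_of // /k; lia.
  rewrite -{3}(sweep_result_id (tape_of w s) k); apply: rruns_sweep => //.
    by rewrite /P !has_tape_of // /k; lia.
  by move=> j j_k; rewrite /P !has_tape_of // /k; lia.
- move=> h_K [s_le _]; exists (2 * cnt s h + 3); first by move: (s_le h); lia.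
  set tau := fun c => _ == x; set k := cnt s h.
  have -> : (onth w k == x) = tau (tape_of w s k) by [].
  rewrite -{3}(sweep_result_id (tape_of w s) k); apply: rruns_sweep => //.
    by rewrite has_tape_of.
  by move=> j j_h; rewrite has_tape_of // gtn_eqF.
Qed.

Lemma store_leW m n s : m <= n -> store_le m s -> store_le n s.
Proof. by move=> mn [le1 le2]; split=> [h|]; apply: leq_trans mn. Qed.

(** One unit of program time enlarges counters and output by at most one, so every sweep stays
    within [m + n] cells, and the factor [2 * (m + n) + 3] is the price of one sweep. *)
Lemma compileP w p s s' n : exec w p s s' n -> forall m, prog_ok p -> store_le m s ->
  store_le (m + n) s' /\
  exists2 t, t <= n * (2 * (m + n) + 3) &
  exists b, rruns (compile p) t (tape_of w s) b (tape_of w s').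
Proof.
elim=> {p s s' n}.
- move=> a s m a_ok s_le; rewrite addn1 mul1n; split; first exact: run_action_le.
  have [t t_le run] := compile_actionP w a_ok s_le.
  by exists t => //; apply: leq_trans t_le _; lia.
- move=> p q s s1 s2 n1 n2 _ IH1 _ IH2 m /= /andP[p_ok q_ok] s_le.
  have [s1_le [t1 t1_le [b1 run1]]] := IH1 m p_ok s_le.
  have [s2_le [t2 t2_le [b2 run2]]] := IH2 _ q_ok s1_le.
  split; first by rewrite addnA.
  exists (t1 + t2); last by exists b2; apply: rruns_seq run1 run2.
  rewrite mulnDl addnA leq_add // ?(leq_trans t1_le) // leq_mul2l.
  by apply/orP; right; lia.
- move=> t p q s s' n _ IH m /= /and3P[t_ok p_ok q_ok] s_le.
  have [t0 t0_le run0] := compile_testP w t_ok s_le.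
  have [|s'_le [t1 t1_le [b1 run1]]] := IH m _ s_le; first by case: ifP.
  split; first by apply: store_leW s'_le; lia.
  exists (t0 + t1); first nia.
  by exists b1; apply: (rruns_ite run0); case: (run_test w t s) run1.
- move=> t p s t_true m /= /andP[t_ok p_ok] s_le.
  split; first by apply: store_leW s_le; lia.
  have [t0 t0_le run0] := compile_testP w t_ok s_le.
  exists t0; first by lia.
  by exists true; apply: rruns_until_stop; rewrite t_true in run0.
- move=> t p s s1 s2 n1 n2 t_false _ IH1 _ IH2 m /= /andP[t_ok p_ok] s_le.
  have [t0 t0_le run0] := compile_testP w t_ok s_le.
  have [s1_le [t1 t1_le [b1 run1]]] := IH1 m p_ok s_le.
  have [|s2_le [t2 t2_le [b2 run2]]] := IH2 (m + n1) _ s1_le.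
    by rewrite /= t_ok.
  split; first by apply: store_leW s2_le; lia.
  exists (t0 + (t1 + t2)); first nia.
  exists b2; rewrite (negPf t_false) in run0.
  exact: rruns_until_loop run0 run1 run2.
Qed.

Definition blank_cell : cell := (false, [ffun=> false], None, None).
Definition input_cell (b : bool) : cell := (false, [ffun=> false], Some b, None).
Definition first_cell (c : cell) : cell := (true, [ffun=> true], c.1.2, c.2).

(** The input arrives without flag and markers. One extra initial step sets the start flag and puts
    all markers on cell 0, which represents the store with all counters 0. *)
Definition tm_of (R : routine cell) : TM bool 'I_3 := {|
  tm_Q := (unit + (rQ R + bool))%type : finType;
  tm_G := cell : finType;
  tm_blank := blank_cell;
  tm_in := input_cell;
  tm_out := snd;
  tm_start := inl tt;
  tm_halt := fun q => if q is inr (inr _) then true else false;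
  tm_accept := fun=> false;
  tm_delta := fun q c => match q with
    | inl _ => (inr (inl (rstart R)), first_cell c, MStay)
    | inr (inl q) => let: (q', c', mv) := rdelta R q c in (inr q', c', mv)
    | inr (inr _) => (q, c, MStay)
    end |}.

Lemma tm_of_rsteps R n q h f q' h' f' (l r : seq cell) :
    @rsteps _ R n (q, h, f) (q', h', f') -> tape blank_cell h l r = f ->
  exists l' r', tape blank_cell h' l' r' = f' /\
    iter n (@tm_step _ _ (tm_of R)) (inr q, l, r) = (inr q', l', r').
Proof.
move Ec: (q, h, f) => c; move Ec': (q', h', f') => c' R_run.
elim: R_run l r q h f Ec Ec' => {n c c'} [c|n q0 h0 f0 q1 g' mv c E h0_gt0 _ IH] l r q h f.
  by move=> <- [<- <- <-] f_tape; exists l, r.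
move=> [-> -> ->] Ec f_tape.
have := @tape_moveE _ blank_cell mv g' h0 l r h0_gt0.
case Em: (tape_move _ _ _ _ _) => [l1 r1] tape1.
have [|l' [r' [f'_tape run]]] := IH l1 r1 _ _ _ erefl Ec; first by rewrite tape1 f_tape.
exists l', r'; split=> //; rewrite iterSr tm_stepE //= -(tape_head _ h0 l r) f_tape E.
by rewrite Em.
Qed.

Lemma tape_of_init w : upd (tape blank_cell 0 [::] (map input_cell w)) 0
    (first_cell (head blank_cell (map input_cell w))) =
  tape_of w (Store (fun=> 0) [::]).
Proof.
apply: functional_extensionality => -[|p]; rewrite /upd /tape_of.
  by case: w => [|b w] /=; rewrite /first_cell /=; congr (_, _, _, _);
  apply/ffunP=> i; rewrite !ffunE.
change (nth blank_cell (map input_cell w) p.+1 =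
  (false, [ffun i : 'I_K => 0 == p.+1], onth w p.+1, onth (Nil 'I_3) p.+1)).
rewrite onth0n -odflt_onth onth_map; have -> : [ffun i : 'I_K => 0 == p.+1] = [ffun=> false].
  by apply/ffunP=> i; rewrite !ffunE.
by case: (onth w _).
Qed.

(** With the head back at 0 the list [r] is the whole tape, and the first empty output track stops
    the read-out where [out s] ends. *)
Lemma tm_readout_tape R (r : seq cell) w s :
  tape blank_cell 0 [::] r = tape_of w s -> @tm_readout _ _ (tm_of R) r = out s.
Proof.
move=> E; have {E} : forall p, (nth blank_cell r p).2 = onth (out s) p.
  by move=> p; have := congr1 (fun f => (f p).2) E; rewrite /tape /= subn0.
elim: r (out s) => [|c r IH] o E.
  by case: o E => // x o /(_ 0).
have /= := E 0; case: o E => [|x o] E; rewrite /= => -> //.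
by congr cons; apply: IH => p; exact: E p.+1.
Qed.

Lemma tape0 (G : Type) (blank : G) l l' r : tape blank 0 l r = tape blank 0 l' r.
Proof. by []. Qed.

End Compile.

Definition test_bound (t : test) : nat :=
  match t with TEq a b | TLe a b => (a + b).+1 | TInp h _ => h.+1 end.

Fixpoint prog_bound (p : prog) : nat :=
  match p with
  | Act (Inc h) | Act (Clr h) => h.+1
  | Act (Out _) => 0
  | Seq p q => prog_bound p + prog_bound q
  | If t p q => test_bound t + (prog_bound p + prog_bound q)
  | Until t p => test_bound t + prog_bound p
  end.

Lemma test_ok_bound t K : test_bound t <= K -> test_ok K t.
Proof. by case: t => [a b|a b|h x] /=; lia. Qed.

Lemma prog_ok_bound p K : prog_bound p <= K -> prog_ok K p.
Proof.
elim: p K => [[h|h|o]|p IHp q IHq|t p IHp q IHq|t p IHp] K //= K_le;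
  rewrite ?test_ok_bound ?IHp ?IHq //; lia.
Qed.

Lemma leq_exp2 m n c : m <= n -> m ^ c <= n ^ c.
Proof. by case: c => // c mn; rewrite leq_exp2r. Qed.

(** Brings bounds into the form [n ^ c + c] of the definitions. From [n = 2] on, [n + 2 <= n ^ 2];
    the additive constant covers [n = 0] and [n = 1], where the left side is [2 ^ c] and [3 ^ c]. *)
Lemma polynomial_bound c n : (n + 2) ^ c <= n ^ (3 ^ c + 2 * c) + (3 ^ c + 2 * c).
Proof.
case: n => [|[|n]].
- by have := @leq_exp2 2 3 c isT; rewrite add0n; lia.
- by rewrite exp1n add1n; lia.
- apply: leq_trans (leq_addr _ _); apply: (@leq_trans (n.+2 ^ (2 * c))).
    by rewrite expnM leq_exp2 //; lia.
  by rewrite leq_pexp2l //; lia.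
Qed.

Lemma exec_polytime (p : prog) (f : seq bool -> seq 'I_3) (c : nat) :
    (forall w, exists s n, [/\ exec w p (Store (fun=> 0) [::]) s n,
       n <= (size w + 2) ^ c & out s = f w]) ->
  polytime_computable f.
Proof.
move=> p_run; set R := compile (prog_bound p) p.
pose d := 3 * c + 3; exists (tm_of R), (3 ^ d + 2 * d) => w.
have [s [n [p_exec n_le out_s]]] := p_run w.
have [|_ [t t_le [b run]]] :=
    compileP p_exec (m := 0) (prog_ok_bound (leqnn _)).
  by split.
have run0 : tm_run (tm_of R) 1 w = (inr (inl (rstart R)), [::],
    first_cell (head (blank_cell _) (map (@input_cell _) w)) ::
    behead (map (@input_cell _) w)) by [].
have tape1 : tape (blank_cell _) 0 [::] (first_cell (head (blank_cell _)
    (map (@input_cell (prog_bound p)) w)) :: behead (map (@input_cell _) w)) =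
    tape_of (prog_bound p) w (Store (fun=> 0) [::]).
  rewrite -tape_of_init; apply: functional_extensionality => -[|q]; rewrite /tape /upd //=.
  by rewrite !subn0 /= nth_behead.
have [l [r [r_tape run1]]] := tm_of_rsteps run tape1.
set T := _ + _; have t_T : t.+1 <= T.
  apply: leq_trans (polynomial_bound d (size w)).
  set N := (size w + 2) ^ c in n_le.
  (* The compiled time is at most [N * (2 * N + 3)], plus one initial step; this is below
     [8 * N ^ 3]. The cube gives [3 * c] and the factor [8 = 2 ^ 3] gives the summand 3 in [d]. *)
  apply: (@leq_trans (8 * (N * N * N))).
    have : 0 < N by rewrite expn_gt0 addn2.
    have : n * (2 * (0 + n) + 3) <= N * (2 * N + 3) by apply: leq_mul => //; lia.
    by move: t_le; move: (n * _) => Y; clear; nia.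
  rewrite /d expnD [3 * c]mulnC expnM -/N mulnC leq_mul //.
    by rewrite !expnS expn0 muln1 mulnA.
  by apply: (@leq_exp2 2 (size w + 2) 3); lia.
have -> : tm_run (tm_of R) T w = (inr (inr b), l, r).
  rewrite /tm_run -(subnK t_T) iterD iterSr -[X in iter t _ X]/(tm_run (tm_of R) 1 w).
  by rewrite run0 run1 tm_step_halt.
by split=> //; rewrite (tm_readout_tape R (s := s) (w := w)) // -r_tape; apply: tape0.
Qed.

(** * Polynomial-time arithmetic *)

(** [Shr] replaces a power operation: a counter holding [2 ^ y] would be exponentially large,
    whereas repeated halving of [x] stays below [x]. *)
Inductive binop := Add | Sub | Mul | Div | Mod | Shr.
Inductive expr :=
  | EVar of nat
  | ECst of nat
  | EInp of expr
  | EBin of binop & expr & expr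
  | EIfEq of expr & expr & expr & expr
  | EIfLe of expr & expr & expr & expr.

Definition run_binop (op : binop) (x y : nat) : nat :=
  match op with
  | Add => x + y | Sub => x - y | Mul => x * y
  | Div => x %/ y | Mod => x %% y | Shr => x %/ 2 ^ y
  end.

Definition input_code (w : seq bool) (x : nat) : nat :=
  match onth w x with None => 0 | Some false => 1 | Some true => 2 end.

Fixpoint ev (w : seq bool) (env : nat -> nat) (e : expr) : nat :=
  match e with
  | EVar x => env x
  | ECst c => c
  | EInp e => input_code w (ev w env e)
  | EBin op a b => run_binop op (ev w env a) (ev w env b)
  | EIfEq a b e1 e2 => if ev w env a == ev w env b then ev w env e1 else ev w env e2
  | EIfLe a b e1 e2 => if ev w env a <= ev w env b then ev w env e1 else ev w env e2
  end.

Fixpoint vars_lt (v : nat) (e : expr) : bool :=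
  match e with
  | EVar x => x < v
  | ECst _ => true
  | EInp e => vars_lt v e
  | EBin _ a b => vars_lt v a && vars_lt v b
  | EIfEq a b e1 e2 | EIfLe a b e1 e2 =>
      [&& vars_lt v a, vars_lt v b, vars_lt v e1 & vars_lt v e2]
  end.

Lemma ev_ext w v env env' e : vars_lt v e -> (forall h, h < v -> env h = env' h) ->
  ev w env e = ev w env' e.
Proof.
move=> e_v E; elim: e e_v => //=.
- by move=> e IH /IH ->.
- by move=> op a IHa b IHb /andP[/IHa-> /IHb->].
- by move=> a IHa b IHb e1 IH1 e2 IH2 /and4P[/IHa-> /IHb-> /IH1-> /IH2->].
- by move=> a IHa b IHb e1 IH1 e2 IH2 /and4P[/IHa-> /IHb-> /IH1-> /IH2->].
Qed.

(* [vals] lists the counters from [d] on that are known; those below [d] are given by [e] *)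
Definition holds (d : nat) (e : nat -> nat) (o : seq 'I_3) (vals : seq nat) (s : store) :=
  [/\ forall h, h < d -> cnt s h = e h, out s = o &
      forall i, i < size vals -> cnt s (d + i) = nth 0 vals i].

(** * Hoare triples with a bound on the running time *)

Section Triples.
Variable w : seq bool.

Definition triple (P : store -> Prop) (p : prog) (c : nat) (Q : store -> Prop) :=
  forall s, P s -> exists s' n, [/\ exec w p s s' n, n <= c & Q s'].

Lemma triple_seq P Q R p q c1 c2 :
  triple P p c1 Q -> triple Q q c2 R -> triple P (Seq p q) (c1 + c2) R.
Proof.
move=> pP qP s /pP[s1 [n1 [p_run n1_le /qP[s2 [n2 [q_run n2_le s2_R]]]]]].
by exists s2, (n1 + n2); split; rewrite ?leq_add //; apply: ExSeq p_run q_run.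
Qed.

Lemma triple_le P Q p c c' : c <= c' -> triple P p c Q -> triple P p c' Q.
Proof.
move=> c_le pP s /pP[s1 [n1 [p_run n1_le s1_Q]]].
by exists s1, n1; split=> //; apply: leq_trans c_le.
Qed.

Lemma triple_post P Q Q' p c : (forall s, Q s -> Q' s) -> triple P p c Q -> triple P p c Q'.
Proof.
by move=> QQ' pP s /pP[s1 [n1 [p_run n1_le /QQ' s1_Q]]]; exists s1, n1.
Qed.

Lemma triple_pre (P P' Q : store -> Prop) p c :
  (forall s, P' s -> P s) -> triple P p c Q -> triple P' p c Q.
Proof. by move=> PP' pP s /PP'; apply: pP. Qed.

Lemma triple_if (t : test) (b : bool) P Q p q c :
  (forall s, P s -> run_test w t s = b) -> triple P (if b then p else q) c Q ->
  triple P (If t p q) c.+1 Q.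
Proof.
move=> tP pP s s_P; have [s1 [n1 [p_run n1_le s1_Q]]] := pP s s_P.
by exists s1, n1.+1; split=> //; apply: ExIf; rewrite tP.
Qed.

Lemma holds_cat d e o vals junk s : holds d e o (vals ++ junk) s -> holds d e o vals s.
Proof.
case=> low out_s high; split=> // i i_lt; rewrite high ?nth_cat ?i_lt //.
by rewrite size_cat ltn_addr.
Qed.

Lemma triple_clr d e o vals i : i <= size vals ->
  triple (holds d e o vals) (Act (Clr (d + i))) 1 (holds d e o (set_nth 0 vals i 0)).
Proof.
move=> i_le s [low out_s high]; exists (run_action (Clr (d + i)) s), 1.
split=> //; first exact: ExAct.
split=> //= [h h_d|j]; rewrite /upd; first by rewrite -low // ltn_eqF // ltn_addr.
rewrite size_set_nth nth_set_nth /= eqn_add2l; case: eqP => // j_i j_lt.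
by rewrite high //; lia.
Qed.

Lemma triple_inc d e o vals i : i < size vals ->
  triple (holds d e o vals) (Act (Inc (d + i))) 1
    (holds d e o (set_nth 0 vals i (nth 0 vals i).+1)).
Proof.
move=> i_le s [low out_s high]; exists (run_action (Inc (d + i)) s), 1.
split=> //; first exact: ExAct.
split=> //= [h h_d|j]; rewrite /upd; first by rewrite -low // ltn_eqF // ltn_addr.
rewrite size_set_nth nth_set_nth /= eqn_add2l high //; case: eqP => // j_i j_lt.
by rewrite high //; lia.
Qed.

Lemma triple_ifeq d e o vals i j Q p q c : i < size vals -> j < size vals ->
  triple (holds d e o vals) (if nth 0 vals i == nth 0 vals j then p else q) c Q ->
  triple (holds d e o vals) (If (TEq (d + i) (d + j)) p q) c.+1 Q.
Proof.
move=> i_lt j_lt; apply: triple_if => s [_ _ high].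
by rewrite /= !high.
Qed.

(** The test succeeds at stage [m] and at no earlier one, so there are exactly [m] rounds, each
    paying [c] for the body and one for the test; one more test ends the loop. *)
Lemma triple_until (t : test) p (I : nat -> store -> Prop) m c :
    (forall k s, k <= m -> I k s -> run_test w t s = (k == m)) ->
    (forall k, k < m -> triple (I k) p c (I k.+1)) ->
  triple (I 0) (Until t p) (m * c.+1).+1 (I m).
Proof.
move=> tI pI; suff gen : forall j s, j <= m -> I (m - j) s ->
    exists s' n, [/\ exec w (Until t p) s s' n, n <= (j * c.+1).+1 & I m s'].
  by move=> s s_I; apply: gen (leqnn m) _; rewrite subnn.
elim=> [|j IH] s j_m s_I.
  rewrite subn0 in s_I; exists s, 1; split=> //; apply: ExStop.
  by rewrite (tI m) ?eqxx.
have j_lt : m - j.+1 < m by lia.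
have [s1 [n1 [p_run n1_le s1_I]]] := pI _ j_lt s s_I.
rewrite -subSn // subSS in s1_I.
have [s2 [n2 [run n2_le s2_I]]] := IH s1 (ltnW j_m) s1_I.
exists s2, (n1 + n2).+1; split=> //; last by rewrite mulSn; lia.
by apply: ExLoop p_run run; rewrite (tI (m - j.+1)) ?leq_subr //; lia.
Qed.

Definition For (i b : nat) (p : prog) : prog :=
  Seq (Act (Clr i)) (Until (TEq i b) (Seq p (Act (Inc i)))).

(** The body ends with the values of stage [k.+1] except for the index, which is still [k]; the
    [Inc] that follows completes [V k.+1]. *)
Lemma triple_for d e (o : nat -> seq 'I_3) vals (V : nat -> seq nat) i b m p c :
    i <= size vals -> set_nth 0 vals i 0 = V 0 ->
    (forall k, [/\ i < size (V k), b < size (V k), nth 0 (V k) i = k &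
       nth 0 (V k) b = m]) ->
    (forall k, k < m -> triple (holds d e (o k) (V k)) p c
       (holds d e (o k.+1) (set_nth 0 (V k.+1) i k))) ->
  triple (holds d e (o 0) vals) (For (d + i) (d + b) p) (m * c.+2).+2
    (holds d e (o m) (V m)).
Proof.
move=> i_le V0 V_ p_run; have -> : (m * c.+2).+2 = 1 + (m * c.+2).+1 by lia.
apply: triple_seq; first exact: triple_clr i_le.
rewrite V0; apply: (@triple_until _ _ (fun k => holds d e (o k) (V k)) m).
  move=> k s _ [_ _ high]; have [iV bV Vi Vb] := V_ k.
  by rewrite /= !high // Vi Vb.
move=> k k_m; rewrite -addn1; apply: triple_seq; first exact: p_run.
have [iV bV Vi Vb] := V_ k.+1.
apply: triple_post (@triple_inc d e (o k.+1) (set_nth 0 (V k.+1) i k) i _) => [s|].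
  rewrite nth_set_nth /= eqxx set_set_nth eqxx; congr holds.
  apply: (@eq_from_nth _ 0); first by rewrite size_set_nth; apply/maxn_idPr.
  by move=> j _; rewrite nth_set_nth /=; case: eqP => // ->; rewrite Vi.
by rewrite size_set_nth leq_max ltnSn.
Qed.

Definition Copy (d x : nat) : prog :=
  Seq (Act (Clr d)) (Until (TEq d x) (Act (Inc d))).

Lemma triple_copy d e o vals i x : i <= size vals -> x < size vals -> x != i ->
  triple (holds d e o vals) (Copy (d + i) (d + x)) (nth 0 vals x * 2).+2
    (holds d e o (set_nth 0 vals i (nth 0 vals x))).
Proof.
move=> i_le x_lt x_i; set m := nth 0 vals x.
have -> : (m * 2).+2 = 1 + (m * 2).+1 by lia.
apply: triple_seq; first exact: triple_clr.
apply: (@triple_until _ _ (fun k => holds d e o (set_nth 0 vals i k)) m)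
  => [k s _ [_ _ high]|k k_m].
  by rewrite /= !high ?size_set_nth ?leq_max ?ltnSn ?x_lt ?orbT // !nth_set_nth /= eqxx (negPf x_i).
have := @triple_inc d e o (set_nth 0 vals i k) i.
by rewrite size_set_nth nth_set_nth /= eqxx set_set_nth eqxx; apply; rewrite leq_max ltnSn.
Qed.

End Triples.

(** Clearing a counter that is already 0 serves as the idle action. *)
Definition skip (d : nat) : prog := Act (Clr d).

(** Counts up to [x] while keeping remainder and quotient. For [y = 0] the comparison never
    succeeds, as the remainder has just been incremented; this agrees with [modn0] and [divn0]. *)
Definition div_loop (d : nat) : prog :=
  Seq (Act (Clr (d + 2))) (Seq (Act (Clr (d + 3))) (Seq (Act (Clr (d + 4)))
  (Seq (Act (Clr (d + 5)))
  (For (d + 4) (d + 0)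
    (Seq (Act (Inc (d + 2)))
         (If (TEq (d + 2) (d + 1))
             (Seq (Act (Clr (d + 2))) (Act (Inc (d + 3))))
             (skip (d + 5)))))))).

Definition binop_prog (op : binop) (d : nat) : prog :=
  match op with
  | Add => For (d + 2) (d + 1) (Act (Inc (d + 0)))
  | Sub =>
      Seq (Act (Clr (d + 2))) (Seq (Act (Clr (d + 3)))
      (Seq (For (d + 4) (d + 0)
             (If (TEq (d + 3) (d + 1)) (Act (Inc (d + 2))) (Act (Inc (d + 3)))))
           (Copy (d + 0) (d + 2))))
  | Mul =>
      Seq (Act (Clr (d + 2))) (Seq (Act (Clr (d + 3))) (Seq (Act (Clr (d + 4)))
      (Seq (For (d + 3) (d + 0) (For (d + 4) (d + 1) (Act (Inc (d + 2)))))
           (Copy (d + 0) (d + 2)))))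
  | Div => Seq (div_loop d) (Copy (d + 0) (d + 3))
  | Mod => Seq (div_loop d) (Copy (d + 0) (d + 2))
  | Shr =>
      For (d + 2) (d + 1)
        (Seq (Act (Clr (d + 3))) (Seq (Act (Clr (d + 4))) (Seq (Act (Clr (d + 5)))
        (Seq (For (d + 6) (d + 0)
               (If (TEq (d + 3) (d + 5)) (Act (Inc (d + 3)))
                   (Seq (Act (Clr (d + 3))) (Act (Inc (d + 4))))))
             (Copy (d + 0) (d + 4))))))
  end.

Lemma div_loopP w d e o x y :
  triple w (holds d e o [:: x; y]) (div_loop d) (x * 6 + 6)
    (holds d e o [:: x; y; x %% y; x %/ y; x; 0]).
Proof.
have -> : x * 6 + 6 = 1 + (1 + (1 + (1 + (x * 4.+2).+2))) by lia.
do 4?[apply: triple_seq; first exact: triple_clr] => /=.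
apply: (@triple_for _ _ _ (fun=> o) _ (fun k => [:: x; y; k %% y; k %/ y; k; 0])) => //.
  by rewrite /= mod0n div0n.
move=> k k_x; apply: (@triple_seq _ _ _ _ _ _ 1 3); first exact: triple_inc.
rewrite /=; apply: triple_ifeq => //=.
have [->|y_gt0] := posnP y.
  rewrite !modn0 !divn0 /=.
  by apply: triple_le (triple_clr _ (i := 5) _).
case: eqP => [k_y|k_y].
  apply: (@triple_seq _ _ _ _ _ _ 1 1); first exact: triple_clr.
  have -> : k.+1 %% y = 0.
    by rewrite -addn1 -modnDml addn1 k_y modnn.
  have -> : k.+1 %/ y = (k %/ y).+1.
    by rewrite {1}(divn_eq k y) -addnS k_y divnMDl // divnn y_gt0 addn1.
  exact: triple_inc.
have lt : (k %% y).+1 < y by have := ltn_pmod k y_gt0; lia.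
have -> : k.+1 %% y = (k %% y).+1.
  by rewrite -addn1 -modnDml addn1 modn_small.
have -> : k.+1 %/ y = k %/ y.
  by rewrite {1}(divn_eq k y) -addnS divnMDl ?(divn_small lt) ?addn0 //; apply: leq_trans lt.
by apply: triple_le (triple_clr _ (i := 5) _).
Qed.

Lemma binopP w op d e o x y :
  triple w (holds d e o [:: x; y]) (binop_prog op d) (16 * (x + 1) * (y + 1))
    (holds d e o [:: run_binop op x y]).
Proof.
have drop v junk : forall s, holds d e o (v :: junk) s -> holds d e o [:: v] s.
  by move=> s; apply: (@holds_cat _ _ _ [:: v]).
case: op => /=.
- apply: (@triple_le _ _ _ _ (y * 3).+2); first nia.
  apply: triple_post (drop _ [:: y; y]) _.
  apply: (@triple_for _ _ _ (fun=> o) _ (fun k => [:: x + k; y; k])) => //.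
    by rewrite /= addn0.
  by move=> k k_y; rewrite addnS; apply: triple_inc.
- apply: (@triple_le _ _ _ _ (1 + (1 + ((x * 4).+2 + ((x - y) * 2).+2)))).
    have : (x - y) * 2 <= x * 2 by rewrite leq_mul2r leq_subr orbT.
    nia.
  do 2?[apply: triple_seq; first exact: triple_clr] => /=.
  apply: triple_seq.
    (* Counter [d + 3] saturates at [y]; only the rounds after that count towards the difference,
       which is therefore truncated. *)
    apply: (@triple_for _ _ _ (fun=> o) _ (fun k => [:: x; y; k - y; minn k y; k])) => //.
      by rewrite /= sub0n min0n.
    move=> k k_x /=; apply: triple_ifeq => //=; case: eqP => k_y.
      have [-> ->] : k.+1 - y = (k - y).+1 /\ minn k.+1 y = minn k y by lia.
      exact: triple_inc.
    have [-> ->] : k.+1 - y = k - y /\ minn k.+1 y = (minn k y).+1 by lia.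
    exact: triple_inc.
  by apply: triple_post (drop _ _) _; apply: triple_copy.
- apply: (@triple_le _ _ _ _ (1 + (1 + (1 + ((x * (y * 3).+4).+2 + (x * y * 2).+2)))));
    first nia.
  do 3?[apply: triple_seq; first exact: triple_clr] => /=.
  (* The last entry is the index of the inner loop: 0 before the first round, left at [y] by each
     round. *)
  pose V k := [:: x; y; k * y; k; if k == 0 then 0 else y].
  apply: (@triple_seq _ _ (holds d e o (V x))); last first.
    by apply: triple_post (drop _ _) _; apply: (@triple_copy _ _ _ _ (V x)).
  apply: (@triple_for _ _ _ (fun=> o) _ V) => //.
  move=> k k_x; rewrite /V /= mulSnr.
  apply: (@triple_for _ _ _ (fun=> o) _ (fun j => [:: x; y; k * y + j; k; j])) => //=.
    by rewrite addn0.
  by move=> j j_y; rewrite (addnS (k * y)); apply: triple_inc.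
- apply: (@triple_le _ _ _ _ (x * 6 + 6 + ((x %/ y) * 2).+2)).
    have : (x %/ y) * 2 <= x * 2 by rewrite leq_mul2r leq_div orbT.
    nia.
  apply: triple_seq; first exact: div_loopP.
  by apply: triple_post (drop _ _) _; apply: triple_copy.
- apply: (@triple_le _ _ _ _ (x * 6 + 6 + ((x %% y) * 2).+2)).
    have : (x %% y) * 2 <= x * 2 by rewrite leq_mul2r leq_mod orbT.
    nia.
  apply: triple_seq; first exact: div_loopP.
  by apply: triple_post (drop _ _) _; apply: triple_copy.
- apply: (@triple_le _ _ _ _ (y * (1 + (1 + (1 + ((x * 5).+2 + (x * 2).+2)))).+2).+2); first nia.
  (* A round halves by counting: parity, half, a constant 0 to compare with, and the inner index.
     Before the first round these four are unknown. *)
  pose V k := [:: x %/ 2 ^ k; y; k] ++ if k == 0 then [::] else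
    [:: odd (x %/ 2 ^ k.-1) : nat; x %/ 2 ^ k; 0; x %/ 2 ^ k.-1].
  apply: triple_post (drop _ (behead (V y))) _.
  apply: (@triple_for _ _ _ (fun=> o) _ V) => //=.
    by rewrite /V expn0 divn1.
  move=> k k_y; apply: (@triple_pre _ (holds d e o [:: x %/ 2 ^ k; y; k])).
    by move=> s; apply: holds_cat.
  set z := x %/ 2 ^ k; have z_x : z <= x by apply: leq_div.
  do 3?[apply: triple_seq; first exact: triple_clr] => /=.
  apply: (@triple_le _ _ _ _ ((z * 5).+2 + (z./2 * 2).+2)); first lia.
  have zE : x %/ 2 ^ k.+1 = z./2 by rewrite expnSr divnMA divn2.
  rewrite zE; apply: triple_seq.
    apply: (@triple_for _ _ _ (fun=> o) _ (fun j => [:: z; y; k; odd j : nat; j./2; 0; j])) => //.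
    move=> j j_z /=; apply: triple_ifeq => //=; rewrite uphalf_half.
    case: (odd j) => /=.
      by apply: (@triple_seq _ _ _ _ _ _ 1 1); [exact: triple_clr|exact: triple_inc].
    by apply: (@triple_le _ _ _ _ 1) => //; apply: triple_inc.
  by apply: triple_copy.
Qed.

(** Closes the bounds [(B + 2) ^ k] under sums. This needs a base of at least 2, whence the 2 added
    to [B] throughout. *)
Lemma pow_add X a b : 2 <= X -> X ^ a + X ^ b <= X ^ (a + b).+1.
Proof.
move=> X2; have Xp c : 0 < X ^ c by rewrite expn_gt0; lia.
rewrite expnS expnD; apply: (@leq_trans (2 * (X ^ a * X ^ b))); last by rewrite leq_mul2r X2 orbT.
by have := Xp a; have := Xp b; nia.
Qed.

Lemma leq_pow X c : 2 <= X -> c <= X ^ c.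
Proof. by move=> X2; apply/ltnW/ltn_expl. Qed.

Lemma leq_pow2 X a b : 2 <= X -> a <= b -> X ^ a <= X ^ b.
Proof. by move=> X2; rewrite leq_exp2l. Qed.

(** The result goes to counter [d]; all counters from [d] on are scratch and those below are
    preserved. Hence the second operand is evaluated at [d.+1], out of reach of the first result. *)
Fixpoint ecomp (e : expr) (d : nat) : prog :=
  match e with
  | EVar x => Copy d x
  | ECst c => iter c (fun p => Seq p (Act (Inc d))) (Act (Clr d))
  | EInp e => Seq (ecomp e d)
      (If (TInp d None) (Act (Clr d))
      (If (TInp d (Some false)) (Seq (Act (Clr d)) (Act (Inc d)))
          (Seq (Act (Clr d)) (Seq (Act (Inc d)) (Act (Inc d))))))
  | EBin op a b => Seq (ecomp a d) (Seq (ecomp b d.+1) (binop_prog op d))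
  | EIfEq a b e1 e2 => Seq (ecomp a d) (Seq (ecomp b d.+1)
      (If (TEq d d.+1) (ecomp e1 d) (ecomp e2 d)))
  | EIfLe a b e1 e2 => Seq (ecomp a d) (Seq (ecomp b d.+1)
      (If (TLe d d.+1) (ecomp e1 d) (ecomp e2 d)))
  end.

(** One exponent serves all inputs, stores and offsets. Value and time are bounded together because
    the time of an operation depends on the size of its arguments. *)
Definition comp_spec (e : expr) (k : nat) := forall v d w s B,
  vars_lt v e -> v <= d -> (forall h, h < v -> cnt s h <= B) ->
  ev w (cnt s) e <= (B + 2) ^ k /\
  exists s' n, [/\ exec w (ecomp e d) s s' n, n <= (B + 2) ^ k &
    holds d (cnt s) (out s) [:: ev w (cnt s) e] s'].

Lemma holds_refl d s : holds d (cnt s) (out s) [::] s.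
Proof. by []. Qed.

Lemma holds_push d e o x y s1 s2 : holds d e o [:: x] s1 ->
  holds d.+1 (cnt s1) (out s1) [:: y] s2 -> holds d e o [:: x; y] s2.
Proof.
case=> low1 out1 high1 [low2 out2 high2]; split.
- by move=> h h_d; rewrite low2 ?low1 // ltnW.
- by rewrite out2.
case=> [|[|i]] // _; last by have /= := high2 0 isT; rewrite addn0 addn1.
by have /= := high1 0 isT; rewrite addn0 => <-; rewrite low2.
Qed.

Lemma comp_pair a b ka kb : comp_spec a ka -> comp_spec b kb -> forall v d w s B,
  vars_lt v a -> vars_lt v b -> v <= d -> (forall h, h < v -> cnt s h <= B) ->
  exists s' n, [/\ forall q s'' m, exec w q s' s'' m ->
       exec w (Seq (ecomp a d) (Seq (ecomp b d.+1) q)) s s'' (n + m),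
     n <= (B + 2) ^ (ka + kb).+1 &
     holds d (cnt s) (out s) [:: ev w (cnt s) a; ev w (cnt s) b] s'].
Proof.
move=> aP bP v d w s B a_v b_v v_d s_B.
have [_ [s1 [n1 [run1 n1_le h1]]]] := aP v d w s B a_v v_d s_B.
have eq1 h : h < v -> cnt s1 h = cnt s h.
  by move=> h_v; case: h1 => low _ _; rewrite low //; apply: leq_trans v_d.
have s1_B h : h < v -> cnt s1 h <= B by move=> h_v; rewrite eq1 ?s_B.
have [_ [s2 [n2 [run2 n2_le h2]]]] := bP v d.+1 w s1 B b_v (leqW v_d) s1_B.
rewrite (ev_ext w b_v eq1) in h2.
exists s2, (n1 + n2); split.
- by move=> q s'' m run; rewrite -addnA; apply: ExSeq run1 (ExSeq run2 run).
- by apply: leq_trans (leq_add n1_le n2_le) (pow_add _ _ _); rewrite addn2.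
- exact: holds_push h1 h2.
Qed.

Lemma run_binop_le op x y : run_binop op x y <= (x + 1) * (y + 1).
Proof.
have := leq_div x y; have := leq_mod x y; have := leq_div x (2 ^ y).
case: op => /=; move: (x %/ _) (x %% _) (x %/ 2 ^ y); nia.
Qed.

Lemma comp_branch (t : nat -> nat -> test) (r : nat -> nat -> bool) a b e1 e2 ka kb k1 k2 :
    (forall w s x y, run_test w (t x y) s = r (cnt s x) (cnt s y)) ->
    comp_spec a ka -> comp_spec b kb -> comp_spec e1 k1 -> comp_spec e2 k2 ->
  forall v d w s B,
  [&& vars_lt v a, vars_lt v b, vars_lt v e1 & vars_lt v e2] -> v <= d ->
  (forall h, h < v -> cnt s h <= B) ->
  let x := if r (ev w (cnt s) a) (ev w (cnt s) b) then ev w (cnt s) e1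
           else ev w (cnt s) e2 in
  x <= (B + 2) ^ (ka + kb + k1 + k2 + 4) /\
  exists s' n, [/\ exec w (Seq (ecomp a d) (Seq (ecomp b d.+1)
      (If (t d d.+1) (ecomp e1 d) (ecomp e2 d)))) s s' n,
    n <= (B + 2) ^ (ka + kb + k1 + k2 + 4) & holds d (cnt s) (out s) [:: x] s'].
Proof.
move=> tE aP bP e1P e2P v d w s B /and4P[a_v b_v e1_v e2_v] v_d s_B x.
have X2 : 2 <= B + 2 by rewrite addn2.
have [s1 [n1 [run1 n1_le h1]]] := comp_pair aP bP w a_v b_v v_d s_B.
have eq1 h : h < v -> cnt s1 h = cnt s h.
  by move=> h_v; case: h1 => low _ _; rewrite low //; apply: leq_trans v_d.
have s1_B h : h < v -> cnt s1 h <= B by move=> h_v; rewrite eq1 ?s_B.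
have [x_le [s2 [n2 [run2 n2_le h2]]]] : x <= (B + 2) ^ (k1 + k2) /\
    exists s' n, [/\ exec w (if run_test w (t d d.+1) s1 then ecomp e1 d else ecomp e2 d) s1 s' n,
      n <= (B + 2) ^ (k1 + k2) & holds d (cnt s1) (out s1) [:: x] s'].
  have -> : run_test w (t d d.+1) s1 = r (ev w (cnt s) a) (ev w (cnt s) b).
    case: h1 => _ _ high; rewrite tE; have /= <- := high 0 isT; have /= <- := high 1 isT.
    by rewrite addn0 addn1.
  rewrite /x; case: ifP => _.
    have := e1P v d w s1 B e1_v v_d s1_B; rewrite (ev_ext w e1_v eq1).
    case=> x_le [s2 [n2 [run2 n2_le h2]]]; split.
      by apply: leq_trans x_le _; rewrite leq_pow2 ?leq_addr.
    exists s2, n2; split=> //.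
    by apply: leq_trans n2_le _; rewrite leq_pow2 ?leq_addr.
  have := e2P v d w s1 B e2_v v_d s1_B; rewrite (ev_ext w e2_v eq1).
  case=> x_le [s2 [n2 [run2 n2_le h2]]]; split.
    by apply: leq_trans x_le _; rewrite leq_pow2 ?leq_addl.
  exists s2, n2; split=> //.
  by apply: leq_trans n2_le _; rewrite leq_pow2 ?leq_addl.
split; first by apply: leq_trans x_le _; rewrite leq_pow2 //; lia.
exists s2, (n1 + n2.+1); split; first by apply: run1; apply: ExIf.
  apply: leq_trans (leq_add n1_le (_ : _ <= (B + 2) ^ (k1 + k2 + 1).+1)) _.
    by apply: leq_trans (pow_add _ _ X2); rewrite -addn1 leq_add // expn1; lia.
  by apply: leq_trans (pow_add _ _ X2) _; rewrite leq_pow2 //; lia.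
case: h1 h2 => low1 out1 _ [low2 out2 high2]; split=> // [h h_d|]; last by rewrite out2.
by rewrite low2 ?low1.
Qed.

Lemma compE e : exists k, comp_spec e k.
Proof.
elim: e => [x|c|e [k eP]|op a [ka aP] b [kb bP]
           |a [ka aP] b [kb bP] e1 [k1 e1P] e2 [k2 e2P]
           |a [ka aP] b [kb bP] e1 [k1 e1P] e2 [k2 e2P]].
- exists 3 => v d w s B /= x_v v_d s_B; have x_B := s_B _ x_v.
  have x_le : cnt s x * 2 + 2 <= (B + 2) ^ 3.
    by rewrite expnS mulnC; nia.
  split; first by apply: leq_trans x_le; lia.
  have x_d : x < d by apply: leq_trans v_d.
  pose I k s' := holds d (cnt s) (out s) [:: k] s'.
  suff run : triple w (eq s) (Copy d x) (cnt s x * 2).+2 (I (cnt s x)).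
    have [s1 [n1 [run1 n1_le h1]]] := run s erefl.
    by exists s1, n1; split=> //; apply: leq_trans x_le; rewrite addn2.
  have -> : (cnt s x * 2).+2 = 1 + (cnt s x * 2).+1 by lia.
  apply: (@triple_seq _ _ (I 0)).
    move=> _ <-; have := @triple_clr w d (cnt s) (out s) [::] 0 isT s (holds_refl d s).
    by rewrite addn0.
  apply: triple_until => [k s1 _ [low _ high]|k _].
    by have /= := high 0 isT; rewrite addn0 => ->; rewrite low.
  by have := @triple_inc w d (cnt s) (out s) [:: k] 0 isT; rewrite addn0.
- exists (c + 3) => v d w s B /= _ _ _; have X2 : 2 <= B + 2 by rewrite addn2.
  split; first by apply: leq_trans (leq_pow _ X2) _; rewrite leq_pow2 ?leq_addr.
  suff [s1 [run1 h1]] : exists s1, exec w (iter c (fun p => Seq p (Act (Inc d)))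
      (Act (Clr d))) s s1 c.+1 /\ holds d (cnt s) (out s) [:: c] s1.
    exists s1, c.+1; split=> //; apply: leq_trans (leq_pow _ X2) _.
    by rewrite leq_pow2 //; lia.
  elim: c => [|c [s1 [run1 h1]]].
    exists (run_action (Clr d) s); split; first exact: ExAct.
    split=> //= [h h_d|[|i]] //; rewrite /upd ?addn0 ?eqxx //.
    by rewrite ltn_eqF.
  exists (run_action (Inc d) s1); split.
    by rewrite -[c.+2]addn1; apply: ExSeq run1 _; apply: ExAct.
  case: h1 => low out1 high; split=> //= [h h_d|[|i]] //; rewrite /upd ?addn0 ?eqxx //.
    by rewrite ltn_eqF // low.
  by rewrite -(addn0 d) high.
- exists (k + 4) => v d w s B /= e_v v_d s_B; have X2 : 2 <= B + 2 by rewrite addn2.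
  have [_ [s1 [n1 [run1 n1_le h1]]]] := eP v d w s B e_v v_d s_B.
  set x := ev w _ e in h1 *.
  split.
    apply: (@leq_trans 2); first by rewrite /input_code; case: onth => // -[].
    by apply: leq_trans (leq_pow _ X2) _; rewrite leq_pow2 //; lia.
  have cl := @triple_clr w d (cnt s) (out s) [:: x] 0 isT.
  have inc y := @triple_inc w d (cnt s) (out s) [:: y] 0 isT.
  rewrite addn0 /= in cl inc.
  suff run : triple w (holds d (cnt s) (out s) [:: x])
      (If (TInp d None) (Act (Clr d))
        (If (TInp d (Some false)) (Seq (Act (Clr d)) (Act (Inc d)))
          (Seq (Act (Clr d)) (Seq (Act (Inc d)) (Act (Inc d)))))) 5
      (holds d (cnt s) (out s) [:: input_code w x]).
    have [s2 [n2 [run2 n2_le h2]]] := run s1 h1.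
    exists s2, (n1 + n2); split=> //; first exact: ExSeq run1 run2.
    apply: (@leq_trans ((B + 2) ^ k + (B + 2) ^ 3)).
      rewrite leq_add //; apply: leq_trans n2_le _.
      by apply: (@leq_trans (2 ^ 3)) => //; apply: leq_exp2.
    by apply: leq_trans (pow_add _ _ X2) _; rewrite leq_pow2 //; lia.
  have cntd s' : holds d (cnt s) (out s) [:: x] s' -> cnt s' d = x.
    by case=> _ _ /(_ 0 isT); rewrite addn0.
  rewrite /input_code; case E : (onth w x) => [[]|].
  + apply: (@triple_if _ _ false) => [s' /cntd /= ->|]; first by rewrite E.
    apply: (@triple_if _ _ false) => [s' /cntd /= ->|]; first by rewrite E.
    apply: (@triple_seq _ _ _ _ _ _ 1 2 cl).
    exact: (@triple_seq _ _ _ _ _ _ 1 1 (inc _) (inc _)).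
  + apply: (@triple_if _ _ false) => [s' /cntd /= ->|]; first by rewrite E.
    apply: (@triple_if _ _ true) => [s' /cntd /= ->|]; first by rewrite E.
    apply: (@triple_le _ _ _ _ (1 + 1)) => //.
    exact: (@triple_seq _ _ _ _ _ _ 1 1 cl (inc _)).
  + apply: (@triple_if _ _ true) => [s' /cntd /= ->|]; first by rewrite E.
    exact: (@triple_le _ _ _ _ 1).
- exists (2 * (ka + kb) + 10) => v d w s B /= /andP[a_v b_v] v_d s_B.
  have X2 : 2 <= B + 2 by rewrite addn2.
  have [x_le _] := aP v d w s B a_v v_d s_B.
  have [y_le _] := bP v d w s B b_v v_d s_B.
  have [s1 [n1 [run1 n1_le h1]]] := comp_pair aP bP w a_v b_v v_d s_B.
  have [s2 [n2 [run2 n2_le h2]]] := binopP w op h1.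
  set x := ev w (cnt s) a in x_le n2_le h2 *.
  set y := ev w (cnt s) b in y_le n2_le h2 *.
  have x1 : x + 1 <= (B + 2) ^ ka.+1.
    by rewrite -(addn0 ka) (leq_trans _ (pow_add _ _ X2)) // leq_add.
  have y1 : y + 1 <= (B + 2) ^ kb.+1.
    by rewrite -(addn0 kb) (leq_trans _ (pow_add _ _ X2)) // leq_add.
  have xy : (x + 1) * (y + 1) <= (B + 2) ^ (ka + kb + 2).
    have -> : ka + kb + 2 = ka.+1 + kb.+1 by lia.
    by rewrite expnD leq_mul.
  split.
    by apply: leq_trans (run_binop_le _ _ _) (leq_trans xy _); rewrite leq_pow2 //; lia.
  exists s2, (n1 + n2); split=> //; first exact: run1.
  apply: leq_trans (leq_add n1_le (_ : _ <= (B + 2) ^ (4 + (ka + kb + 2)))) _.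
    apply: leq_trans n2_le _; rewrite -mulnA expnD leq_mul //.
    by apply: (@leq_trans (2 ^ 4)) => //; apply: leq_exp2.
  by apply: leq_trans (pow_add _ _ X2) _; rewrite leq_pow2 //; lia.
- exists (ka + kb + k1 + k2 + 4) => v d w s B.
  exact: (comp_branch (t := TEq) (r := fun x y => x == y)).
- exists (ka + kb + k1 + k2 + 4) => v d w s B.
  exact: (comp_branch (t := TLe) (r := leq)).
Qed.

(** * Programs that write output *)

Definition emits (d : nat) (p : prog) (g : seq bool -> (nat -> nat) -> seq 'I_3) :=
  (forall w e e', (forall h, h < d -> e h = e' h) -> g w e = g w e') /\
  exists k, forall w s B, (forall h, h < d -> cnt s h <= B) ->
    exists s' n, [/\ exec w p s s' n, n <= (B + 2) ^ k &
      holds d (cnt s) (out s ++ g w (cnt s)) [::] s'].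

Lemma emits_out d x : emits d (Act (Out x)) (fun _ _ => [:: x]).
Proof.
split=> //; exists 0 => w s B _; exists (run_action (Out x) s), 1.
by split; [exact: ExAct | | split=> //=; rewrite cats1].
Qed.

Lemma emits_skip d : emits d (Act (Clr d)) (fun _ _ => [::]).
Proof.
split=> //; exists 0 => w s B _; exists (run_action (Clr d) s), 1.
split; [exact: ExAct | by [] | split=> //=; rewrite ?cats0 //].
by move=> h h_d; rewrite /upd ltn_eqF.
Qed.

Lemma emits_seq d p q g g' : emits d p g -> emits d q g' ->
  emits d (Seq p q) (fun w e => g w e ++ g' w e).
Proof.
move=> [g_ext [k pP]] [g'_ext [k' qP]]; split.
  by move=> w e e' E; rewrite (g_ext w e e') // (g'_ext w e e').
exists (k + k').+1 => w s B s_B.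
have [s1 [n1 [run1 n1_le [low1 out1 _]]]] := pP w s B s_B.
have [|s2 [n2 [run2 n2_le [low2 out2 _]]]] := qP w s1 B.
  by move=> h h_d; rewrite low1 ?s_B.
exists s2, (n1 + n2); split; first exact: ExSeq run1 run2.
  by apply: leq_trans (leq_add n1_le n2_le) (pow_add _ _ _); rewrite addn2.
split=> //; first by move=> h h_d; rewrite low2 ?low1.
by rewrite out2 out1 (g'_ext w _ _ low1) catA.
Qed.

Lemma emits_ext d p g g' : g =2 g' -> emits d p g -> emits d p g'.
Proof.
move=> E; suff -> : g = g' by [].
by apply: functional_extensionality => w; apply: functional_extensionality => e.
Qed.

Definition PIf (a b : expr) (p q : prog) (d : nat) : prog :=
  Seq (ecomp a d) (Seq (ecomp b d.+1) (If (TEq d d.+1) p q)).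

Lemma emits_if d a b p q g g' : vars_lt d a -> vars_lt d b ->
  emits d p g -> emits d q g' ->
  emits d (PIf a b p q d) (fun w e => if ev w e a == ev w e b then g w e else g' w e).
Proof.
move=> a_d b_d [g_ext [k pP]] [g'_ext [k' qP]]; split.
  move=> w e e' E; rewrite (g_ext w e e') // (g'_ext w e e') //.
  by rewrite (ev_ext w a_d E) (ev_ext w b_d E).
have [[ka aP] [kb bP]] := (compE a, compE b).
exists (ka + kb + k + k' + 4) => w s B s_B; have X2 : 2 <= B + 2 by rewrite addn2.
have [s1 [n1 [run1 n1_le [low1 out1 high1]]]] :=
  comp_pair aP bP w a_d b_d (leqnn d) s_B.
have [s2 [n2 [run2 n2_le [low2 out2 _]]]] : exists s2 n2,
    [/\ exec w (if run_test w (TEq d d.+1) s1 then p else q) s1 s2 n2,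
        n2 <= (B + 2) ^ (k + k') &
        holds d (cnt s1) (out s1 ++ (if ev w (cnt s) a == ev w (cnt s) b
           then g w (cnt s) else g' w (cnt s))) [::] s2].
  rewrite /=; have := high1 0 isT; have := high1 1 isT; rewrite addn0 addn1 /= => -> ->.
  have s1_B h : h < d -> cnt s1 h <= B by move=> h_d; rewrite low1 ?s_B.
  case: ifP => _.
    have [s2 [n2 [run2 n2_le]]] := pP w s1 B s1_B; rewrite (g_ext w _ _ low1) => h2.
    exists s2, n2; split=> //.
    by apply: leq_trans n2_le _; rewrite leq_pow2 ?leq_addr.
  have [s2 [n2 [run2 n2_le]]] := qP w s1 B s1_B; rewrite (g'_ext w _ _ low1) => h2.
  exists s2, n2; split=> //.
  by apply: leq_trans n2_le _; rewrite leq_pow2 ?leq_addl.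
exists s2, (n1 + n2.+1); split; first by apply: run1; apply: ExIf.
  apply: leq_trans (leq_add n1_le (_ : _ <= (B + 2) ^ (k + k' + 1).+1)) _.
    by apply: leq_trans (pow_add _ _ X2); rewrite -addn1 leq_add // expn1; lia.
  by apply: leq_trans (pow_add _ _ X2) _; rewrite leq_pow2 //; lia.
split=> //; first by move=> h h_d; rewrite low2 ?low1.
by rewrite out2 out1.
Qed.

Definition PLet (e : expr) (p : prog) (d : nat) : prog := Seq (ecomp e d) p.

(** Substitution of one bound into another: once a value has been bound to a new counter, the
    visible counters are bounded by [B + (B + 2) ^ k] instead of [B]. *)
Lemma leq_subst_pow B k c : (B + (B + 2) ^ k + 2) ^ c <= (B + 2) ^ ((k + 2) * c).
Proof.
have X2 : 2 <= B + 2 by rewrite addn2.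
rewrite expnM; apply: leq_exp2; rewrite -addnA [_ + 2]addnC addnA -{1}(expn1 (B + 2)).
by apply: leq_trans (pow_add _ _ X2) _; rewrite leq_pow2 //; lia.
Qed.

Lemma emits_let d e p g : vars_lt d e -> emits d.+1 p g ->
  emits d (PLet e p d) (fun w env => g w (upd env d (ev w env e))).
Proof.
move=> e_d [g_ext [k pP]]; split.
  move=> w env env' E; apply: g_ext => h; rewrite ltnS /upd (ev_ext w e_d E).
  by case: eqP => // h_d1 h_d; apply: E; lia.
have [ke eP] := compE e.
exists (ke + (ke + 2) * k).+1 => w s B s_B; have X2 : 2 <= B + 2 by rewrite addn2.
have [x_le [s1 [n1 [run1 n1_le [low1 out1 high1]]]]] := eP d d w s B e_d (leqnn d) s_B.
have s1E h : h < d.+1 -> cnt s1 h = upd (cnt s) d (ev w (cnt s) e) h.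
  rewrite ltnS /upd; case: eqP => [->|h_d1 h_d].
    by have /= := high1 0 isT; rewrite addn0.
  by apply: low1; lia.
have [|s2 [n2 [run2 n2_le [low2 out2 _]]]] := pP w s1 (B + (B + 2) ^ ke).
  move=> h h_d; rewrite s1E // /upd; case: eqP => h_d1; first by lia.
  by apply: leq_trans (s_B h _) _; lia.
exists s2, (n1 + n2); split; first exact: ExSeq run1 run2.
  apply: leq_trans (leq_add n1_le (leq_trans n2_le (leq_subst_pow _ _ _))) _.
  exact: pow_add.
split=> //; first by move=> h h_d; rewrite low2 ?low1 // ltnW.
by rewrite out2 out1 (g_ext w _ _ s1E).
Qed.

(** The bound occupies [d] and the index [d + 1], so the body has its scratch from [d.+2] on; this
    fixes the variable numbers in the expressions of the reduction. *)
Definition PFor (e : expr) (p : prog) (d : nat) : prog :=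
  Seq (ecomp e d) (For (d + 1) (d + 0) p).

Lemma emits_for d e p g : vars_lt d e -> emits d.+2 p g ->
  emits d (PFor e p d) (fun w env => flatten
    [seq g w (upd (upd env d (ev w env e)) d.+1 k) | k <- iota 0 (ev w env e)]).
Proof.
move=> e_d [g_ext [k pP]]; split.
  move=> w env env' E; rewrite (ev_ext w e_d E); congr flatten; apply: eq_map => j.
  apply: g_ext => h h_d; rewrite /upd; case: eqP => // h_d1.
  by case: eqP => // h_d2; apply: E; lia.
have [ke eP] := compE e.
exists (ke + (ke + ((ke + 2) * k + 2).+1 + 2).+1).+1 => w s B s_B.
have X2 : 2 <= B + 2 by rewrite addn2.
have [x_le [s1 [n1 [run1 n1_le h1]]]] := eP d d w s B e_d (leqnn d) s_B.
set m := ev w (cnt s) e in x_le h1 *; set X := B + 2 in X2 x_le n1_le *.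
pose o j := out s ++ flatten [seq g w (upd (upd (cnt s) d m) d.+1 i) | i <- iota 0 j].
have body j : j < m -> triple w (holds d (cnt s) (o j) [:: m; j]) p
    (X ^ ((ke + 2) * k)) (holds d (cnt s) (o j.+1) (set_nth 0 [:: m; j.+1] 1 j)).
  move=> j_m s2 [low2 out2 high2].
  have s2E h : h < d.+2 -> cnt s2 h = upd (upd (cnt s) d m) d.+1 j h.
    rewrite /upd; case: eqP => [-> _|h_d1]; first by have /= := high2 1 isT; rewrite addn1.
    case: eqP => [-> _|h_d2 h_d]; first by have /= := high2 0 isT; rewrite addn0.
    by apply: low2; lia.
  have [|s3 [n3 [run3 n3_le [low3 out3 _]]]] := pP w s2 (B + X ^ ke).
    move=> h h_d; rewrite s2E // /upd; case: eqP => h_d0; first by lia.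
    case: eqP => h_d1; first by lia.
    case: (ltnP h d) => h_d2; first by apply: leq_trans (s_B h h_d2) _; lia.
    lia.
  exists s3, n3; split=> //; first exact: leq_trans n3_le (leq_subst_pow _ _ _).
  split=> [h h_d||[|[|]] // _].
  + by rewrite low3 ?low2 //; lia.
  + rewrite out3 out2 (g_ext w _ _ s2E) /o -(addn1 j) iotaD map_cat flatten_cat.
    by rewrite /= cats0 add0n catA.
  + by rewrite low3 ?(high2 0) //; lia.
  + by rewrite low3 ?(high2 1) //; lia.
have h1' : holds d (cnt s) (o 0) [:: m] s1 by rewrite /o cats0.
have [||k'|s2 [n2 [run2 n2_le h2]]] :=
  @triple_for w d (cnt s) o [:: m] (fun j => [:: m; j]) 1 0 m p _ _ _ _ body s1 h1' => //.
exists s2, (n1 + n2); split; first exact: ExSeq run1 run2.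
  apply: leq_trans (leq_add n1_le (leq_trans n2_le
    (_ : _ <= X ^ (ke + ((ke + 2) * k + 2).+1 + 2).+1))) _.
    apply: leq_trans (pow_add _ _ X2); rewrite -addn2 leq_add //.
      rewrite expnD leq_mul // -addn2; apply: leq_trans (pow_add _ _ X2).
      by rewrite leq_add // expnS; nia.
    by rewrite expnS; nia.
  exact: pow_add.
by case: h2 => low2 out2 _; split.
Qed.

(** Division-based and most significant bit first, so that a loop can print it without storing
    digits. The test [x %/ 2 ^ f' == 0] recognizes leading zeros. *)
Fixpoint number_bits (f x : nat) : seq 'I_3 :=
  if f is f'.+1 then
    (if x %/ 2 ^ f' == 0 then [::]
     else if (x %/ 2 ^ f') %% 2 == 0 then [:: sym0] else [:: sym1]) ++ number_bits f' x
  else [::].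

Lemma number_bitsE f x :
  number_bits f x = map (fun b : bool => if b then sym1 else sym0) (rev (bits_lsb f x)).
Proof.
elim: f x => // f IH x.
have step : forall f x, number_bits f.+1 x = number_bits f x./2 ++
    (if x == 0 then [::] else if odd x then [:: sym1] else [:: sym0]).
  move=> {IH x} {}f; elim: f => [|f IH] x.
    by rewrite /= expn0 divn1 modn2 cats0; case: eqP => // _; case: odd.
  rewrite -[number_bits f.+2 x]/(_ ++ number_bits f.+1 x) IH catA.
  by rewrite /= expnS divnMA divn2.
rewrite step IH /=; case: eqP => [->|_].
  rewrite /= cats0 (_ : bits_lsb f 0 = [::]) //; by case: f {IH step}.
by rewrite rev_cons map_rcons -cats1; case: odd.
Qed.

Definition printed_number (x : nat) : seq 'I_3 := number_bits x x ++ [:: symsep].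

(** For 0 all digits count as leading zeros and none is printed, whereas [bits 0] has one digit. *)
Lemma printed_numberE x : 0 < x -> printed_number x = enc_num x.
Proof.
by rewrite /printed_number /enc_num /bits number_bitsE; case: x.
Qed.

Definition PPrint (d : nat) : prog :=
  let bit := EBin Shr (EVar d) (EBin Sub (EBin Sub (EVar d) (ECst 1)) (EVar d.+2)) in
  Seq (PFor (EVar d)
        (PIf bit (ECst 0) (Act (Clr d.+3))
          (PIf (EBin Mod bit (ECst 2)) (ECst 0) (Act (Out sym0)) (Act (Out sym1)) d.+3) d.+3)
        d.+1)
      (Act (Out symsep)).

Lemma emits_print_var d : emits d.+1 (PPrint d) (fun w env => printed_number (env d)).
Proof.
set b := EBin Shr (EVar d) (EBin Sub (EBin Sub (EVar d) (ECst 1)) (EVar d.+2)).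
have b_ok : vars_lt d.+3 b by rewrite /=; lia.
apply: emits_ext (emits_seq (@emits_for d.+1 (EVar d) _ _ _ (emits_if b_ok _
  (emits_skip d.+3) (@emits_if d.+3 (EBin Mod b (ECst 2)) (ECst 0) _ _ _ _ _ _
     (emits_out d.+3 sym0) (emits_out d.+3 sym1)))) (emits_out d.+1 symsep)) => //=;
  last by rewrite andbT.
move=> w env; rewrite /printed_number /upd !eqxx; congr (_ ++ _).
rewrite (ltn_eqF (ltnSn d)) (ltn_eqF (ltnW (ltnSn d.+1))).
set x := env d; set F := (F in map F).
suff gen f : f <= x -> flatten (map F (iota (x - f) f)) = number_bits f x.
  by have := gen x (leqnn x); rewrite subnn.
elim: f => // f IH f_x; rewrite [iota _ _]/= map_cons.
rewrite -[number_bits f.+1 x]/(_ ++ number_bits f x) -IH; last by lia.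
rewrite {1}/F; have -> : x - 1 - (x - f.+1) = f by lia.
by have -> : (x - f.+1).+1 = x - f by lia.
Qed.

Lemma emits_print d e : vars_lt d e ->
  emits d (PLet e (PPrint d) d) (fun w env => printed_number (ev w env e)).
Proof.
move=> e_d; apply: emits_ext (emits_let e_d (emits_print_var d)) => w env.
by rewrite /upd eqxx.
Qed.

Lemma emits_polytime p g : emits 1 p g ->
  polytime_computable (fun w => g w (fun=> size w)).
Proof.
move=> [g_ext [k pP]];
(* The prefix loads the length of the input into counter 0 by advancing to the first position
   without a symbol. *)
apply: (@exec_polytime (Seq (Until (TInp 0 None) (Act (Inc 0))) p) _ k.+3) => w.
set s0 := Store _ _; have [|k' _|s1 [n1 [run1 n1_le s1_I]]] := @triple_until w (TInp 0 None) (Act (Inc 0))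
  (fun j s => cnt s 0 = j /\ out s = [::]) (size w) 1 _ _ s0 (conj erefl erefl).
- move=> j s j_w [s_j _] /=; rewrite s_j.
  case: (ltngtP j (size w)) j_w => // [j_w|->] _; last by rewrite onth_default.
  by apply/negbTE/onth_lt.
- move=> s [s_k s_out]; exists (run_action (Inc 0) s), 1.
  by split; [exact: ExAct | | rewrite /= /upd eqxx s_k].
case: s1_I => s1_w s1_out.
have [|s2 [n2 [run2 n2_le [_ out2 _]]]] := pP w s1 (size w).
  by case=> // _; rewrite s1_w.
exists s2, (n1 + n2); split; first exact: ExSeq run1 run2.
  apply: leq_trans (leq_add n1_le n2_le) _.
  apply: leq_trans (leq_add (_ : _ <= (size w + 2) ^ 2) (leqnn _)) _.
    by rewrite expnS expn1; nia.
  by apply: leq_trans (pow_add _ _ _) _; rewrite ?addn2 // leq_pow2.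
by rewrite out2 s1_out; apply: g_ext => -[|].
Qed.

(** * Logics of matrices *)

Section Logic.
Variable sig : seq nat.
Implicit Types (t : term sig) (M : lmatrix sig).

Lemma term_induction (P : term sig -> Prop) :
  (forall x, P (@Var sig x)) ->
  (forall i (args : {ffun 'I_(arity i) -> term sig}), (forall j, P (args j)) -> P (App args)) ->
  forall t, P t.
Proof.
move=> PV PA; fix IH 1 => -[x|i args]; first exact: PV.
by apply: PA => j; apply: IH.
Qed.

Fixpoint subst (s : nat -> term sig) t : term sig :=
  match t with
  | Var x => s x
  | App i args => App [ffun j => subst s (args j)]
  end.

Lemma eval_subst (A : algebra sig) (v : nat -> A) s t :
  eval v (subst s t) = eval (fun x => eval v (s x)) t.
Proof.
elim/term_induction: t => //= i args IH; congr ops.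
by apply: functional_extensionality => j; rewrite ffunE IH.
Qed.

Lemma eval_vars (A : algebra sig) (v v' : nat -> A) (P : nat -> Prop) t :
  vars_in P t -> (forall x, P x -> v x = v' x) -> eval v t = eval v' t.
Proof.
move=> + E; elim/term_induction: t => [x /E //|i args IH /= args_P]; congr ops.
by apply: functional_extensionality => j; apply: IH.
Qed.

Lemma eval_congr (A : algebra sig) (th : A -> A -> Prop) (v v' : nat -> A) t :
  is_congruence th -> (forall x, th (v x) (v' x)) -> th (eval v t) (eval v' t).
Proof.
by case=> [_ [_ [_ th_op]]] E; elim/term_induction: t => //= i args IH; apply: th_op.
Qed.

Definition valid M t := forall v : nat -> malg M, mfilt M (eval v t).

(** With the empty filter a rule that has a premise holds vacuously; a rule without premises would
    be a theorem. *)
Lemma is_model_empty M (A : algebra sig) : (forall t, ~ valid M t) ->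
  is_model (logic_of M) {| malg := A; mfilt := fun=> False |}.
Proof.
move=> no_thm Gamma phi Gphi v Gv; apply: (no_thm phi) => v'.
by apply: Gphi => g /Gv.
Qed.

Lemma Omega_empty (A : algebra sig) (a b : A) : Omega (fun=> False) a b.
Proof. by exists (fun _ _ => True); do !split. Qed.

(** With the empty filter any two elements are Leibniz congruent, which forces [Delta] to be empty.
    An empty [Delta] makes [a] and [b] congruent in [M] as well, although [M] is reduced. *)
Lemma not_protoalgebraic M (a b : malg M) : reduced M -> a <> b ->
  (forall t, ~ valid M t) -> ~ protoalgebraic (logic_of M).
Proof.
move=> M_red ab no_thm [Delta DeltaP]; apply/ab/M_red/DeltaP => // v _ _ d Dd.
have [H _] := DeltaP _ (is_model_empty no_thm (A := malg M)) a b.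
case: (H (Omega_empty a b) (fun x => if x == 0 then a else b) erefl erefl d Dd).
Qed.

(** The one-element algebra with the empty filter is a reduced model. Every equation holds there, so
    [tau] defines the whole carrier instead of the filter. *)
Lemma not_truth_equational M : (forall t, ~ valid M t) ->
  ~ truth_equational (logic_of M).
Proof.
move=> no_thm [tau [_ tauP]].
pose U : algebra sig := {| carrier := unit; ops := fun _ _ => tt |}.
pose MU : lmatrix sig := {| malg := U; mfilt := fun=> False |}.
have [|_ H] := tauP MU (is_model_empty no_thm (A := U)) _ tt.
  by move=> [] []; split=> // _; apply: Omega_empty.
by apply: H => e _; case: (eval _ _) (eval _ _) => [] [].
Qed.

(** * Consequences of a term that defines equality *)

Section EqualityTerm.
Variables (M : lmatrix sig) (delta : term sig).
Hypothesis delta_vars : vars_in (fun x => x <= 1) delta.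
Hypothesis deltaP : forall v : nat -> malg M, mfilt M (eval v delta) <-> v 0 = v 1.

Definition pair_val (A : Type) (a b : A) (x : nat) : A := if x == 0 then a else b.

Definition delta_of (s t : term sig) : term sig := subst (pair_val s t) delta.

Lemma delta_ofP v s t : mfilt M (eval v (delta_of s t)) <-> eval v s = eval v t.
Proof. by rewrite eval_subst deltaP. Qed.

Lemma eval_delta_of (A : algebra sig) (v : nat -> A) s t :
  eval v (delta_of s t) = eval (pair_val (eval v s) (eval v t)) delta.
Proof.
by rewrite eval_subst; apply: eval_vars delta_vars _ => -[|[|]].
Qed.

Variable M' : lmatrix sig.
Hypothesis M'_model : is_model (logic_of M) M'.

Let eqd (a b : malg M') := mfilt M' (eval (pair_val a b) delta).

(** A quasi-equation true in [M] is a rule about instances of [delta], and rules pass to all models.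
    Since the laws of a congruence are quasi-equations, [eqd] inherits them. *)
Lemma transfer_rule (Gamma : seq (term sig * term sig)) s t :
  (forall v : nat -> malg M, (forall e, List.In e Gamma -> eval v e.1 = eval v e.2) ->
     eval v s = eval v t) ->
  forall v : nat -> malg M', (forall e, List.In e Gamma -> eqd (eval v e.1) (eval v e.2)) ->
     eqd (eval v s) (eval v t).
Proof.
move=> H v Gv; rewrite /eqd -eval_delta_of.
apply: (M'_model (Gamma := fun g => exists2 e, List.In e Gamma & g = delta_of e.1 e.2)).
  move=> u Gu; apply/delta_ofP/H => e e_G; apply/delta_ofP; apply: Gu; by exists e.
by move=> _ [e e_G ->]; rewrite eval_delta_of; apply: Gv.
Qed.

Lemma eqd_refl a : eqd a a.
Proof. by apply: (@transfer_rule [::] (Var _ 0) (Var _ 0) _ (fun=> a)). Qed.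

Lemma eqd_congruence : is_congruence eqd.
Proof.
split; [exact: eqd_refl | split; [|split]].
- move=> a b ab; apply: (@transfer_rule [:: (Var _ 0, Var _ 1)] (Var _ 1) (Var _ 0) _ (pair_val a b)).
    by move=> v /(_ _ (or_introl erefl)) /= ->.
  by move=> _ [<-|[]].
- move=> a b c ab bc.
  apply: (@transfer_rule [:: (Var _ 0, Var _ 1); (Var _ 1, Var _ 2)] (Var _ 0) (Var _ 2) _
     (fun x => nth c [:: a; b] x)).
    by move=> v H; rewrite (H _ (or_introl erefl)) -(H _ (or_intror (or_introl erefl))).
  by move=> _ [<-|[<-|[]]].
- move=> i a b ab; set k := arity i in a b ab *.
  (* Variable [j] stands for [a j] and variable [k + j] for [b j]. The default value is just some
     element of the carrier that exists even when [k = 0]. *)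
  pose v (x : nat) : malg M' := if insub x is Some j then a j
    else if insub (x - k) is Some j then b j else ops (malg M') i a.
  have va j : v (nat_of_ord j) = a j by rewrite /v valK.
  have vb (j : 'I_k) : v (k + j) = b j.
    by rewrite /v insubF ?ltnNge ?leq_addr // addKn valK.
  have := @transfer_rule [seq (Var sig j, Var sig (k + j)) | j <- iota 0 k]
    (@App sig i [ffun j : 'I_k => Var sig j]) (@App sig i [ffun j : 'I_k => Var sig (k + j)]) _ v.
  have Ea : (fun j : 'I_k => eval v ([ffun j : 'I_k => Var sig j] j)) = a.
    by apply: functional_extensionality => j; rewrite ffunE /= va.
  have Eb : (fun j : 'I_k => eval v ([ffun j : 'I_k => Var sig (k + j)] j)) = b.
    by apply: functional_extensionality => j; rewrite ffunE /= vb.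
  rewrite /= Ea Eb; apply.
    move=> u H; congr ops; apply: functional_extensionality => j; rewrite !ffunE.
    apply: (H (_, _)); apply/(@List.in_map _ _ (fun j => (Var sig j, Var sig (k + j)))).
    have: val j \in iota 0 k by rewrite mem_iota /=.
    elim: (iota 0 k) => //= x r IH; rewrite inE => /orP[/eqP->|/IH]; by [left|right].
  move=> e /List.in_map_iff[j [<- j_k]] /=.
  have j_lt : j < k.
    have : j \in iota 0 k by elim: (iota 0 k) j_k => //= x r IH [->|/IH];
      rewrite inE ?eqxx // => ->; rewrite orbT.
    by rewrite mem_iota.
  by have := ab (Ordinal j_lt); rewrite -va -vb.
Qed.

(** Modus ponens: in [M] the formulas [x] and [delta(x, y)] entail [y]. *)
Lemma eqd_compatible : compatible eqd (mfilt M').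
Proof.
move=> a b ab aF; rewrite -[b]/(eval (pair_val a b) (Var sig 1)).
apply: (M'_model (Gamma := fun g => g = Var sig 0 \/ g = delta)).
  move=> v H; have v0 := H _ (or_introl erefl).
  by rewrite /= -(proj1 (deltaP v) (H _ (or_intror erefl))).
by move=> _ [->|->].
Qed.

(** For maximality: a compatible congruence relating [a] and [b] relates [delta(a, a)], which is
    designated, to [delta(a, b)]. *)
Lemma eqd_Leibniz : is_Leibniz (mfilt M') eqd.
Proof.
split; [exact: eqd_congruence | split; [exact: eqd_compatible|]].
move=> th th_congr th_compat a b ab; apply: (th_compat _ _ _ (eqd_refl a)).
have th_refl := proj1 th_congr.
by apply: eval_congr th_congr _ => -[|[|x]] //=; apply: th_refl.
Qed.

Lemma Omega_eqd a b : Omega (mfilt M') a b <-> eqd a b.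
Proof.
split=> [[th [[th_congr [th_compat _]] ab]]|ab].
  by case: eqd_Leibniz => _ [_ H]; apply: H ab.
by exists eqd; split=> //; apply: eqd_Leibniz.
Qed.

Lemma Omega_delta a b : Omega (mfilt M') a b <->
  (forall v : nat -> malg M', v 0 = a -> v 1 = b -> forall d, d = delta -> mfilt M' (eval v d)).
Proof.
split=> [/Omega_eqd ab v v0 v1 _ ->|H]; last by apply/Omega_eqd; apply: H.
rewrite (eval_vars (v' := pair_val a b) delta_vars) //.
by move=> [|[|]].
Qed.

End EqualityTerm.

Lemma equivalential_delta M delta : vars_in (fun x => x <= 1) delta ->
  (forall v : nat -> malg M, mfilt M (eval v delta) <-> v 0 = v 1) ->
  equivalential (logic_of M).
Proof.
move=> delta_vars deltaP; exists (fun d => d = delta); split=> [_ -> //|M' M'_model a b].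
exact: Omega_delta.
Qed.

(** In [M], hence in every model, [x] and [delta(s, t)] entail each other; in a reduced model
    [delta] is equality, so membership in the filter becomes the equation [s = t]. *)
Lemma truth_equational_delta M delta s t : vars_in (fun x => x <= 1) delta ->
  (forall v : nat -> malg M, mfilt M (eval v delta) <-> v 0 = v 1) ->
  vars_in (fun x => x = 0) s -> vars_in (fun x => x = 0) t ->
  (forall v : nat -> malg M, mfilt M (v 0) <-> eval v s = eval v t) ->
  truth_equational (logic_of M).
Proof.
move=> delta_vars deltaP s_vars t_vars stP.
exists (fun e => e = (s, t)); split=> [_ -> //|M' M'_model M'_red a].
have st_delta : mfilt M' a <-> mfilt M' (eval (fun=> a) (delta_of delta s t)).
  split=> aF.
    apply: (M'_model (fun g => g = Var sig 0)) => [v H|_ -> //].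
    by apply/(delta_ofP deltaP)/stP; apply: (H (Var sig 0)).
  rewrite -[a]/(eval (fun=> a) (Var sig 0)).
  apply: (M'_model (fun g => g = delta_of delta s t)) => [v H|_ -> //].
  by apply/stP/(delta_ofP deltaP); apply: (H (delta_of delta s t)).
rewrite st_delta eval_delta_of // -(Omega_eqd delta_vars deltaP M'_model) M'_red.
by split=> [E _ ->|H]; [|apply: (H (s, t))].
Qed.

Lemma equivalential_protoalgebraic (L : logic sig) : equivalential L -> protoalgebraic L.
Proof. by case=> Delta [_ H]; exists Delta. Qed.

Lemma in_class_algebraizable K (L : logic sig) : algebraizable L -> in_class K L.
Proof.
move=> [L_eq L_truth]; have L_proto := equivalential_protoalgebraic L_eq.
by case: K => //=; split.
Qed.

Lemma not_in_class K (L : logic sig) :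
  ~ protoalgebraic L -> ~ truth_equational L -> ~ in_class K L.
Proof.
move=> not_proto not_truth; case: K => /=.
- by case.
- by move/equivalential_protoalgebraic.
- by case.
- by [].
- by [].
Qed.

End Logic.

(** * Binary addresses *)

Definition bit (i z : nat) : bool := odd (z %/ 2 ^ i).

Lemma bit_ext Q z z' : z < 2 ^ Q -> z' < 2 ^ Q ->
  (forall i, i < Q -> bit i z = bit i z') -> z = z'.
Proof.
elim: Q z z' => [|Q IH] z z'; first by rewrite expn0; lia.
rewrite !expnS => z_lt z'_lt E.
have z2 : z./2 = z'./2.
  apply: IH => [||i i_Q]; [lia|lia|].
  by have := E i.+1 i_Q; rewrite /bit expnS !divnMA !divn2.
have := E 0 isT; rewrite /bit expn0 !divn1 => z_odd.
by rewrite -(odd_double_half z) -(odd_double_half z') z_odd z2.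
Qed.

Lemma bit_add_clear j z : ~~ bit j z ->
  [/\ bit j (z + 2 ^ j), forall i, i != j -> bit i (z + 2 ^ j) = bit i z &
      (z + 2 ^ j) %/ 2 ^ j.+1 = z %/ 2 ^ j.+1].
Proof.
move=> z_j; have pos i : 0 < 2 ^ i by rewrite expn_gt0.
have divj : (z + 2 ^ j) %/ 2 ^ j = (z %/ 2 ^ j).+1.
  by rewrite divnDr ?divnn ?pos ?addn1.
have divj1 : (z + 2 ^ j) %/ 2 ^ j.+1 = z %/ 2 ^ j.+1.
  rewrite expnSr !divnMA divj !divn2 -uphalfE uphalf_half.
  by rewrite /bit in z_j; rewrite (negPf z_j).
split=> //; first by rewrite /bit divj.
move=> i; rewrite neq_ltn => /orP[i_j|i_j]; rewrite /bit.
  rewrite -(subnK (ltnW i_j)) expnD divnDr ?dvdn_mull // mulnK // oddD oddX /=.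
  by rewrite orbF subn_eq0 leqNgt i_j addbF.
by rewrite -(subnKC i_j) expnD !divnMA divj1.
Qed.

Lemma bit_sub_set j z : bit j z -> 2 ^ j <= z /\ ~~ bit j (z - 2 ^ j).
Proof.
move=> z_j; have pos : 0 < 2 ^ j by rewrite expn_gt0.
have z_le : 2 ^ j <= z.
  by rewrite leqNgt; apply: contraL z_j => /divn_small; rewrite /bit => ->.
split=> //; rewrite -[in bit j z](subnK z_le) in z_j.
move: z_j; rewrite /bit divnDr // divnn pos addn1 /=.
by [].
Qed.

(* [j] is the carry position when [2 ^ lo] is added to [z] *)
Definition carry (lo j z : nat) :=
  [/\ lo <= j, forall i, lo <= i < j -> bit i z & ~~ bit j z].

(** Induction on [j - lo]: if bit [lo] is set, removing it gives [z'] with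
    [z + 2 ^ lo = z' + 2 ^ lo.+1], the same addition one place higher. *)
Lemma carry_add lo j z : carry lo j z ->
  (forall i, bit i (z + 2 ^ lo) =
     if i < lo then bit i z else if i < j then false else (i == j) || bit i z) /\
  (z + 2 ^ lo) %/ 2 ^ j.+1 = z %/ 2 ^ j.+1.
Proof.
case=> lo_j; rewrite -(subnK lo_j); move: (j - lo) => d {j lo_j}.
elim: d z lo => [|d IH] z lo ones zero.
  rewrite add0n in ones zero *; have [H1 H2 H3] := bit_add_clear zero; split=> // i.
  by case: ltngtP => [i_lo|i_lo|->]; rewrite ?H1 // H2 // ?(ltn_eqF i_lo) ?(gtn_eqF i_lo).
have lo1 : bit lo z by apply: ones; lia.
have [z_le z'_lo] := bit_sub_set lo1.
set z' := z - 2 ^ lo in z'_lo; have zE : z = z' + 2 ^ lo by rewrite subnK.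
have [_ bitE divE] := bit_add_clear z'_lo; rewrite -zE in bitE divE.
have [||bits' div'] := IH z' lo.+1.
- by move=> i i_lt; rewrite -bitE ?ones //; lia.
- by rewrite -bitE ?addnS -?addSn //; lia.
have -> : z + 2 ^ lo = z' + 2 ^ lo.+1 by rewrite {1}zE expnS mul2n -addnn addnA.
rewrite addSnnS; split.
  move=> i; rewrite bits'; case: (ltngtP i lo) => i_lo.
  + by rewrite ltnW // bitE // ltn_eqF.
  + by rewrite ltnS leqNgt i_lo /= bitE // gtn_eqF.
  + by rewrite i_lo ltnSn (negPf z'_lo); case: ifP => //; lia.
by rewrite div' -addSn addnC expnD !divnMA divE.
Qed.

Lemma carry_exists lo b z : lo <= b ->
  (exists2 j, j < b & carry lo j z) \/ (z + 2 ^ lo) %/ 2 ^ b = (z %/ 2 ^ b).+1.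
Proof.
move=> lo_b; have := subnK lo_b; move: (b - lo) => d bE; rewrite -{}bE {b lo_b}.
elim: d z lo => [|d IH] z lo.
  by right; rewrite divnDr // divnn expn_gt0 addn1.
case lo1 : (bit lo z); last first.
  left; exists lo; first by lia.
  by split; [|lia|rewrite lo1].
have [z_le z'_lo] := bit_sub_set lo1.
set z' := z - 2 ^ lo in z'_lo; have zE : z = z' + 2 ^ lo by rewrite subnK.
have [_ bitE divE] := bit_add_clear z'_lo; rewrite -zE in bitE divE.
have addE : z + 2 ^ lo = z' + 2 ^ lo.+1 by rewrite {1}zE expnS mul2n -addnn addnA.
rewrite addSnnS; case: (IH z' lo.+1) => [[j j_d [lo_j ones zero]]|divE'].
  left; exists j => //; split; first exact: ltnW.
    move=> i /andP[lo_i i_j]; case: (eqVneq i lo) => [->//|i_lo].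
    by rewrite bitE // ones //; lia.
  by rewrite bitE //; lia.
right; rewrite addE divE'; congr _.+1.
by rewrite addnC expnD !divnMA divE.
Qed.

Lemma lt_pow_div Q z : (z < 2 ^ Q) = (z %/ 2 ^ Q == 0).
Proof. by rewrite -leqn0 -(ltnS (z %/ _)) ltn_divLR ?expn_gt0 // mul1n. Qed.

Lemma carry_div lo j b z : carry lo j z -> j < b -> (z + 2 ^ lo) %/ 2 ^ b = z %/ 2 ^ b.
Proof.
move=> /carry_add[_ divE] j_b.
by rewrite -(subnKC j_b) expnD !divnMA divE.
Qed.

(** * Space-time diagrams of a machine *)

Section Diagram.
Variables (Sin Sout : finType) (M : TM Sin Sout).

Definition cellv := (tm_G M * option (tm_Q M))%type.
Definition blankv : cellv := (tm_blank M, None).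

(** The machine as a cellular automaton: [a] and [c] are the left and right neighbours of [b]. *)
Definition cell_rule (a b c : cellv) : cellv :=
  match b.2 with
  | Some q => if tm_halt M q then b else
      let: (q', g', mv) := tm_delta M q b.1 in
      (g', if mv is MStay then Some q' else None)
  | None => (b.1,
      match a.2 with
      | Some q => if tm_halt M q then None else
          let: (q', g', mv) := tm_delta M q a.1 in if mv is MRight then Some q' else None
      | None => match c.2 with
        | Some q => if tm_halt M q then None else
            let: (q', g', mv) := tm_delta M q c.1 in if mv is MLeft then Some q' else None
        | None => None
        end
      end)
  end.

(* the number is the absolute position of the head *)
Definition pstep (x : config M * nat) : config M * nat :=
  let: (q, _, r) := x.1 in
  (tm_step x.1, if tm_halt M q then x.2
                else move_head (tm_delta M q (head (tm_blank M) r)).2 x.2).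

Definition content (x : config M * nat) (p : nat) : cellv :=
  let: (q, l, r) := x.1 in
  (tape (tm_blank M) x.2 l r p, if p == x.2 then Some q else None).

Lemma content_step x p : 0 < x.2 -> 0 < p ->
  content (pstep x) p = cell_rule (content x p.-1) (content x p) (content x p.+1).
Proof.
case: x => -[[q l] r] h /= h_gt0 p_gt0; rewrite /pstep /= /cell_rule /content.
case q_halt : (tm_halt M q) => /=.
  case: (eqVneq p h) => [->|_]; first by rewrite /= q_halt.
  by case: (p.-1 == h); case: (p.+1 == h); rewrite /= ?q_halt.
rewrite -(tape_head (tm_blank M) h l r); set f := tape _ h l r.
case E : (tm_delta M q (f h)) => [[q' g'] mv] /=.
have := @tape_moveE _ (tm_blank M) mv g' h l r (fun=> h_gt0).
case Em : (tape_move _ _ _ _ _) => [l' r'] tapeE.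
have -> : (match mv with
   | MLeft => (q', behead l, head (tm_blank M) l :: g' :: behead r)
   | MRight => (q', g' :: l, behead r)
   | MStay => (q', l, g' :: behead r)
   end : config M) = (q', l', r').
  by move: Em; rewrite /tape_move; case: (mv) => -[<- <-].
rewrite tapeE /upd -/f {Em tapeE l' r'}; case: (eqVneq p h) => [->|p_h] /=.
  rewrite q_halt E; case: (mv) => /=; rewrite ?eqxx //; congr (_, _); case: eqP => //; lia.
congr (_, _); case: (eqVneq p.-1 h) => [p1_h|p1_h].
  rewrite q_halt p1_h E; case: (mv) => /=; case: eqP => //; lia.
case: (eqVneq p.+1 h) => [p1_h'|p1_h'].
  rewrite q_halt p1_h' E; case: (mv) => /=; case: eqP => //; lia.
by case: (mv) => /=; case: eqP => //; lia.
Qed.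

Variables (w : seq Sin) (B : nat).

Definition prun (t : nat) : config M * nat := iter t pstep (tm_init M w, B).

Lemma prun_run t : (prun t).1 = tm_run M t w.
Proof.
elim: t => //= t IH; rewrite /tm_run /= -/(tm_run M t w) -IH /pstep.
by case: (prun t) => [[[q l] r] h].
Qed.

Lemma prun_pos t : B <= (prun t).2 + t /\ (prun t).2 <= B + t.
Proof.
elim: t => [|t [IH1 IH2]]; first by rewrite /= addn0.
have pred_succ mv h : h.-1 <= move_head mv h <= h.+1 by case: mv => /=; lia.
rewrite /= /pstep; move: IH1 IH2; case: (prun t) => [[[q l] r] h] /=.
case: ifP => _; first by lia.
by have := pred_succ (tm_delta M q (head (tm_blank M) r)).2 h; lia.
Qed.

(** The head starts at [B] and moves at most one cell per step, so after [t] steps nothing farther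
    than [t] from the input has been touched. *)
Lemma prun_blank t p : t < B -> (p + t < B) || (B + size w + t < p) ->
  content (prun t) p = blankv.
Proof.
move=> t_B p_out.
have p_h : p != (prun t).2 by have := prun_pos t; lia.
have -> : content (prun t) p = ((content (prun t) p).1, None).
  by move: p_h; rewrite /content; case: (prun t) => [[[q l] r] h] /= /negPf ->.
congr (_, _); elim: t t_B p_out {p_h} => [_ p_out|t IH t_B p_out].
  rewrite /= /tape; case: ltnP => p_B; first by rewrite nth_nil.
  by rewrite nth_default // size_map; lia.
rewrite -IH ?(ltnW t_B) //; last by lia.
have := prun_pos t; have /= := t_B; rewrite /= /content /pstep.
case: (prun t) => [[[q l] r] h] /= t_B' [h_ge h_le].
case: ifP => q_halt //.
rewrite -(tape_head (tm_blank M) h l r); set f := tape _ h l r.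
case E : (tm_delta M q (f h)) => [[q' g'] mv] /=.
have h_gt0 : 0 < h by lia.
have := @tape_moveE _ (tm_blank M) mv g' h l r (fun=> h_gt0).
have p_h : (p == h) = false by lia.
by case: (mv) => /= ->; rewrite /upd p_h.
Qed.

Lemma run_state_halt t t' : t <= t' -> tm_halt M (tm_run M t w).1.1 ->
  tm_run M t' w = tm_run M t w.
Proof. by move=> tt' t_halt; rewrite /tm_run -(subnK tt') iterD tm_step_halt. Qed.

(* Row [t] of width [W] starts at address [t * W]; it is shifted by [t]
   positions, so that a cell only depends on cells of smaller address.
   [None] marks the cells of row 0 that do not belong to the input. *)
Definition diagram (W z : nat) : option cellv :=
  if (z < W) && ((z < B) || (B + size w < z)) then None
  else Some (content (prun (z %/ W)) (z %% W + z %/ W)).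

Definition cell_of (x : option cellv) : cellv := odflt blankv x.

Variable W : nat.
Hypotheses (W_big : B + size w < W) (B_gt0 : 0 < B).

Lemma cell_of_diagram z :
  cell_of (diagram W z) = content (prun (z %/ W)) (z %% W + z %/ W).
Proof.
rewrite /diagram; case: ifP => // /andP[z_W z_out].
rewrite divn_small // modn_small // addn0 prun_blank //; lia.
Qed.

(** The address [z + a] may run over into the next row. The cell wanted then lies to the right of
    everything written, the cell actually read to the left of it, and both are blank. *)
Lemma cell_of_diagram_add z a : a <= 2 -> 2 * (z %/ W) + 3 < B ->
  cell_of (diagram W (z + a)) = content (prun (z %/ W)) (z %% W + z %/ W + a).
Proof.
move=> a_2 t_B; have W_gt0 : 0 < W by lia.
rewrite cell_of_diagram; set t := z %/ W in t_B *; set p := z %% W.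
have p_W : p < W by rewrite ltn_mod.
have zE : z = t * W + p by apply: divn_eq.
rewrite zE -addnA divnMDl // modnMDl.
case: (ltnP (p + a) W) => pa_W.
  by rewrite divn_small // modn_small // addn0 addnAC.
have -> : p + a = 1 * W + (p + a - W) by lia.
rewrite divnMDl // modnMDl divn_small ?modn_small; try lia.
rewrite !prun_blank //; lia.
Qed.

(** Going down one row at equal offset raises the position by one, so the left neighbour, the cell
    itself and the right neighbour have addresses [z], [z.+1] and [z.+2]. *)
Lemma diagram_step z : 2 * (z %/ W) + 3 < B ->
  diagram W (z + W) = Some (cell_rule (cell_of (diagram W z))
    (cell_of (diagram W z.+1)) (cell_of (diagram W z.+2))).
Proof.
move=> t_B; have W_gt0 : 0 < W by lia.
have -> : diagram W (z + W) = Some (content (prun (z %/ W).+1) (z %% W + (z %/ W).+1)).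
  by rewrite /diagram ltnNge leq_addl /= divnDr // divnn W_gt0 addn1 modnDr.
have := cell_of_diagram_add (a := 0) isT t_B; have := cell_of_diagram_add (a := 1) isT t_B.
have := cell_of_diagram_add (a := 2) isT t_B; rewrite addn2 addn1 addn0 => -> -> ->.
have := prun_pos (z %/ W) => pos.
by rewrite [prun _]/= content_step; [rewrite addnS addn0 addn1 addn2 | lia | lia].
Qed.

Definition accepting (x : option cellv) : bool :=
  if x is Some (_, Some q) then tm_halt M q && tm_accept M q else false.

Lemma diagram_accepting z T : accepting (diagram W z) ->
  tm_halt M (tm_run M T w).1.1 -> tm_accept M (tm_run M T w).1.1.
Proof.
rewrite /diagram; case: ifP => // _; set t := z %/ W; rewrite /content.
case E : (prun t) => [[[q l] r] h] /=; case: eqP => // _ /andP[q_halt q_acc] T_halt.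
have t_q : (tm_run M t w).1.1 = q by rewrite -prun_run E.
case: (leqP t T) => tT.
  by rewrite (run_state_halt tT) ?t_q.
by rewrite -(run_state_halt (ltnW tT) T_halt) t_q.
Qed.

Lemma accepting_diagram T : 2 * T < B -> 0 < T ->
  tm_halt M (tm_run M T w).1.1 -> tm_accept M (tm_run M T w).1.1 ->
  exists2 z, z < T.+1 * W & accepting (diagram W z).
Proof.
move=> T_B T_gt0 T_halt T_acc; have W_gt0 : 0 < W by lia.
have [pos1 pos2] := prun_pos T; set h := (prun T).2 in pos1 pos2.
have p_W : h - T < W by lia.
(* The address of the head in row [T]: its position [h] less the shift of the row. *)
exists (T * W + (h - T)); first by rewrite mulSn; lia.
rewrite /diagram ltnNge (leq_trans _ (leq_addr _ _)) ?leq_pmull //=.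
rewrite divnMDl // modnMDl divn_small // modn_small // addn0 subnK; last by lia.
have := T_acc; have := T_halt; rewrite -prun_run /content /h.
by case: (prun T) => [[[q l] r] h'] /=; rewrite eqxx => -> ->.
Qed.

End Diagram.

(** * Encodings determine matrices *)

Lemma bits_inj : injective bits.
Proof.
pose val (s : seq bool) := foldl (fun a (b : bool) => 2 * a + b) 0 s.
have lsb f n : n <= f -> val (rev (bits_lsb f n)) = n.
  elim: f n => [|f IH] n /=; first by case: n.
  move=> n_f; case: eqP => [->//|n0].
  rewrite rev_cons /val foldl_rcons -/(val _) IH; last by lia.
  by rewrite mul2n addnC odd_double_half.
apply: (can_inj (g := val)) => n; rewrite /bits; case: eqP => [->//|_].
exact: lsb.
Qed.

Lemma enc_num_cat n n' s s' : enc_num n ++ s = enc_num n' ++ s' -> n = n' /\ s = s'.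
Proof.
rewrite /enc_num -!catA => E.
suff [/bits_inj -> ->] : bits n = bits n' /\ s = s' by [].
elim: (bits n) (bits n') E => [|b r IH] [|b' r'] //=.
- by case=> ->.
- by case: b'.
- by case: b.
- by case=> bb /IH[-> ->]; split=> //; congr cons; case: b b' bb => [] [].
Qed.

Lemma encode_numbers_inj s s' : flatten (map enc_num s) = flatten (map enc_num s') -> s = s'.
Proof.
have ne n r : [::] <> enc_num n ++ r by rewrite /enc_num -catA; case: (map _ _).
elim: s s' => [|n s IH] [|n' s'] //=.
- by move/ne.
- by move/esym/ne.
- by case/enc_num_cat=> -> /IH ->.
Qed.

(** Needed since [problem] speaks of some matrix with the given encoding. Well-formedness fixes the
    table lengths, by which the flat list of numbers can be parsed. *)
Lemma encode_inj D D' : fm_wf D -> fm_wf D' -> encode D = encode D' -> D = D'.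
Proof.
case: D D' => [n m o] [n' m' o'] [_ /= o_wf] [_ /= o'_wf] /encode_numbers_inj.
rewrite /fm_numbers /= /fm_n /= => -[nE <- size_o E]; subst n'; congr Build_fmat.
rewrite /fm_n /= in o_wf o'_wf.
elim: o o' o_wf o'_wf size_o E => [|[k v] o IH] [|[k' v'] o'] //=.
move=> /andP[/andP[/eqP v_size _] o_wf] /andP[/andP[/eqP v'_size _] o'_wf] [size_o].
case=> kE /eqP; subst k'; rewrite eqseq_cat; last by rewrite v_size v'_size.
by case/andP=> /eqP-> /eqP E; rewrite (IH o').
Qed.

(** * Matrices all of whose operations are ternary *)

Lemma base3_lt n x y u : x < n -> y < n -> u < n -> x * n ^ 2 + y * n + u < n ^ 3.
Proof. by rewrite !expnS expn0 muln1; nia. Qed.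

Section Ternary.
Variables (N1 m K : nat) (f : nat -> nat -> nat -> nat -> nat).
Let N := N1.+1.
Hypothesis f_lt : forall o x y u, o < K -> x < N -> y < N -> u < N -> f o x y u < N.

Definition table (o : nat) : seq nat :=
  [seq (f o (t %/ N ^ 2) (t %/ N %% N) (t %% N)).+1 | t <- iota 0 (N ^ 3)].

Definition ternary_fmat : fmat := {|
  fm_size := N1; fm_m := m; fm_ops := [seq (3, table o) | o <- iota 0 K] |}.

Let D := ternary_fmat.
Let A := fm_alg D.

Lemma ternary_wf : m <= N -> fm_wf D.
Proof.
move=> m_le; split=> //; apply/allP => p /mapP[o]; rewrite mem_iota add0n => /andP[_ o_K] ->.
change ((size (table o) == N ^ 3) && all (fun v => 1 <= v <= N) (table o)).
rewrite size_map size_iota eqxx; apply/allP => v /mapP[t].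
rewrite mem_iota add0n => /andP[_ t_lt] ->; apply: f_lt => //; rewrite ?ltn_mod //.
by rewrite ltn_divLR ?expn_gt0 // -expnS.
Qed.

Lemma ternary_sig_size : size (fm_sig D) = K.
Proof. by rewrite /fm_sig !size_map size_iota. Qed.

Lemma ternary_arity (i : 'I_(size (fm_sig D))) : arity i = 3.
Proof.
have nth3 n : n < K -> nth 0 (fm_sig D) n = 3.
  by move=> n_K; rewrite /fm_sig -map_comp (nth_map 0) ?size_iota.
by apply: nth3; rewrite -ternary_sig_size.
Qed.

Definition op_arg (i : 'I_(size (fm_sig D))) (j : 'I_3) : 'I_(arity i) :=
  cast_ord (esym (ternary_arity i)) j.

Definition ternary_op (o : nat) (x y u : 'I_N) : 'I_N := inord (f o x y u).

Lemma ternary_opE o (x y u : 'I_N) : o < K -> ternary_op o x y u = f o x y u :> nat.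
Proof. by move=> o_K; rewrite inordK //; apply: f_lt. Qed.

Lemma tuple_index3 n k (a : 'I_k -> nat) (k3 : k = 3) :
  let c j := a (cast_ord (esym k3) (inord j)) in
  tuple_index n a = c 0 * n ^ 2 + c 1 * n + c 2.
Proof.
subst k => /=; rewrite /tuple_index !big_ord_recl big_ord0 addn0 addnA.
have inordE (j : 'I_3) : cast_ord erefl (inord j) = j.
  by apply: val_inj; rewrite /= inordK.
have := inordE (lift ord0 (lift ord0 ord0)); have := inordE (lift ord0 ord0).
have := inordE ord0; rewrite /= => -> -> ->.
by rewrite /bump /= expn1 expn0 muln1.
Qed.

Lemma ternary_ops (i : 'I_(size (fm_sig D))) (a : 'I_(arity i) -> A) :
  ops A i a = ternary_op i (a (op_arg i (inord 0))) (a (op_arg i (inord 1)))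
                (a (op_arg i (inord 2))).
Proof.
have i_K : i < K by rewrite -ternary_sig_size.
rewrite /= (tuple_index3 _ _ (ternary_arity i)) /= -/(op_arg i _) -/(op_arg i _) -/(op_arg i _).
move: (a _) (a _) (a _) => u y x; congr inord.
rewrite /fm_table -map_comp (nth_map 0) ?size_iota // nth_iota // add0n /= /table.
have lt : x * N ^ 2 + y * N + u < N ^ 3.
  exact: base3_lt.
rewrite -[fm_n _]/N (nth_map 0) ?size_iota // nth_iota // add0n /=.
have N_gt0 : 0 < N by [].
have -> : x * N ^ 2 + y * N + u = (x * N + y) * N + u by rewrite expnS expn1; lia.
rewrite expnS expn1 divnMA !divnMDl // !modnMDl !(divn_small (ltn_ord u)) addn0.
by rewrite modnMDl divnMDl // (divn_small (ltn_ord y)) addn0 !modn_small.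
Qed.

Definition app3 (o : nat) (t1 t2 t3 : term (fm_sig D)) : term (fm_sig D) :=
  if insub o is Some i
  then @App (fm_sig D) i [ffun j : 'I_(arity i) => nth t1 [:: t1; t2; t3] j] else t1.

Lemma eval_app3 o t1 t2 t3 (v : nat -> A) : o < K ->
  eval v (app3 o t1 t2 t3) = ternary_op o (eval v t1) (eval v t2) (eval v t3).
Proof.
rewrite -ternary_sig_size => o_K; rewrite /app3 insubT /= -[LHS]/(ops A _ _) ternary_ops /=.
by rewrite !ffunE /= !inordK.
Qed.

Lemma vars_in_app3 o t1 t2 t3 P : vars_in P t1 -> vars_in P t2 -> vars_in P t3 ->
  vars_in P (app3 o t1 t2 t3).
Proof.
move=> P1 P2 P3; rewrite /app3; case: insub => // i /= j; rewrite ffunE.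
by case: (val j) => [|[|[|n]]] //=; rewrite nth_nil.
Qed.

(** [S] is an invariant of a whole family of evaluations of one term; the index will be the sort. *)
Lemma eval_closed (J : Type) (S : (J -> 'I_N) -> Prop) (v : J -> nat -> A) :
    (forall x, S (fun i => v i x)) ->
    (forall o X Y U, o < K -> S X -> S Y -> S U ->
       S (fun i => ternary_op o (X i) (Y i) (U i))) ->
  forall t, S (fun i => eval (v i) t).
Proof.
move=> S_var S_op t; elim/term_induction: t => [x|i args IH]; first exact: S_var.
have -> : (fun i0 => eval (v i0) (App args)) = (fun i0 => ternary_op i
    (eval (v i0) (args (op_arg i (inord 0)))) (eval (v i0) (args (op_arg i (inord 1))))
    (eval (v i0) (args (op_arg i (inord 2))))).
  by apply: functional_extensionality => i0; rewrite [LHS]ternary_ops.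
by apply: S_op; rewrite -?ternary_sig_size.
Qed.

End Ternary.

(** * The matrix of a computation *)

Section Symbols.
Variable M : TM bool bool.

Definition symbol : finType := option (cellv M).

Definition code (x : symbol) : nat := 4 + enum_rank x.
Definition decode (v : nat) : option symbol :=
  if v < 4 then None else onth (enum symbol) (v - 4).
Definition values : nat := 4 + #|symbol|.

Lemma codeK x : decode (code x) = Some x.
Proof.
rewrite /decode /code ltnNge leq_addr /= addKn.
have := onthTE (enum symbol) (enum_rank x); rewrite -cardE ltn_ord.
by case E : (onth _ _) => [y|] // _; rewrite -(@onth_nth _ x _ _ _ E) nth_enum_rank.
Qed.

Lemma code_inj : injective code.
Proof. by move=> x y E; have := codeK x; rewrite E codeK => -[]. Qed.

Lemma code_lt x : code x < values.
Proof. by rewrite /code /values ltn_add2l. Qed.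

Definition sym_step (x y u : nat) : nat :=
  match decode x, decode y, decode u with
  | Some x, Some y, Some u =>
      code (Some (cell_rule (cell_of x) (cell_of y) (cell_of u)))
  | _, _, _ => 1
  end.

Definition sym_acc (x : nat) : nat :=
  if decode x is Some x then (if accepting x then 0 else 1) else 1.

Definition sym_init (first : bool) (b : option bool) : nat :=
  code (Some (if b is Some b then tm_in M b else tm_blank M,
              if first then Some (tm_start M) else None)).

End Symbols.

Lemma lt_2b b : 3 <= b -> 2 * b < 2 ^ b.
Proof.
elim: b => // b IH; case: (ltnP b 3) => b3 b_ge; last by rewrite expnS; have := IH b3; lia.
by have -> : b = 2 by lia.
Qed.

Section Construction.
Variables (M : TM bool bool) (c : nat) (w : seq bool).

(** One bit more than the exponent of the time bound, so that rows 0 to [T] can be addressed. *)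
Definition row_bits : nat := (size w ^ c + c).+1.
(** [2 ^ half_bits] is the initial head position. It must exceed [2 * t + 3] for every row [t] that
    is stepped from, and also the number of address bits; the summands provide for both. *)
Definition half_bits : nat := row_bits + size w + 3.
Definition width_bits : nat := half_bits.+1.
Definition addr_bits : nat := width_bits + row_bits.
Definition sorts : nat := addr_bits.+1.
(** Indexing is uniform: each of the six kinds has three parameters below [Q], the carry positions
    that a step needs for [z + 1], [z + 2] and [z + W]. *)
Definition num_ops : nat := 6 * addr_bits ^ 3.

Local Notation B := (2 ^ half_bits).
Local Notation W := (2 ^ width_bits).
Local Notation Q := addr_bits.

Definition diag (z : nat) : symbol M := diagram M w B W z.

Lemma B_gt_addr : Q < B.
Proof.
apply: leq_ltn_trans (@lt_2b half_bits _); last by rewrite /half_bits; lia.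
by rewrite /addr_bits /width_bits /half_bits; lia.
Qed.

Lemma addr_gt0 : 0 < Q. Proof. by []. Qed.

Lemma B_gt0 : 0 < B. Proof. by rewrite expn_gt0. Qed.

Lemma W_big : B + size w < W.
Proof.
have := B_gt_addr; rewrite /width_bits expnS.
by move: (2 ^ _) => X; rewrite /addr_bits /width_bits /half_bits; lia.
Qed.

Lemma row_lt z : z + W < 2 ^ Q -> 2 * (z %/ W) + 3 < B.
Proof.
have W_gt0 : 0 < W by rewrite expn_gt0.
rewrite /addr_bits expnD mulnC -ltn_divLR // divnDr // divnn W_gt0 addn1.
rewrite /half_bits 2!expnD; have := expn_gt0 2 row_bits; have := expn_gt0 2 (size w).
by move: (2 ^ row_bits) (2 ^ size w) (z %/ W) => X Y t /= Y0 X0 tX; rewrite (_ : 2 ^ 3 = 8) //; nia.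
Qed.

(* Values of an element: 0 designated, 1 error, 2 and 3 the bits, from 4 on the
   codes of the symbols.  Kinds of operations: 0 equality, 1 acceptance, 2 input
   cell, 3 the blank cell 0, 4 from a blank cell of row 0 to the next one, 5 step
   of the machine. *)
Definition incr (lo j i a : nat) : nat :=
  if i < lo then a
  else if i < j then (if a == 3 then 2 else 1)
  else if i == j then (if a == 2 then 3 else 1)
  else a.

(** For kind 2 the position [j = size w] is an ordinary blank, and larger [j] yield the mark [None],
    from which kind 4 fills the right part of row 0. *)
Definition op_symbol (kind j : nat) (x y u : nat) : nat :=
  if kind == 1 then sym_acc M x
  else if kind == 2 then
    (if j <= size w then sym_init M (j == 0) (onth w j) else code (None : symbol M))
  else if kind == 3 then code (None : symbol M)
  else if kind == 4 then (if x == code (None : symbol M) then x else 1)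
  else sym_step M x y u.

(** The tests [2 <= y] and [2 <= u] make errors of [y] and [u] visible: where the increment fails as
    well, the comparison alone would read [1 == 1] and succeed. *)
Definition op_bit (kind j j' k i : nat) (x y u : nat) : nat :=
  if kind == 1 then (if x == 2 then 0 else if x == 3 then 0 else 1)
  else if kind == 2 then (if i == half_bits then 3 else 2 + (j %/ 2 ^ i) %% 2)
  else if kind == 3 then 2
  else if kind == 4 then (if j < half_bits then incr 0 j i x else 1)
  else if width_bits <= k then
    if y == incr 0 j i x then
      if 2 <= y then
        if u == incr 0 j' i y then
          if 2 <= u then incr width_bits k i x else 1
        else 1
      else 1
    else 1
  else 1.

Definition op_value (kind j j' k i : nat) (same : bool) (x y u : nat) : nat :=
  if kind == 0 then (if same then (if u == 0 then 0 else 1) else 1)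
  else if i == Q then op_symbol kind j x y u else op_bit kind j j' k i x y u.

Definition fact (z i : nat) : nat := if i == Q then code (diag z) else 2 + bit i z.

Definition legit (T : nat -> nat) :=
  (exists2 i, i <= Q & T i = 1) \/ (exists2 z, z < 2 ^ Q & forall i, i <= Q -> T i = fact z i).

Lemma legit_or (T : nat -> nat) :
  ((forall i, i <= Q -> T i != 1) ->
    exists2 z, z < 2 ^ Q & forall i, i <= Q -> T i = fact z i) -> legit T.
Proof.
case: (boolP [exists i : 'I_Q.+1, T i == 1]) => [/existsP[i /eqP T_i] _|].
  by left; exists i; rewrite // -ltnS.
move=> /existsPn T1 H; right; apply: H => i i_Q.
exact: (T1 (Ordinal (i_Q : i < Q.+1))).
Qed.

Lemma legit_cases (T : nat -> nat) : legit T -> (forall i, i <= Q -> T i != 1) ->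
  exists2 z, z < 2 ^ Q & forall i, i <= Q -> T i = fact z i.
Proof. by case=> // -[i i_Q T_i] T1; have := T1 i i_Q; rewrite T_i. Qed.

Lemma fact_bit z i : i < Q -> fact z i = 2 + bit i z.
Proof. by move=> i_Q; rewrite /fact ltn_eqF. Qed.

Lemma fact_symbol z : fact z Q = code (diag z).
Proof. by rewrite /fact eqxx. Qed.

Lemma incr_error lo j i : incr lo j i 1 = 1.
Proof. by rewrite /incr; do 3?case: ifP. Qed.

Lemma incr_carry lo j z i : carry lo j z -> incr lo j i (2 + bit i z) = 2 + bit i (z + 2 ^ lo).
Proof.
move=> z_carry; have [bitE _] := carry_add z_carry; case: z_carry => lo_j ones zero.
rewrite bitE /incr; case: ltnP => // lo_i; case: ltnP => i_j.
  by rewrite ones ?lo_i.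
by case: eqP => // ->; rewrite (negPf zero).
Qed.

(** Every sort checks its own bit, so the absence of errors in all of them certifies the guessed
    carry position. *)
Lemma carry_incr lo j z : lo <= j -> j < Q ->
  (forall i, i < Q -> incr lo j i (2 + bit i z) != 1) -> carry lo j z.
Proof.
move=> lo_j j_Q H; split=> // [i /andP[lo_i i_j]|].
  have := H i (ltn_trans i_j j_Q); rewrite /incr ltnNge lo_i i_j /=.
  by case: (bit i z).
have := H j j_Q; rewrite /incr ltnNge lo_j ltnn eqxx /=.
by case: (bit j z).
Qed.

Lemma incr_bound lo j z : carry lo j z -> j < Q -> z < 2 ^ Q -> z + 2 ^ lo < 2 ^ Q.
Proof. by rewrite !lt_pow_div => z_carry j_Q; rewrite (carry_div z_carry). Qed.

Lemma diag_None z : diag z = None <-> z < W /\ ((z < B) \/ (B + size w < z)).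
Proof.
rewrite /diag /diagram; case: ifP => [/andP[zW /orP z_out]|H]; split=> //.
by case=> zW /orP z_out; rewrite zW z_out in H.
Qed.

(** In row 0 the bound on [j] excludes just the carries into [B], where the input begins, and into
    [W], where row 1 begins. *)
Lemma chain_None j z : carry 0 j z -> j < half_bits -> diag z = None -> diag z.+1 = None.
Proof.
move=> z_carry j_b /diag_None[zW z_out]; apply/diag_None.
have := carry_div z_carry j_b; rewrite expn0 addn1.
have B_gt0 := B_gt0; have W2 : W = 2 * B by rewrite expnS.
case: z_out => z_out divE.
  have z1 : z.+1 < B by rewrite lt_pow_div divE (divn_small z_out).
  by split; [lia | left].
have : z.+1 %/ B < 2 by rewrite divE ltn_divLR // -W2.
by rewrite ltn_divLR // -W2 => z1; split=> //; right; lia.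
Qed.

Lemma bit_lt j i : j < 2 ^ i -> bit i j = false.
Proof. by rewrite /bit => /divn_small->. Qed.

Lemma fact_init j i : j < Q -> i < Q ->
  op_bit 2 j 0 0 i 0 0 0 = fact (B + j) i.
Proof.
move=> j_Q i_Q; rewrite fact_bit // /op_bit /= modn2 -/(bit i j) addnC.
have j_B : j < B by apply: ltn_trans j_Q B_gt_addr.
have j_b : ~~ bit half_bits j by rewrite bit_lt.
have [bit_b bit_i _] := bit_add_clear j_b; rewrite addnC in bit_b bit_i *.
by case: eqP => [->|/eqP i_b]; rewrite ?bit_b ?bit_i // addnC.
Qed.

Lemma symbol_init j : j < Q -> op_symbol 2 j 0 0 0 = code (diag (B + j)).
Proof.
move=> j_Q; rewrite /op_symbol /=; have j_B : j < B by apply: ltn_trans j_Q B_gt_addr.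
have W2 : W = 2 * B by rewrite expnS.
have zW : B + j < W by lia.
case: leqP => j_w; last first.
  by congr code; apply/esym/diag_None; split=> //; right; rewrite ltn_add2l.
have z_in : (B + j < B) || (B + size w < B + j) = false by lia.
rewrite /sym_init /diag /diagram zW z_in /=.
rewrite divn_small // modn_small // addn0 /content /= /tape ltnNge leq_addr /= addKn.
rewrite -{2}(addn0 B) eqn_add2l -odflt_onth onth_map.
by congr (code (Some (_, _))); case: onth.
Qed.

(** * Soundness: without an accepting cell, only errors and true facts arise *)

Section Soundness.
Hypothesis no_accepting : forall z, z < 2 ^ Q -> ~~ accepting (diag z).

(** Kinds 0 and 1 always leave an error, kinds 2 and 3 give true facts. For kinds 4 and 5 an error
    in an argument shows up in the same sort of the result; an error-free result thus comes from
    facts, with correct addresses and carries. *)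
Lemma legit_op kind j j' k (same : nat -> bool) x y u :
  j < Q -> j' < Q -> k < Q -> legit x -> legit y -> legit u ->
  legit (fun i => op_value kind j j' k i (same i) (x i) (y i) (u i)).
Proof.
move=> j_Q j'_Q k_Q x_legit y_legit u_legit; have Q_neq i : i < Q -> (i == Q) = false.
  by move=> i_Q; rewrite ltn_eqF.
rewrite /op_value; case: (eqVneq kind 0) => [_|kind0].
  (* The guard is never designated in all sorts: it has an error or a symbol code somewhere, and
     either gives 1 there. *)
  left; case: u_legit => [[i i_Q ui]|[z z_Q uE]].
    by exists i; rewrite //= ui; case: (same i).
  exists Q; rewrite //= uE // fact_symbol /code; by case: (same Q).
case: (eqVneq kind 1) => [->|kind1].
  left; case: x_legit => [[i i_Q xi]|[z z_Q xE]].
    by exists i; rewrite //= xi; case: ifP.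
  exists Q; rewrite //= eqxx xE // fact_symbol /op_symbol /sym_acc /= codeK.
  by rewrite (negPf (no_accepting z_Q)).
case: (eqVneq kind 2) => [->|kind2].
  right; exists (B + j).
    apply: (@leq_trans W); last by rewrite leq_exp2l // /addr_bits leq_addr.
    by have := B_gt_addr; rewrite /width_bits expnS; lia.
  move=> i i_Q; case: eqP => [->|/eqP i_nQ]; first by rewrite fact_symbol -symbol_init.
  have {}i_Q : i < Q by lia.
  by rewrite -fact_init.
case: (eqVneq kind 3) => [->|kind3].
  right; exists 0; first by rewrite expn_gt0.
  move=> i i_Q; rewrite /fact; case: eqP => // _.
    congr code; apply/esym/diag_None; split; first by rewrite expn_gt0.
    by left; exact: B_gt0.
  by rewrite /bit div0n.
apply: legit_or => ne1.
have {}ne1 : forall i, i <= Q -> op_value kind j j' k i (same i) (x i) (y i) (u i) != 1.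
  by move=> i i_Q; rewrite /op_value (negPf kind0); apply: ne1.
have ne1b i : i < Q -> op_bit kind j j' k i (x i) (y i) (u i) != 1.
  by move=> i_Q; have := ne1 i (ltnW i_Q); rewrite /op_value (negPf kind0) Q_neq.
have := ne1 Q (leqnn Q); rewrite /op_value (negPf kind0) eqxx => ne1s.
case: (eqVneq kind 4) => [kindE|kind4].
  subst kind; rewrite /op_bit /= in ne1b; rewrite /op_symbol /= in ne1s.
  have [z z_Q xE] : exists2 z, z < 2 ^ Q & forall i, i <= Q -> x i = fact z i.
    apply: legit_cases x_legit _ => i; rewrite leq_eqVlt => /orP[/eqP->|i_Q].
      by apply/eqP => xi; move: ne1s; rewrite xi; case: (1 == _).
    by apply/eqP => xi; have := ne1b i i_Q; rewrite xi incr_error; case: (j < _).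
  have j_b : j < half_bits.
    by have := ne1b 0 addr_gt0; case: (j < _).
  rewrite j_b in ne1b.
  have z_carry : carry 0 j z.
    by apply: carry_incr => // i i_Q; rewrite -fact_bit // -xE ?ne1b // ltnW.
  have z_None : diag z = None.
    by apply: code_inj; move: ne1s; rewrite xE // fact_symbol; case: (_ =P code None).
  exists (z + 2 ^ 0); first exact: incr_bound z_carry _ _.
  move=> i; rewrite leq_eqVlt => /orP[/eqP->|i_Q].
    rewrite eqxx /op_symbol /= xE // !fact_symbol z_None eqxx addn1.
    by rewrite (chain_None z_carry j_b z_None).
  rewrite Q_neq // /op_bit /= j_b xE; last exact: ltnW.
  by rewrite !fact_bit // incr_carry.
have op_bitE i : op_bit kind j j' k i (x i) (y i) (u i) =
    if [&& width_bits <= k, y i == incr 0 j i (x i), 2 <= y i,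
        u i == incr 0 j' i (y i) & 2 <= u i] then incr width_bits k i (x i) else 1.
  rewrite /op_bit (negPf kind1) (negPf kind2) (negPf kind3) (negPf kind4).
  by do 5?case: ifP.
have op_symE : op_symbol kind j (x Q) (y Q) (u Q) = sym_step M (x Q) (y Q) (u Q).
  by rewrite /op_symbol (negPf kind1) (negPf kind2) (negPf kind3) (negPf kind4).
rewrite op_symE in ne1s.
have conds i : i < Q -> [&& width_bits <= k, y i == incr 0 j i (x i), 2 <= y i,
    u i == incr 0 j' i (y i) & 2 <= u i].
  by move=> i_Q; have := ne1b i i_Q; rewrite op_bitE; case: (andb _ _).
have k_ge : width_bits <= k by case/andP: (conds 0 addr_gt0).
have [z z_Q xE] : exists2 z, z < 2 ^ Q & forall i, i <= Q -> x i = fact z i.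
  apply: legit_cases x_legit _ => i; rewrite leq_eqVlt => /orP[/eqP->|i_Q].
    by apply/eqP => xi; move: ne1s; rewrite xi /sym_step.
  by apply/eqP => xi; have := ne1b i i_Q; rewrite op_bitE xi !incr_error; case: (andb _ _).
have [z' z'_Q yE] : exists2 z, z < 2 ^ Q & forall i, i <= Q -> y i = fact z i.
  apply: legit_cases y_legit _ => i; rewrite leq_eqVlt => /orP[/eqP->|i_Q].
    by apply/eqP => yi; move: ne1s; rewrite yi /sym_step; case: decode.
  by apply/eqP => yi; have /and5P[] := conds i i_Q; rewrite yi.
have [z'' z''_Q uE] : exists2 z, z < 2 ^ Q & forall i, i <= Q -> u i = fact z i.
  apply: legit_cases u_legit _ => i; rewrite leq_eqVlt => /orP[/eqP->|i_Q].
    apply/eqP => ui; move: ne1s; rewrite ui /sym_step.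
    by case: decode => // ?; case: decode.
  by apply/eqP => ui; have /and5P[] := conds i i_Q; rewrite ui.
(* The left sides are 2 or 3, never the error 1; so these equations first certify [l] as the carry
   position of [a] and then determine all bits of [b]. *)
have succ a b l : l < Q -> a < 2 ^ Q -> b < 2 ^ Q ->
    (forall i, i < Q -> 2 + bit i b = incr 0 l i (2 + bit i a)) -> b = a.+1.
  move=> l_Q a_Q b_Q E; have a_carry : carry 0 l a.
    by apply: carry_incr => // i i_Q; rewrite -E.
  have a1 := incr_bound a_carry l_Q a_Q; rewrite -[a.+1]addn1 -[1](expn0 2).
  apply: bit_ext a1 _ => // i i_Q; have := E i i_Q; rewrite (incr_carry _ a_carry).
  by case: bit; case: bit.
have z'E : z' = z.+1.
  apply: (succ z z' j) => // i i_Q.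
  rewrite -(fact_bit z' i_Q) -(fact_bit z i_Q) -(xE i (ltnW i_Q)) -(yE i (ltnW i_Q)).
  by have /and5P[_ /eqP] := conds i i_Q.
have z''E : z'' = z'.+1.
  apply: (succ z' z'' j') => // i i_Q.
  rewrite -(fact_bit z'' i_Q) -(fact_bit z' i_Q) -(yE i (ltnW i_Q)) -(uE i (ltnW i_Q)).
  by have /and5P[_ _ _ /eqP] := conds i i_Q.
have z_carry : carry width_bits k z.
  apply: carry_incr => // i i_Q; rewrite -(fact_bit z i_Q) -(xE i (ltnW i_Q)).
  by have := ne1b i i_Q; rewrite op_bitE conds.
have zW := incr_bound z_carry k_Q z_Q.
exists (z + W) => // i; rewrite leq_eqVlt => /orP[/eqP->|i_Q].
  rewrite eqxx op_symE xE // yE // uE // !fact_symbol /sym_step !codeK.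
  by rewrite /diag (diagram_step M W_big B_gt0 (row_lt zW)) -/(diag _) z''E z'E.
rewrite Q_neq // op_bitE conds // xE; last exact: ltnW.
by rewrite !fact_bit // incr_carry.
Qed.

End Soundness.
End Construction.

Section Matrix.
Variables (M : TM bool bool) (c : nat) (w : seq bool).

Local Notation Q := (addr_bits c w).
Local Notation I := (sorts c w).
Local Notation V := (values M).
Local Notation B := (2 ^ half_bits c w).
Local Notation W := (2 ^ width_bits c w).
Local Notation K := (num_ops c w).
Local Notation fact := (fact M c w).
Local Notation diag := (diag M c w).
Local Notation op_value := (op_value M c w).

Lemma op_value_lt kind j j' k i same x y u : x < V -> op_value kind j j' k i same x y u < V.
Proof.
move=> x_V; have V4 : 4 <= V by rewrite /values leq_addr.
have incr_lt lo l : incr lo l i x < V.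
  by rewrite /incr; repeat match goal with
    |- context [if ?b then _ else _] => case: b end => //; apply: leq_trans V4.
have sym_lt : op_symbol M w kind j x y u < V.
  rewrite /op_symbol /sym_acc /sym_init /sym_step.
  repeat match goal with
  | |- context [if ?b then _ else _] => case: b
  | |- context [decode M ?v] => case: (decode M v) => [?|]
  end; rewrite ?code_lt //; apply: leq_trans V4 => //.
have bit_lt : op_bit c w kind j j' k i x y u < V.
  have mod2 : 2 + (j %/ 2 ^ i) %% 2 < V.
    by apply: leq_trans V4; rewrite modn2; case: odd.
  rewrite /op_bit.
  repeat match goal with
  | |- context [if ?b then _ else _] => case: b
  end; rewrite ?incr_lt ?mod2 //; apply: leq_trans V4 => //.
rewrite /op_value; repeat match goal with
  | |- context [if ?b then _ else _] => case: b
  end => //; apply: leq_trans V4 => //.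
Qed.

(** The index [o] is read in mixed radix with [kind] as lowest digit. An element is
    [value * I + sort], so the designated ones, of value 0, form the initial segment that the
    encoding requires. The result keeps the sort of [x]. *)
Definition opcode (o x y u : nat) : nat :=
  op_value (o %% 6) (o %/ 6 %% Q) (o %/ 6 %/ Q %% Q) (o %/ 6 %/ Q %/ Q %% Q)
    (x %% I) (x == y) (x %/ I) (y %/ I) (u %/ I) * I + x %% I.

Definition last_elt : nat := (V * I).-1.

Lemma last_eltE : last_elt.+1 = V * I.
Proof. by rewrite /last_elt prednK // muln_gt0. Qed.

Lemma elt_lt v s : v < V -> s < I -> v * I + s < last_elt.+1.
Proof. by rewrite last_eltE; move: (I) (V) => i n; nia. Qed.

Lemma opcode_lt o x y u : o < K -> x < last_elt.+1 -> y < last_elt.+1 ->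
  u < last_elt.+1 -> opcode o x y u < last_elt.+1.
Proof.
rewrite {1}last_eltE => _ x_lt _ _; apply: elt_lt; last by rewrite ltn_mod.
by apply: op_value_lt; rewrite ltn_divLR.
Qed.

Lemma sorts_le : I <= last_elt.+1.
Proof. by rewrite last_eltE leq_pmull. Qed.

Definition matrix : fmat := ternary_fmat last_elt I K opcode.

Lemma matrix_wf : fm_wf matrix.
Proof. by apply: ternary_wf; [exact: opcode_lt | exact: sorts_le]. Qed.

Local Notation D := matrix.
Local Notation LM := (fm_matrix matrix).
Local Notation T := (term (fm_sig matrix)).

Definition nval (x : malg LM) : nat := nat_of_ord (x : 'I_last_elt.+1).

Lemma nval_inj : injective nval. Proof. exact: val_inj. Qed.

Lemma mfilt_nval x : mfilt LM x = (nval x < I). Proof. by []. Qed.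

Definition op_index (kind j j' k : nat) : nat := kind + 6 * (j + Q * (j' + Q * k)).

Lemma op_index_lt kind j j' k : kind < 6 -> j < Q -> j' < Q -> k < Q -> op_index kind j j' k < K.
Proof.
rewrite /op_index /num_ops !expnS expn0 muln1; move: (Q) => q H1 H2 H3 H4.
have : j' + q * k < q * q by nia.
move: (j' + q * k) => r r_q; have : j + q * r < q * (q * q) by nia.
lia.
Qed.

Lemma opcode_index kind j j' k x y u : kind < 6 -> j < Q -> j' < Q -> k < Q ->
  opcode (op_index kind j j' k) x y u =
  op_value kind j j' k (x %% I) (x == y) (x %/ I) (y %/ I) (u %/ I) * I + x %% I.
Proof.
move=> k6 jQ j'Q kQ; rewrite /opcode /op_index.
have Q_gt0 : 0 < Q by [].
have -> : (kind + 6 * (j + Q * (j' + Q * k))) %% 6 = kind.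
  by rewrite addnC mulnC modnMDl modn_small.
have -> : (kind + 6 * (j + Q * (j' + Q * k))) %/ 6 = j + Q * (j' + Q * k).
  by rewrite addnC mulnC divnMDl // divn_small // addn0.
have -> : (j + Q * (j' + Q * k)) %% Q = j.
  by rewrite addnC mulnC modnMDl modn_small.
have -> : (j + Q * (j' + Q * k)) %/ Q = j' + Q * k.
  by rewrite addnC mulnC divnMDl // divn_small // addn0.
have -> : (j' + Q * k) %% Q = j' by rewrite addnC mulnC modnMDl modn_small.
have -> : (j' + Q * k) %/ Q = k by rewrite addnC mulnC divnMDl // divn_small // addn0.
by rewrite (modn_small kQ).
Qed.

Definition op_term (kind j j' k : nat) (t1 t2 t3 : T) : T :=
  app3 (op_index kind j j' k) t1 t2 t3.

Lemma eval_op_term kind j j' k t1 t2 t3 (v : nat -> malg LM) :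
  kind < 6 -> j < Q -> j' < Q -> k < Q ->
  nval (eval v (op_term kind j j' k t1 t2 t3)) =
  op_value kind j j' k (nval (eval v t1) %% I) (nval (eval v t1) == nval (eval v t2))
    (nval (eval v t1) %/ I) (nval (eval v t2) %/ I) (nval (eval v t3) %/ I) * I +
  nval (eval v t1) %% I.
Proof.
move=> k6 jQ j'Q kQ; rewrite -opcode_index //.
have o_K := op_index_lt k6 jQ j'Q kQ.
rewrite /op_term /nval (eval_app3 t1 t2 t3 v o_K).
by apply: ternary_opE o_K; apply: opcode_lt.
Qed.

(** The term looks only at the sort of its variable, and so represents the tuple [g]. *)
Definition computes (t : T) (g : nat -> nat) :=
  vars_in (fun x => x = 0) t /\
  forall v, nval (eval v t) = g (nval (v 0) %% I) * I + nval (v 0) %% I.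

Lemma computes_const kind j g : kind < 6 -> j < Q ->
    (forall s same x y u, s <= Q -> op_value kind j 0 0 s same x y u = g s) ->
  computes (op_term kind j 0 0 (Var _ 0) (Var _ 0) (Var _ 0)) g.
Proof.
move=> k6 jQ E; split; first by apply: vars_in_app3.
by move=> v; rewrite eval_op_term //= E // -ltnS ltn_mod.
Qed.

Lemma computes_op kind j j' k t1 t2 t3 g1 g2 g3 g :
    kind < 6 -> j < Q -> j' < Q -> k < Q ->
    computes t1 g1 -> computes t2 g2 -> computes t3 g3 ->
    (forall s same, s <= Q -> op_value kind j j' k s same (g1 s) (g2 s) (g3 s) = g s) ->
  computes (op_term kind j j' k t1 t2 t3) g.
Proof.
move=> k6 jQ j'Q kQ [vars1 E1] [vars2 E2] [vars3 E3] E.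
split; first by apply: vars_in_app3.
move=> v; rewrite eval_op_term // E1 E2 E3; set s := nval (v 0) %% I.
have s_I : s < I by rewrite ltn_mod.
by rewrite !modnMDl !(modn_small s_I) !divnMDl // !(divn_small s_I) !addn0 E.
Qed.

Lemma fact_zero s same x y u : s <= Q -> op_value 3 0 0 0 s same x y u = fact 0 s.
Proof.
move=> s_Q; rewrite /op_value /= /fact; case: eqP => [_|_]; last by rewrite /bit div0n.
by congr code; apply/esym/diag_None; split; [rewrite expn_gt0|left; apply: B_gt0].
Qed.

Lemma fact_input j s same x y u : j < Q -> s <= Q ->
  op_value 2 j 0 0 s same x y u = fact (B + j) s.
Proof.
move=> j_Q; rewrite /op_value /= leq_eqVlt => /orP[/eqP->|s_Q].
  by rewrite eqxx fact_symbol -symbol_init.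
by rewrite ltn_eqF // -fact_init.
Qed.

Lemma fact_chain j z s same y u : carry 0 j z -> j < half_bits c w -> diag z = None ->
  s <= Q -> op_value 4 j 0 0 s same (fact z s) y u = fact z.+1 s.
Proof.
move=> z_carry j_b z_None; rewrite /op_value /= leq_eqVlt => /orP[/eqP->|s_Q].
  rewrite eqxx /op_symbol /= !fact_symbol z_None (chain_None z_carry j_b z_None).
  by rewrite eqxx.
by rewrite ltn_eqF // /op_bit /= j_b !fact_bit // incr_carry // addn1.
Qed.

Lemma fact_step j j' k z s same : carry 0 j z -> carry 0 j' z.+1 ->
  carry (width_bits c w) k z -> z + W < 2 ^ Q -> s <= Q ->
  op_value 5 j j' k s same (fact z s) (fact z.+1 s) (fact z.+2 s) = fact (z + W) s.
Proof.
move=> j_carry j'_carry k_carry z_lt; rewrite /op_value /= leq_eqVlt => /orP[/eqP->|s_Q].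
  rewrite eqxx /op_symbol /= !fact_symbol /sym_step !codeK.
  by rewrite /diag (diagram_step M (W_big c w) (B_gt0 c w) (row_lt z_lt)).
rewrite ltn_eqF // /op_bit /= !fact_bit // !incr_carry // !addn1.
have -> : width_bits c w <= k by case: k_carry.
by rewrite !eqxx.
Qed.

Lemma carry_below lo z : z + 2 ^ lo < 2 ^ Q -> lo <= Q -> exists2 j, j < Q & carry lo j z.
Proof.
move=> z_lt lo_Q; case: (carry_exists z lo_Q) => // E.
by move: z_lt; rewrite lt_pow_div E.
Qed.

(** Completeness: induction on the address works because each cell depends on smaller addresses
    only; in row 0 a marked blank comes from its left neighbour. *)
Lemma fact_computable z : z < 2 ^ Q -> exists t, computes t (fact z).
Proof.
have B0 := B_gt0 c w; have W2 : W = 2 * B by rewrite expnS.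
have B_Q := B_gt_addr c w; have Q0 := addr_gt0 c w.
elim/ltn_ind: z => z IH z_Q; case: (ltnP z W) => z_W; last first.
  have zE : z = z - W + W by rewrite subnK.
  move: (z - W) zE => y zE; subst z; rewrite W2 in IH z_Q *.
  have [t1 t1P] := IH y ltac:(lia) ltac:(lia).
  have [t2 t2P] := IH y.+1 ltac:(lia) ltac:(lia).
  have [t3 t3P] := IH y.+2 ltac:(lia) ltac:(lia).
  rewrite -W2 in z_Q *.
  have [j j_Q j_carry] : exists2 j, j < Q & carry 0 j y by apply: carry_below; rewrite // expn0; lia.
  have [j' j'_Q j'_carry] : exists2 j, j < Q & carry 0 j y.+1 by apply: carry_below; rewrite // expn0; lia.
  have [k k_Q k_carry] : exists2 j, j < Q & carry (width_bits c w) j y.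
    by apply: carry_below; rewrite // leq_addr.
  exists (op_term 5 j j' k t1 t2 t3).
  by apply: (computes_op _ _ _ _ t1P t2P t3P) => // s same; apply: fact_step.
case: (posnP z) => [->|z_gt0].
  exists (op_term 3 0 0 0 (Var _ 0) (Var _ 0) (Var _ 0)).
  by apply: computes_const => //; apply: fact_zero.
(* The range reaches one beyond [B + size w]: that cell is the first marked blank on the right and
   starts the chain there. *)
case: (boolP ((B <= z) && (z <= B + (size w).+1))) => [/andP[z_B z_w]|z_out].
  have j_Q : z - B < Q.
    by apply: (@leq_ltn_trans (size w).+1); [lia|rewrite /addr_bits /width_bits /half_bits; lia].
  exists (op_term 2 (z - B) 0 0 (Var _ 0) (Var _ 0) (Var _ 0)).
  rewrite -{2}(subnKC z_B); apply: computes_const => // s same x y u.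
  exact: fact_input.
case: z z_gt0 => // y _ in IH z_Q z_W z_out *.
have y_None : diag y = None by apply/diag_None; split; [lia|]; case: (ltnP y B); [left|right; lia].
have [t tP] := IH y (ltnSn y) (ltnW z_Q).
case: (carry_exists y (leq0n (half_bits c w))) => [[j j_b j_carry]|E].
  have j_Q : j < Q by apply: (leq_trans j_b); rewrite /addr_bits /width_bits; lia.
  exists (op_term 4 j 0 0 t t t).
  by apply: (computes_op _ _ _ _ tP tP tP) => // s same; apply: fact_chain.
(* An overflow would make [y.+1] a positive multiple of [B] below [2 * B], that is [B] itself, which
   was treated as an input cell. *)
exfalso; move: E; rewrite expn0 addn1; case: (ltnP y.+1 B) => y_B.
  by rewrite divn_small.
have y_B' : B <= y by lia.
have -> : y.+1 = 1 * B + (y.+1 - B) by lia.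
have {2}-> : y = 1 * B + (y - B) by lia.
by rewrite !divnMDl // !divn_small; lia.
Qed.

(** * Reducedness, algebraizability and absence of theorems *)

Definition eq_term : T := op_term 0 0 0 0 (Var _ 0) (Var _ 1) (Var _ 2).

Lemma eval_op0 t1 t2 t3 (v : nat -> malg LM) : nval (eval v t3) < I ->
  nval (eval v (op_term 0 0 0 0 t1 t2 t3)) =
  (nval (eval v t1) != nval (eval v t2)) * I + nval (eval v t1) %% I.
Proof.
by move=> t3_I; rewrite eval_op_term // /op_value /= (divn_small t3_I) /=; case: (_ == _).
Qed.

Lemma filter_op0 t1 t2 t3 (v : nat -> malg LM) : nval (eval v t3) < I ->
  mfilt LM (eval v (op_term 0 0 0 0 t1 t2 t3)) <-> eval v t1 = eval v t2.
Proof.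
move=> t3_I; rewrite mfilt_nval eval_op0 //; case: eqP => [/nval_inj->|ne] /=.
  by rewrite mul0n add0n ltn_mod.
by rewrite mul1n ltnNge leq_addr; split=> // E; case: ne; rewrite E.
Qed.

(** The designated parameter [top] opens the guard: comparison with [a] maps [a] into the filter,
    hence also [b], whatever the machine does. *)
Lemma matrix_separated (th : malg LM -> malg LM -> Prop) a b :
  is_congruence th -> compatible th (mfilt LM) -> th a b -> a = b.
Proof.
move=> th_congr th_compat ab; pose top : malg LM := ord0.
have top_I : nval top < I by [].
pose v x : malg LM := nth top [:: a; a] x; pose v' x : malg LM := nth top [:: a; b] x.
suff : mfilt LM (eval v' eq_term) by move/(filter_op0 _ _ (t3 := Var _ 2) (v := v')); apply.
apply: (th_compat (eval v eq_term)).
  have th_refl := proj1 th_congr.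
  by apply: eval_congr th_congr _ => -[|[|x]]; rewrite /v /v' //=; apply: th_refl.
by apply/filter_op0.
Qed.

Lemma matrix_reduced : reduced LM.
Proof.
move=> a b; split=> [[th [[th_congr [th_compat _]] ab]]|->].
  exact: matrix_separated th_congr th_compat ab.
exists eq; split=> //; split; last split.
- split=> //; split; first by move=> x y ->.
  split; first by move=> x y z -> ->.
  by move=> i x y xy; congr ops; apply: functional_extensionality.
- by move=> x y ->.
- by move=> th th_congr th_compat x y; apply: matrix_separated.
Qed.

(** The theorem [thm] takes the place of the parameter. As each sort has a single designated
    element, [x] is designated iff it equals the result of comparing it with itself. *)
Lemma matrix_algebraizable : (exists2 z, z < 2 ^ Q & accepting (diag z)) ->
  algebraizable (logic_of LM).
Proof.
case=> z z_Q z_acc; have [t tP] := fact_computable z_Q.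
have [thm_vars thmE] : computes (op_term 1 0 0 0 t t t) (fun=> 0).
  apply: (computes_op _ _ _ _ tP tP tP) => // s same.
  rewrite /op_value /= leq_eqVlt => /orP[/eqP->|s_Q].
    by rewrite eqxx /op_symbol /= fact_symbol /sym_acc codeK z_acc.
  by rewrite ltn_eqF // fact_bit // /op_bit /=; case: bit.
set thm := op_term 1 0 0 0 t t t in thm_vars thmE.
have thm_I v : nval (eval v thm) < I by rewrite thmE mul0n ltn_mod.
pose delta := op_term 0 0 0 0 (Var _ 0) (Var _ 1) thm.
have delta_vars : vars_in (fun x => x <= 1) delta.
  apply: vars_in_app3 => //; elim/term_induction: (thm) thm_vars => [x /= ->|i args args_vars H j] //.
  by apply: args_vars; apply: H.
have deltaP (v : nat -> malg LM) : mfilt LM (eval v delta) <-> v 0 = v 1.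
  exact: filter_op0.
split; first exact: equivalential_delta delta_vars deltaP.
pose top := op_term 0 0 0 0 (Var _ 0) (Var _ 0) thm.
apply: (truth_equational_delta (s := Var _ 0) (t := top) delta_vars deltaP) => //.
  by apply: vars_in_app3.
move=> v; rewrite mfilt_nval; split=> [v_I|E].
  by apply: nval_inj; rewrite eval_op0 // eqxx mul0n add0n modn_small.
by have := congr1 nval E; rewrite eval_op0 // eqxx mul0n add0n /= => ->; rewrite ltn_mod.
Qed.

(** In sort [i] all variables take the error value, so the tuples start out [legit] and remain so. A
    theorem would give value 0 in every sort, but a [legit] tuple contains a 1 or a symbol code. *)
Lemma matrix_no_theorem : (forall z, z < 2 ^ Q -> ~~ accepting (diag z)) ->
  forall t, ~ valid LM t.
Proof.
move=> no_acc t t_valid; have V2 : 1 < V by rewrite /values.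
pose v (i x : nat) : malg LM := inord (1 * I + i).
have vE i x : i <= Q -> nval (v i x) = 1 * I + i.
  by move=> i_Q; rewrite /nval inordK //; apply: elt_lt.
pose S (X : nat -> 'I_last_elt.+1) :=
  (forall i, i <= Q -> X i %% I = i) /\ legit M c w (fun i => X i %/ I).
have : S (fun i => eval (v i) t).
  apply: eval_closed.
    move=> x; split=> [i i_Q|].
      by have := vE i x i_Q; rewrite /nval => ->; rewrite modnMDl modn_small.
    left; exists 0 => //; have := vE 0 x (leq0n _); rewrite /nval => ->.
    by rewrite divnMDl // divn_small.
  move=> o X Y U o_K [X_sort X_legit] [Y_sort Y_legit] [U_sort U_legit].
  have opE i : i <= Q -> ternary_op opcode o (X i) (Y i) (U i) =
      op_value (o %% 6) (o %/ 6 %% Q) (o %/ 6 %/ Q %% Q) (o %/ 6 %/ Q %/ Q %% Q) i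
        (X i == Y i :> nat) (X i %/ I) (Y i %/ I) (U i %/ I) * I + i :> nat.
    by move=> i_Q; rewrite (ternary_opE opcode_lt) // /opcode X_sort.
  split=> [i i_Q|]; first by rewrite opE // modnMDl modn_small.
  have Q_gt0 : 0 < Q by [].
  have := @legit_op M c w no_acc (o %% 6) (o %/ 6 %% Q) (o %/ 6 %/ Q %% Q)
    (o %/ 6 %/ Q %/ Q %% Q) (fun i => X i == Y i :> nat) _ _ _
    (ltn_pmod _ Q_gt0) (ltn_pmod _ Q_gt0) (ltn_pmod _ Q_gt0) X_legit Y_legit U_legit.
  have divE i : i <= Q -> ternary_op opcode o (X i) (Y i) (U i) %/ I =
      op_value (o %% 6) (o %/ 6 %% Q) (o %/ 6 %/ Q %% Q) (o %/ 6 %/ Q %/ Q %% Q) i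
        (X i == Y i :> nat) (X i %/ I) (Y i %/ I) (U i %/ I).
    by move=> i_Q; rewrite opE // divnMDl // (@divn_small i I) // addn0.
  case=> [[i i_Q E]|[z z_Q E]]; [left; exists i | right; exists z] => //.
    by rewrite divE.
  by move=> i i_Q; rewrite divE ?E.
have t0 i : eval (v i) t %/ I = 0.
  by rewrite divn_small //; have := t_valid (v i); rewrite mfilt_nval.
case=> _ [[i _]|[z _ /(_ Q (leqnn Q))]]; rewrite t0 //.
by rewrite fact_symbol.
Qed.

Lemma matrix_two_elements : exists a b : malg LM, a <> b.
Proof.
have V2 : 1 < V by rewrite /values.
exists (inord (0 * I + 0)), (inord (1 * I + 0)) => /(congr1 nval).
by rewrite /nval !inordK //; apply: elt_lt.
Qed.

Lemma matrix_in_class K : (exists2 z, z < 2 ^ Q & accepting (diag z)) <->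
  in_class K (logic_of LM).
Proof.
split=> [acc|]; first by apply/in_class_algebraizable/matrix_algebraizable.
(* The search is bounded, so it is settled by a boolean quantifier. *)
move=> in_K; case: (boolP [exists z : 'I_(2 ^ Q), accepting (diag z)]) => [/existsP[z]|].
  by exists z.
move=> /existsPn no_acc; exfalso.
have no_thm : forall t, ~ valid LM t.
  by apply: matrix_no_theorem => z z_Q; apply: (no_acc (Ordinal z_Q)).
have [a [b ab]] := matrix_two_elements.
apply: not_in_class in_K; first exact: (not_protoalgebraic matrix_reduced ab no_thm).
exact: not_truth_equational.
Qed.

End Matrix.

(** * The reduction is polynomial-time *)

Section Expressions.
Variables (M : TM bool bool) (c : nat).
Local Notation V := (values M).

(** The machine is fixed while the input varies, so its finite functions become constant look-up
    tables. *)
Fixpoint e_table (k : nat) (s : seq nat) (e : expr) : expr :=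
  if s is x :: s' then EIfEq e (ECst k) (ECst x) (e_table k.+1 s' e) else ECst 0.

Definition e_incr (lo j i a : expr) : expr :=
  EIfLe (EBin Add i (ECst 1)) lo a
    (EIfLe (EBin Add i (ECst 1)) j (EIfEq a (ECst 3) (ECst 2) (ECst 1))
      (EIfEq i j (EIfEq a (ECst 2) (ECst 3) (ECst 1)) a)).

Definition e_pow : expr := iter c (EBin Mul (EVar 0)) (ECst 1).
Definition e_row : expr := EBin Add (EBin Add e_pow (ECst c)) (ECst 1).
Definition e_half : expr := EBin Add (EBin Add e_row (EVar 0)) (ECst 3).
Definition e_width : expr := EBin Add e_half (ECst 1).
Definition e_addr : expr := EBin Add e_width e_row.
Definition e_sorts : expr := EBin Add e_addr (ECst 1).
Definition e_elts : expr := EBin Mul (ECst V) e_sorts.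
Definition e_cube (e : expr) : expr := EBin Mul e (EBin Mul e e).
Definition e_num_ops : expr := EBin Mul (ECst 6) (e_cube e_addr).

Definition e_sym_acc (x : expr) : expr := e_table 0 (mkseq (sym_acc M) V) x.
(** Three codes are packed as the base-[V] digits of one table index. *)
Definition e_sym_step (x y u : expr) : expr :=
  e_table 0 (mkseq (fun t => sym_step M (t %/ V %/ V) (t %/ V %% V) (t %% V)) (V * V * V))
    (EBin Add (EBin Mul (EBin Add (EBin Mul x (ECst V)) y) (ECst V)) u).
Definition e_sym_input (first : bool) (j : expr) : expr :=
  e_table 0 [:: sym_init M first None; sym_init M first (Some false);
                sym_init M first (Some true)] (EInp j).
Definition e_none : expr := ECst (code (None : symbol M)).

Definition e_op_symbol (kind j x y u : expr) : expr :=
  EIfEq kind (ECst 1) (e_sym_acc x)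
  (EIfEq kind (ECst 2)
    (EIfLe j (EVar 0)
      (EIfEq j (ECst 0) (e_sym_input true j) (e_sym_input false j)) e_none)
  (EIfEq kind (ECst 3) e_none
  (EIfEq kind (ECst 4) (EIfEq x e_none x (ECst 1))
  (e_sym_step x y u)))).

Definition e_op_bit (kind j j' k i x y u : expr) : expr :=
  EIfEq kind (ECst 1) (EIfEq x (ECst 2) (ECst 0) (EIfEq x (ECst 3) (ECst 0) (ECst 1)))
  (EIfEq kind (ECst 2)
    (EIfEq i e_half (ECst 3) (EBin Add (ECst 2) (EBin Mod (EBin Shr j i) (ECst 2))))
  (EIfEq kind (ECst 3) (ECst 2)
  (EIfEq kind (ECst 4)
    (EIfLe (EBin Add j (ECst 1)) e_half (e_incr (ECst 0) j i x) (ECst 1))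
  (EIfLe e_width k
    (EIfEq y (e_incr (ECst 0) j i x)
      (EIfLe (ECst 2) y
        (EIfEq u (e_incr (ECst 0) j' i y)
          (EIfLe (ECst 2) u (e_incr e_width k i x) (ECst 1))
        (ECst 1))
      (ECst 1))
    (ECst 1))
  (ECst 1))))).

Definition e_op_value (kind j j' k i X Y x y u : expr) : expr :=
  EIfEq kind (ECst 0) (EIfEq X Y (EIfEq u (ECst 0) (ECst 0) (ECst 1)) (ECst 1))
  (EIfEq i e_addr (e_op_symbol kind j x y u) (e_op_bit kind j j' k i x y u)).

Definition e_opcode (o x y u : expr) : expr :=
  let o1 := EBin Div o (ECst 6) in
  let o2 := EBin Div o1 e_addr in
  let o3 := EBin Div o2 e_addr in
  EBin Add (EBin Mul
    (e_op_value (EBin Mod o (ECst 6)) (EBin Mod o1 e_addr) (EBin Mod o2 e_addr)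
       (EBin Mod o3 e_addr) (EBin Mod x e_sorts) x y (EBin Div x e_sorts)
       (EBin Div y e_sorts) (EBin Div u e_sorts)) e_sorts) (EBin Mod x e_sorts).

(** Variables 2 and 4 are the indices of the two nested loops, namely operation and table position;
    1 and 3 hold the loop bounds, and 0 the input length. *)
Definition e_entry : expr :=
  let o := EVar 2 in let t := EVar 4 in
  EBin Add (e_opcode o (EBin Div t (EBin Mul e_elts e_elts))
    (EBin Mod (EBin Div t e_elts) e_elts) (EBin Mod t e_elts)) (ECst 1).

Section Values.
Variables (w : seq bool) (env : nat -> nat).
Hypothesis env0 : env 0 = size w.
Local Notation ev := (ev w env).

Lemma ev_table k s e : ev (e_table k s e) = if k <= ev e then nth 0 s (ev e - k) else 0.
Proof.
elim: s k => [|x s IH] k; first by rewrite nth_nil if_same.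
rewrite [LHS]/= IH; case: (ltngtP k (ev e)) => [k_lt|//|<-]; last by rewrite subnn.
by have -> : ev e - k = (ev e - k.+1).+1 by lia.
Qed.

Lemma ev_incr lo j i a : ev (e_incr lo j i a) = incr (ev lo) (ev j) (ev i) (ev a).
Proof. by rewrite /= !addn1. Qed.

Lemma ev_row : ev e_row = row_bits c w.
Proof.
rewrite /= addn1; congr (_ + _).+1; rewrite /e_pow.
by elim: c => //= k ->; rewrite env0 expnS.
Qed.

Lemma ev_half : ev e_half = half_bits c w.
Proof. by rewrite -[LHS]/(ev e_row + env 0 + 3) ev_row env0. Qed.

Lemma ev_width : ev e_width = width_bits c w.
Proof. by rewrite -[LHS]/(ev e_half + 1) ev_half addn1. Qed.

Lemma ev_addr : ev e_addr = addr_bits c w.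
Proof. by rewrite -[LHS]/(ev e_width + ev e_row) ev_width ev_row. Qed.

Lemma ev_sorts : ev e_sorts = sorts c w.
Proof. by rewrite -[LHS]/(ev e_addr + 1) ev_addr addn1. Qed.

Lemma ev_elts : ev e_elts = (last_elt M c w).+1.
Proof. by rewrite -[LHS]/(V * ev e_sorts) ev_sorts last_eltE. Qed.

Lemma ev_cube e : ev (e_cube e) = ev e ^ 3.
Proof. by rewrite !expnS expn0 muln1. Qed.

Lemma ev_num_ops : ev e_num_ops = num_ops c w.
Proof. by rewrite -[LHS]/(6 * ev (e_cube e_addr)) ev_cube ev_addr. Qed.

Lemma ev_sym_acc x : ev x < V -> ev (e_sym_acc x) = sym_acc M (ev x).
Proof. by move=> x_V; rewrite ev_table subn0 nth_mkseq. Qed.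

Lemma ev_sym_step x y u : ev x < V -> ev y < V -> ev u < V ->
  ev (e_sym_step x y u) = sym_step M (ev x) (ev y) (ev u).
Proof.
move=> x_V y_V u_V; rewrite ev_table subn0 [ev _]/=; move: V x_V y_V u_V => v x_V y_V u_V.
have v_gt0 : 0 < v by apply: leq_trans x_V.
rewrite nth_mkseq; last by move: (ev x) (ev y) (ev u) x_V y_V u_V => X Y U; nia.
by rewrite divnMDl // modnMDl (divn_small u_V) addn0 divnMDl // modnMDl
  (divn_small y_V) addn0 !modn_small.
Qed.

Lemma ev_sym_input first j : ev (e_sym_input first j) = sym_init M first (onth w (ev j)).
Proof.
rewrite ev_table subn0 [ev _]/= /input_code.
by case: (onth w (ev j)) => [[]|].
Qed.

Lemma ev_op_symbol kind j x y u : ev x < V -> ev y < V -> ev u < V ->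
  ev (e_op_symbol kind j x y u) = op_symbol M w (ev kind) (ev j) (ev x) (ev y) (ev u).
Proof.
move=> x_V y_V u_V; rewrite /op_symbol -(ev_sym_acc x_V) -(ev_sym_step x_V y_V u_V).
have -> : sym_init M (ev j == 0) (onth w (ev j)) =
    if ev j == 0 then ev (e_sym_input true j) else ev (e_sym_input false j).
  by rewrite !ev_sym_input; case: (ev j == 0).
by rewrite -env0.
Qed.

Lemma ev_op_bit kind j j' k i x y u : ev (e_op_bit kind j j' k i x y u) =
  op_bit c w (ev kind) (ev j) (ev j') (ev k) (ev i) (ev x) (ev y) (ev u).
Proof.
rewrite /op_bit -ev_half -ev_width -!(ev_incr (ECst 0)) -ev_incr.
by rewrite -(addn1 (ev j)).
Qed.

Lemma ev_op_value kind j j' k i X Y x y u : ev x < V -> ev y < V -> ev u < V ->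
  ev (e_op_value kind j j' k i X Y x y u) =
  op_value M c w (ev kind) (ev j) (ev j') (ev k) (ev i) (ev X == ev Y) (ev x) (ev y) (ev u).
Proof.
move=> x_V y_V u_V; rewrite /op_value -(ev_op_symbol kind j x_V y_V u_V).
by rewrite -(ev_op_bit kind j j' k i x y u) -ev_addr.
Qed.

Lemma ev_opcode o x y u : ev x < (last_elt M c w).+1 -> ev y < (last_elt M c w).+1 ->
  ev u < (last_elt M c w).+1 ->
  ev (e_opcode o x y u) = opcode M c w (ev o) (ev x) (ev y) (ev u).
Proof.
rewrite last_eltE => x_lt y_lt u_lt.
have ev_div a b : ev (EBin Div a b) = ev a %/ ev b by [].
have ev_mod a b : ev (EBin Mod a b) = ev a %% ev b by [].
have lt e : ev e < V * sorts c w -> ev (EBin Div e e_sorts) < V.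
  by rewrite ev_div ev_sorts ltn_divLR.
have E kind j j' k i :=
  ev_op_value kind j j' k i x y (lt x x_lt) (lt y y_lt) (lt u u_lt).
have -> : ev (e_opcode o x y u) = ev (e_op_value (EBin Mod o (ECst 6))
    (EBin Mod (EBin Div o (ECst 6)) e_addr)
    (EBin Mod (EBin Div (EBin Div o (ECst 6)) e_addr) e_addr)
    (EBin Mod (EBin Div (EBin Div (EBin Div o (ECst 6)) e_addr) e_addr) e_addr)
    (EBin Mod x e_sorts) x y (EBin Div x e_sorts) (EBin Div y e_sorts)
    (EBin Div u e_sorts)) * ev e_sorts + ev (EBin Mod x e_sorts) by [].
by rewrite E !(ev_mod, ev_div) ev_addr ev_sorts.
Qed.

Lemma ev_entry : env 4 < (last_elt M c w).+1 ^ 3 ->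
  let N := (last_elt M c w).+1 in
  ev e_entry = (opcode M c w (env 2) (env 4 %/ N ^ 2) (env 4 %/ N %% N) (env 4 %% N)).+1.
Proof.
move=> t_lt N; set x := EBin Div (EVar 4) (EBin Mul e_elts e_elts).
set y := EBin Mod (EBin Div (EVar 4) e_elts) e_elts; set u := EBin Mod (EVar 4) e_elts.
have xE : ev x = env 4 %/ N ^ 2.
  by rewrite -[LHS]/(env 4 %/ (ev e_elts * ev e_elts)) ev_elts expnS expn1.
have yE : ev y = env 4 %/ N %% N by rewrite -[LHS]/(env 4 %/ ev e_elts %% ev e_elts) ev_elts.
have uE : ev u = env 4 %% N by rewrite -[LHS]/(env 4 %% ev e_elts) ev_elts.
rewrite -[LHS]/(ev (e_opcode (EVar 2) x y u) + 1) addn1 ev_opcode.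
- by rewrite xE yE uE.
- by rewrite xE -/N ltn_divLR ?expn_gt0 // -expnS.
- by rewrite yE ltn_mod.
- by rewrite uE ltn_mod.
Qed.

End Values.

Section Variables.
Variable v : nat.
Hypothesis v_gt0 : 0 < v.

Lemma vars_table k s e : vars_lt v e -> vars_lt v (e_table k s e).
Proof. by move=> e_v; elim: s k => //= x s IH k; rewrite e_v IH. Qed.

Lemma vars_incr lo j i a : vars_lt v lo -> vars_lt v j -> vars_lt v i -> vars_lt v a ->
  vars_lt v (e_incr lo j i a).
Proof. by move=> /= -> -> -> ->. Qed.

Lemma vars_row : vars_lt v e_row.
Proof.
rewrite -[vars_lt _ _]/(vars_lt v e_pow && true && true) !andbT /e_pow.
by elim: c => //= k ->; rewrite v_gt0.
Qed.

Lemma vars_half : vars_lt v e_half.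
Proof. by rewrite -[vars_lt _ _]/(vars_lt v e_row && (0 < v) && true) vars_row v_gt0. Qed.

Lemma vars_width : vars_lt v e_width.
Proof. by rewrite -[vars_lt _ _]/(vars_lt v e_half && true) vars_half. Qed.

Lemma vars_addr : vars_lt v e_addr.
Proof. by rewrite -[vars_lt _ _]/(vars_lt v e_width && vars_lt v e_row) vars_width vars_row. Qed.

Lemma vars_sorts : vars_lt v e_sorts.
Proof. by rewrite -[vars_lt _ _]/(vars_lt v e_addr && true) vars_addr. Qed.

Lemma vars_elts : vars_lt v e_elts.
Proof. by rewrite -[vars_lt _ _]/(vars_lt v e_sorts) vars_sorts. Qed.

Lemma vars_bin op a b : vars_lt v a -> vars_lt v b -> vars_lt v (EBin op a b).
Proof. by move=> /= -> ->. Qed.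

Lemma vars_ifeq a b e e' : vars_lt v a -> vars_lt v b -> vars_lt v e -> vars_lt v e' ->
  vars_lt v (EIfEq a b e e').
Proof. by move=> /= -> -> -> ->. Qed.

Lemma vars_ifle a b e e' : vars_lt v a -> vars_lt v b -> vars_lt v e -> vars_lt v e' ->
  vars_lt v (EIfLe a b e e').
Proof. by move=> /= -> -> -> ->. Qed.

Lemma vars_op_value kind j j' k i X Y x y u :
    vars_lt v kind -> vars_lt v j -> vars_lt v j' -> vars_lt v k -> vars_lt v i ->
    vars_lt v X -> vars_lt v Y -> vars_lt v x -> vars_lt v y -> vars_lt v u ->
  vars_lt v (e_op_value kind j j' k i X Y x y u).
Proof.
move=> *; have := (vars_half, vars_width, vars_addr) => -[[half width] addr].
by do ![assumption | apply: vars_ifeq | apply: vars_ifle | apply: vars_incr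
       | apply: vars_bin | apply: vars_table | done].
Qed.

Lemma vars_entry : 4 < v -> vars_lt v e_entry.
Proof.
move=> v4; have := (vars_elts, vars_sorts, vars_addr) => -[[elts sorts'] addr].
have v2 : 2 < v by apply: ltn_trans v4.
by do ![assumption | apply: vars_op_value | apply: vars_bin | done].
Qed.

End Variables.
End Expressions.

Lemma flatten_map_flatten (A B C : Type) (h : B -> seq C) (F : A -> seq B) s :
  flatten (map h (flatten (map F s))) = flatten [seq flatten (map h (F x)) | x <- s].
Proof. by elim: s => //= x s IH; rewrite map_cat flatten_cat IH. Qed.

Lemma encode_ternary N1 m K f : encode (ternary_fmat N1 m K f) =
  enc_num N1.+1 ++ (enc_num m ++ (enc_num K ++
  flatten [seq enc_num 3 ++ flatten [seq enc_num (f o (t %/ N1.+1 ^ 2)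
      (t %/ N1.+1 %% N1.+1) (t %% N1.+1)).+1 | t <- iota 0 (N1.+1 ^ 3)] | o <- iota 0 K])).
Proof.
rewrite /encode /fm_numbers map_cat flatten_cat flatten_map_flatten.
rewrite -[fm_ops _]/[seq (3, table N1 f o) | o <- iota 0 K] size_map size_iota -map_comp.
rewrite -[fm_n _]/N1.+1 -[fm_m _]/m [map enc_num [:: _; _; _]]/= [flatten [:: _; _; _]]/=.
rewrite cats0 -(catA (enc_num N1.+1)) -(catA (enc_num m)).
do 3!congr (_ ++ _); congr flatten; apply: eq_map => o.
rewrite -[(_ \o _) o]/(enc_num 3 ++ flatten (map enc_num (table N1 f o))).
by rewrite /table -map_comp.
Qed.

Lemma reduction_polytime M c : polytime_computable (fun w => encode (matrix M c w)).
Proof.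
pose p d e := PLet e (PPrint d) d.
pose prog := Seq (p 1 (e_elts M c)) (Seq (p 1 (e_sorts c)) (Seq (p 1 (e_num_ops c))
  (PFor (e_num_ops c) (Seq (p 3 (ECst 3)) (PFor (e_cube (e_elts M c)) (p 5 (e_entry M c)) 3)) 1))).
have vars_cube v e : vars_lt v e -> vars_lt v (e_cube e) by move=> /= ->.
have vars_ops v : 0 < v -> vars_lt v (e_num_ops c).
  by move=> v0; apply: vars_bin => //; apply/vars_cube/vars_addr.
have := @emits_polytime prog _ (emits_seq (emits_print (vars_elts M c (isT : 0 < 1)))
  (emits_seq (emits_print (vars_sorts c (isT : 0 < 1)))
  (emits_seq (emits_print (vars_ops 1 isT))
  (emits_for (vars_ops 1 isT) (emits_seq (@emits_print 3 (ECst 3) isT)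
    (emits_for (vars_cube 3 _ (vars_elts M c (isT : 0 < 3)))
      (emits_print (vars_entry M c (isT : 0 < 5) (isT : 4 < 5))))))))).
congr polytime_computable; apply: functional_extensionality => w.
set env : nat -> nat := fun=> size w; have env0 : env 0 = size w by [].
rewrite (ev_elts M c env0) (ev_sorts c env0) (ev_num_ops c env0).
rewrite /matrix encode_ternary !printed_numberE //; do 3!congr (_ ++ _).
congr flatten; apply/eq_in_map => o; rewrite mem_iota add0n => /andP[_ o_lt].
set env1 := upd _ _ _; have env10 : env1 0 = size w by [].
have env12 : env1 2 = o by [].
rewrite ev_cube (ev_elts M c env10) printed_numberE //; congr (_ ++ _).
congr flatten; apply/eq_in_map => t; rewrite mem_iota add0n => /andP[_ t_lt].
set env2 := upd _ _ _; have env20 : env2 0 = size w by [].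
have [env24 env22] : env2 4 = t /\ env2 2 = o by [].
have := @ev_entry M c w env2 env20; rewrite env24 env22 => -> //.
by rewrite printed_numberE.
Qed.

Theorem theorem5p5 (K : logic_class) : EXPTIME_hard (problem K).
Proof.
move=> L [M [c M_decides]]; exists (fun w => encode (matrix M c w)).
split; first exact: reduction_polytime.
move=> w; set T := 2 ^ (size w ^ c + c).
have [T_halt T_acc] : tm_halt M (tm_run M T w).1.1 /\
    (tm_accept M (tm_run M T w).1.1 <-> L w).
  by have := M_decides w; rewrite -/T; case: tm_run => [[q l] r].
have W_gt := W_big c w; have B_gt := B_gt0 c w.
have T_gt0 : 0 < T by rewrite expn_gt0.
have RE : 2 ^ row_bits c w = 2 * T by rewrite expnS.
have T_B : 2 * T < 2 ^ half_bits c w.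
  by rewrite -RE ltn_exp2l // /half_bits; lia.
have acc : (exists2 z, z < 2 ^ addr_bits c w & accepting (diag M c w z)) <-> L w.
  rewrite -T_acc; split=> [[z z_lt z_acc]|acc_T].
    exact: diagram_accepting z_acc T_halt.
  have [z z_lt z_acc] := accepting_diagram W_gt B_gt T_B T_gt0 T_halt acc_T.
  (* The address space has [2 * T] rows of width [W], enough for the rows 0 to [T]. *)
  exists z => //; apply: leq_trans z_lt _; rewrite /addr_bits expnD mulnC leq_mul //.
  by rewrite RE; lia.
rewrite -acc; split=> [z_acc|[D [DE [D_wf [_ D_K]]]]].
  exists (matrix M c w); split=> //; split; first exact: matrix_wf.
  by split; [exact: matrix_reduced | apply/matrix_in_class].
have matrixD : matrix M c w = D by apply: encode_inj D_wf DE; apply: matrix_wf.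
by apply/(matrix_in_class M c w K); rewrite matrixD.
Qed.
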